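(* Let $n$ be a positive integer, let $\lambda\in\mathbb R$ (possibly depending on $n$) and let $k$ be an integer. Suppose that $-n^{1/12}\le \lambda \le \frac15 n^{1/12}$ and $(3\lambda\vee 1)n^{2/3}\le k \le n^{3/4}$, and put $a=k/n^{2/3}$. Let $L_1$ be the number of vertices in a largest connected component of the Erdős–Rényi graph $G(n,p_{n,\lambda})$, $p_{n,\lambda}=n^{-1}+\lambda n^{-4/3}$, with law $\mathbb P_{n,\lambda}$. Then (a) $\displaystyle \mathbb P_{n,\lambda}(L_1 = k) = \frac{k^{1/2}}{(8\pi)^{1/2}n} e^{-G_\lambda(a)} (1+O(E_1)) + O(E_2)$, (b) $\displaystyle \mathbb P_{n,\lambda}(L_1 \ge k) = \frac{a^{1/2}}{(8\pi)^{1/2}G'_\lambda(a)}e^{-G_\lambda(a)} (1+O(E_1)) + O(E_2)$, where $E_1=E_1(k,n,\lambda) = \frac{k^4}{n^3} + \frac{|\lambda|}{n^{1/12}} + \frac{|\lambda|^3 k}{n} + \frac{n^{2/3}}{k} + \frac{1}{n^{1/10}}$ and $E_2=E_2(n)=n^{1/4}e^{-n^{1/4}/80}$.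
   Context: $G(n,p)$ is the random graph on $n$ labelled vertices in which each pair of vertices is joined by an edge independently with probability $p$. $G_\lambda(x) = \frac{x^3}{8} - \frac{\lambda x^2}{2} + \frac{\lambda^2 x}{2} = \frac{x}{8}(x-2\lambda)^2$, and $G'_\lambda$ is its derivative in $x$. $x\vee y=\max(x,y)$. Asymptotic notation: an identity $f=g(1+O(h))+O(h')$ means there is an absolute constant $C<\infty$ (not depending on $n,k,\lambda$) such that $|f-g|\le C|g|h+Ch'$ for all sufficiently large $n$ and all parameters satisfying the hypotheses. *)

(* Defs.v *)
From HB Require Import structures.
From mathcomp Require Import all_boot all_order all_algebra.
From mathcomp Require Import all_classical all_reals all_analysis.
Set Implicit Arguments. Unset Strict Implicit. Unset Printing Implicit Defensive.
Import Order.TTheory GRing.Theory Num.Theory.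
Local Open Scope ring_scope.

Section ER.
Variable R : realType.

Definition pot_edges (n : nat) : {set 'I_n * 'I_n} := [set e : 'I_n * 'I_n | (e.1 < e.2)%N].

(* A graph is a set E of potential edges; adjacency is symmetric. *)
Definition adj (n : nat) (E : {set 'I_n * 'I_n}) : rel 'I_n :=
  fun i j => ((i, j) \in E) || ((j, i) \in E).

Definition comp (n : nat) (E : {set 'I_n * 'I_n}) (v : 'I_n) : {set 'I_n} :=
  [set w | connect (adj E) v w].

Definition L1 (n : nat) (E : {set 'I_n * 'I_n}) : nat :=
  \max_(v : 'I_n) #|comp E v|.

(* Probability of an event (a boolean predicate on graphs) under G(n,p):
   each of the n(n-1)/2 edges is present independently with prob. p. *)
Definition Gnp_prob (n : nat) (p : R) (A : pred {set 'I_n * 'I_n}) : R :=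
  \sum_(E in powerset (pot_edges n) | A E)
     p ^+ #|E| * (1 - p) ^+ (#|pot_edges n| - #|E|)%N.

Definition p_nl (n : nat) (lam : R) : R :=
  (n%:R)^-1 + lam * powR n%:R (-(4%:R / 3%:R)).

Definition Glam (lam x : R) : R :=
  x ^+ 3 / 8%:R - lam * x ^+ 2 / 2%:R + lam ^+ 2 * x / 2%:R.
Definition Glam' (lam x : R) : R :=
  3%:R * x ^+ 2 / 8%:R - lam * x + lam ^+ 2 / 2%:R.

Definition E1 (k n : nat) (lam : R) : R :=
  (k%:R) ^+ 4 / (n%:R) ^+ 3 + `|lam| / powR n%:R (1 / 12%:R)
  + `|lam| ^+ 3 * k%:R / n%:R + powR n%:R (2%:R / 3%:R) / k%:R
  + 1 / powR n%:R (1 / 10%:R).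

Definition E2 (n : nat) : R :=
  powR n%:R (1 / 4%:R) * expR (- (powR n%:R (1 / 4%:R) / 80%:R)).

End ER.

(* Main.v *)
From HB Require Import structures.
From mathcomp Require Import all_boot all_order all_algebra.
From mathcomp Require Import reals.
From mathcomp Require Import ring lra zify.
Require Import Defs.
Set Implicit Arguments. Unset Strict Implicit. Unset Printing Implicit Defensive.
Import Order.TTheory GRing.Theory Num.Theory.
Local Open Scope ring_scope.

(* First and second moments for the number N_j of components of size j, whose mean
   is C(n,j) P_j (1-p)^(j(n-j)) with P_j the probability that G(j,p) is connected.
   One has E N_k (1 - sum_(j >= k) E_(n-k) N_j) <= P(L1 = k) <= E N_k, and the
   subtracted sum is O((n^(2/3) / k)^3) because G(n-k,p) is subcritical.

   P_k is estimated without enumerating connected graphs: explore the cluster of a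
   vertex, each other vertex being a ball that falls into the box of the first
   explored vertex adjacent to it. Given that all balls fall into the k boxes, the
   graph is connected iff the queue never empties; its probability (kp)^2/2 (1+o(1))
   follows from exponential martingales with a tilt s, bounding the survival
   probability from above and from below. The binomial factors are estimated by
   Stirling's formula and give the exponent - G_lam(a).

   For (b), the sum of (a) over k <= j <= n^(3/4) telescopes up to a relative error,
   sqrt x e^(-G) being close to minus the derivative of sqrt x e^(-G) / G'; the
   sizes j > n^(3/4) contribute O(E_2) by a Chernoff bound for the exploration.
   Fractional powers of n are written as powers of r = n^(1/60). *)

(** * Exploration of a cluster *)

(** The exploration is never constructed on the graph: it exists only as the recursion [busy], and
    the two sides meet because both solve the triangular system saying that the component of a
    vertex has some size. Conditioning and tilting are one parameter [c] of [survival], so each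
    martingale argument reduces to the polynomial identity [survival_sum]. The obstacle is the end
    of the conditioned exploration: with [l] boxes and about [l] balls left the next box gets about
    [1 + l p / 2] balls on average, and this drift vanishes. [survival_telescope] writes the
    probability of full survival as a sum of survival probabilities at all times with weights near
    [p / 2]. Survival has probability about [x = k p] at almost all times (twice the initial drift
    [x / 2], as for a branching process), which gives [k * (p / 2) * x = x ^ 2 / 2]. In the lower
    bound the loss comes from an initial and a final stretch of relative length [c], with
    [k c ^ 3 x ^ 2] of order 1. As [k x ^ 2] is about [a ^ 3], [c] is of order [1 / a], the term
    [n^(2/3) / k] of [E1]. *)

Section Omega.
Variable R : realFieldType.
Implicit Types (p c : R) (M N i m k : nat).

(* Explore a cluster vertex by vertex: each further vertex falls into the box of
   the first explored vertex adjacent to it, box [j] having mass [p * (1 - p) ^ j].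
   [busy p i N] is the probability that [N] given vertices all fall into the first
   [i] boxes and that the exploration queue does not empty before step [i]. *)
Fixpoint busy p i N : R :=
  if i is i'.+1 then
    if (i'.+1 <= N)%N then
      \sum_(j < N.+1) 'C(N, j)%:R * (p * (1 - p) ^+ i') ^+ (N - j) * busy p i' j
    else 0
  else (N == 0)%:R.

(* For [c = 0], the probability that the cluster of a given vertex of [G(M+1, p)]
   has more than [i] vertices. A positive [c] lowers the mass left for the later
   boxes: [c = (1 - p) ^ (M + 1)] restricts to the event that all vertices fall into
   the first [M + 1] boxes, any other [c] is an exponential tilt. *)
Definition survival p M i c : R :=
  \sum_(N < M.+1) 'C(M, N)%:R * busy p i N * ((1 - p) ^+ i - c) ^+ (M - N).

Lemma busy_small p i N : (N < i)%N -> busy p i N = 0.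
Proof. by case: i => [|i] //= h; rewrite ltnNge in h; rewrite (negbTE h). Qed.

Lemma busy_ge0 p i N : 0 <= p <= 1 -> 0 <= busy p i N.
Proof.
move=> /andP[p0 p1]; elim: i N => [|i IH] N /=; first by rewrite ler0n.
case: ifP => // _; apply: sumr_ge0 => j _.
by rewrite !mulr_ge0 ?ler0n ?exprn_ge0 ?mulr_ge0 ?exprn_ge0 ?subr_ge0.
Qed.

Lemma mul_bin_trinomial M N j : (j <= N <= M)%N ->
  ('C(M, N) * 'C(N, j) = 'C(M, j) * 'C(M - j, N - j))%N.
Proof.
move=> /andP[jN NM].
have jM := leq_trans jN NM.
apply/eqP; rewrite -(eqn_pmul2r (fact_gt0 j)) -(eqn_pmul2r (fact_gt0 (N - j))).
rewrite -(eqn_pmul2r (fact_gt0 (M - N))); apply/eqP.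
have e1 := bin_fact NM; have e2 := bin_fact jN; have e3 := bin_fact jM.
have /bin_fact e4 : (N - j <= M - j)%N by rewrite leq_sub2r.
rewrite (_ : (M - j - (N - j) = M - N)%N) in e4; last by rewrite subnBA // subnK.
transitivity M`!; [rewrite -e1 -e2; ring | rewrite -e3 -e4; ring].
Qed.

(** The loss is the death of the queue at step [i + 1]: exactly [i] balls in the first [i] boxes and
    none in the next. Expanding the power of the mass [D + p * Q ^ i] left after [i] boxes
    distributes the unplaced balls between the next box and the later ones. *)
Lemma survival_step p M i c :
  survival p M i.+1 c =
  survival p M i c - 'C(M, i)%:R * busy p i i * ((1 - p) ^+ i.+1 - c) ^+ (M - i).
Proof.
set Q : R := 1 - p; set D : R := Q ^+ i.+1 - c.
have eD : Q ^+ i - c = D + p * Q ^+ i by rewrite /D /Q exprS; ring.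
have -> : survival p M i c = \sum_(N < M.+1) 'C(M, N)%:R * D ^+ (M - N) *
    \sum_(j < N.+1) 'C(N, j)%:R * (p * Q ^+ i) ^+ (N - j) * busy p i j.
  transitivity (\sum_(N < M.+1) \sum_(j < M.+1 | (j <= N)%N) 'C(M, N)%:R * D ^+ (M - N) *
     ('C(N, j)%:R * (p * Q ^+ i) ^+ (N - j) * busy p i j)); last first.
    apply: eq_bigr => N _; rewrite mulr_sumr.
    rewrite (big_ord_widen_cond M.+1 xpredT (fun j => 'C(M, N)%:R * D ^+ (M - N) *
     ('C(N, j)%:R * (p * Q ^+ i) ^+ (N - j) * busy p i j))); last by rewrite ltn_ord.
    by apply: eq_bigl => j; rewrite ltnS.
  rewrite (exchange_big_dep xpredT) //=; apply: eq_bigr => j _.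
  rewrite -/Q eD exprDn.
  have jM : (j <= M)%N by rewrite -ltnS.
  rewrite mulr_sumr -(big_mkord xpredT (fun l => 'C(M, j)%:R * busy p i j *
     (D ^+ (M - j - l) * (p * Q ^+ i) ^+ l *+ 'C(M - j, l)))).
  rewrite -(big_mkord (fun N => (j <= N)%N) (fun N => 'C(M, N)%:R * D ^+ (M - N) *
     ('C(N, j)%:R * (p * Q ^+ i) ^+ (N - j) * busy p i j))).
  rewrite [RHS](@big_cat_nat _ _ _ j) //=; last by lia.
  rewrite [X in _ = X + _](_ : _ = 0) ?add0r; last first.
    by rewrite big_nat_cond big1 // => N /andP[/andP[_ h1] h2]; lia.
  rewrite [RHS]big_nat_cond [RHS](_ : _ = \sum_(0 + j <= N < M.+1) 'C(M, N)%:R * D ^+ (M - N) *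
     ('C(N, j)%:R * (p * Q ^+ i) ^+ (N - j) * busy p i j)); last first.
    by rewrite add0n [RHS]big_nat_cond; apply: eq_bigl => N; case: (leqP j N); rewrite ?andbF ?andbT.
  rewrite [RHS]big_addn subSn //.
  rewrite big_nat_cond [RHS]big_nat_cond; apply: eq_bigr => l /andP[/andP[_ lM] _].
  have h : (j <= l + j <= M)%N. by lia.
  have := mul_bin_trinomial h.
  rewrite addnK => e.
  have e' : 'C(M, l + j)%:R * 'C(l + j, j)%:R = 'C(M, j)%:R * 'C(M - j, l)%:R :> R.
    by rewrite -!natrM e.
  rewrite (_ : (M - (l + j) = M - j - l)%N); last by lia.
  rewrite -[_ *+ 'C(_, _)]mulr_natr.
  transitivity ('C(M, l + j)%:R * 'C(l + j, j)%:R * D ^+ (M - j - l) *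
    (p * Q ^+ i) ^+ l * busy p i j); last by ring.
  rewrite e'; ring.
rewrite /survival -/Q -/D.
(* The guard in [busy] discards only [N = i]: for [N < i] the convolution is already 0, as
   [busy p i j] vanishes for [j < i]. *)
have inner N : \sum_(j < N.+1) 'C(N, j)%:R * (p * Q ^+ i) ^+ (N - j) * busy p i j =
   busy p i.+1 N + (N == i)%:R * busy p i i.
  rewrite /= -/Q; case: ifP => [iN|/negbT]; first by rewrite gtn_eqF // mul0r addr0.
  rewrite -ltnNge ltnS leq_eqVlt => /orP[/eqP ->|Ni].
    rewrite eqxx mul1r add0r big_ord_recr /= big1 ?add0r; last first.
      by move=> j _; rewrite busy_small ?mulr0 // ltn_ord.
    by rewrite binn subnn expr0 !mul1r.
  rewrite ltn_eqF // mul0r addr0 big1 // => j _.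
  by rewrite busy_small ?mulr0 //; apply: leq_trans Ni; rewrite ltn_ord.
under [in RHS]eq_bigr => N _ do rewrite inner mulrDr.
rewrite big_split /= (_ : \sum_(N < M.+1) 'C(M, N)%:R * D ^+ (M - N) *
  ((val N == i)%:R * busy p i i) = 'C(M, i)%:R * busy p i i * D ^+ (M - i)); last first.
  have [iM|Mi] := leqP i M; last first.
    rewrite bin_small // !mul0r big1 // => N _.
    have NM : (N <= M)%N by rewrite -ltnS.
    by rewrite (ltn_eqF (leq_ltn_trans NM Mi)) mul0r mulr0.
  rewrite -ltnS in iM; rewrite (bigD1 (Ordinal iM)) //= eqxx mul1r big1 ?addr0.
    by ring.
  by move=> N /negbTE; rewrite -val_eqE /= => ->; rewrite mul0r mulr0.
by rewrite addrK; apply: eq_bigr => N _; rewrite mulrAC.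
Qed.

Lemma survival0 p M c : survival p M 0 c = (1 - c) ^+ M.
Proof.
rewrite /survival big_ord_recl big1 ?addr0; last by move=> i _; rewrite /= mulr0 mul0r.
by rewrite /= bin0 expr0 subn0 !mul1r.
Qed.

Lemma survival_small p M m c : (M < m)%N -> survival p M m c = 0.
Proof.
move=> h; rewrite /survival big1 // => N _; rewrite busy_small ?mulr0 ?mul0r //.
by apply: leq_ltn_trans h; rewrite -ltnS.
Qed.

Lemma survival_sum p M m c :
  survival p M m c = (1 - c) ^+ M -
   \sum_(i < m) 'C(M, i)%:R * busy p i i * ((1 - p) ^+ i.+1 - c) ^+ (M - i).
Proof.
elim: m => [|m IH]; first by rewrite big_ord0 subr0 survival0.
by rewrite survival_step IH big_ord_recr /= opprD addrA.
Qed.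

Lemma survival_diag p M c : survival p M M c = busy p M M.
Proof.
rewrite /survival big_ord_recr /= binn subnn expr0 mul1r mulr1 big1 ?add0r //.
by move=> i _; rewrite busy_small ?mulr0 ?mul0r // ltn_ord.
Qed.

Lemma survival_ge0 p M i c : 0 <= p <= 1 -> c <= (1 - p) ^+ i -> 0 <= survival p M i c.
Proof.
move=> hp hc; apply: sumr_ge0 => N _.
by rewrite !mulr_ge0 ?ler0n ?busy_ge0 ?exprn_ge0 ?subr_ge0.
Qed.

(** The terms lost with [M + 1] and with [M] balls are proportional, because [(M + 1 - i) C(M + 1,
    i) = (M + 1) C(M, i)]; this combination cancels them and leaves a multiple of [survival] itself.
    It serves twice: for the mean cluster size ([c = 0]) and for the probability of connectedness
    ([c = (1 - p) ^ (M + 2)]). *)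
Lemma survival_telescope_step p M i c :
  (1 - p) ^+ i - c != 0 -> (1 - p) ^+ i.+1 - c != 0 ->
  let g i := (M.+2%:R - i%:R) * survival p M.+1 i c / ((1 - p) ^+ i - c)
             - M.+1%:R * survival p M i c in
  g i.+1 - g i = survival p M.+1 i c *
    ((M.+1%:R - i%:R) / ((1 - p) ^+ i.+1 - c) - (M.+2%:R - i%:R) / ((1 - p) ^+ i - c)).
Proof.
move=> h0 h1 /=; rewrite !survival_step.
set D0 := (1 - p) ^+ i - c in h0 *; set D1 := (1 - p) ^+ i.+1 - c in h1 *.
have e : (M.+1%:R - i%:R) * 'C(M.+1, i)%:R * D1 ^+ (M.+1 - i) =
   M.+1%:R * 'C(M, i)%:R * D1 * D1 ^+ (M - i).
  have [iM|] := leqP i M.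
    rewrite subSn // exprS -natrB ?leqW //.
    have /(congr1 (fun x => x%:R : R)) := mul_bin_down M.+1 i.
    rewrite !natrM /= subSn // => ->; ring.
  rewrite leq_eqVlt => /orP[/eqP <-|h]; first by rewrite subrr !mul0r bin_small // !(mul0r, mulr0).
  by rewrite !bin_small ?(ltnW h) // ?(mul0r, mulr0).
rewrite [i.+1%:R]mulrSr.
have -> : M.+2%:R = M.+1%:R + 1 :> R by rewrite [LHS]mulrSr.
set X := D1 ^+ (M.+1 - i) in e *; set Y := D1 ^+ (M - i) in e *.
have e2 : (M.+1%:R - i%:R) * 'C(M.+1, i)%:R * X / D1 = M.+1%:R * 'C(M, i)%:R * Y.
  by rewrite e; field.
transitivity ((M.+1%:R - i%:R) * survival p M.+1 i c / D1 -
   busy p i i * ((M.+1%:R - i%:R) * 'C(M.+1, i)%:R * X / D1 - M.+1%:R * 'C(M, i)%:R * Y)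
   - (M.+1%:R + 1 - i%:R) * survival p M.+1 i c / D0); first by ring.
by rewrite e2; ring.
Qed.

Lemma survival_telescope p M c m :
  (forall i, (i <= m)%N -> (1 - p) ^+ i - c != 0) ->
  (M.+2%:R - m%:R) * survival p M.+1 m c / ((1 - p) ^+ m - c) - M.+1%:R * survival p M m c =
  (1 - c) ^+ M + \sum_(i < m) survival p M.+1 i c *
    ((M.+1%:R - i%:R) / ((1 - p) ^+ i.+1 - c) - (M.+2%:R - i%:R) / ((1 - p) ^+ i - c)).
Proof.
elim: m => [|m IH] h.
  rewrite big_ord0 addr0 !survival0 expr0 subr0 exprSr.
  have c1 : 1 - c != 0 by have := h 0%N isT; rewrite expr0.
  by rewrite mulrA mulfK // [M.+2%:R]mulrSr; ring.
rewrite big_ord_recr /= addrA -IH; last by move=> i im; apply: h; exact: leqW.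
have := @survival_telescope_step p M m c (h _ (leqnSn m)) (h _ (leqnn _)) => /= <-.
by ring.
Qed.

(* [\sum_(i <= M) P(|C(v)| > i)] is the mean cluster size in [G(M+1, p)]. *)
Lemma sum_survival_le p M : 0 <= p -> M.+2%:R * p < 1 ->
  \sum_(i < M.+2) survival p M.+1 i 0 <= (1 - M.+2%:R * p)^-1.
Proof.
move=> p0 hM.
have p1 : p < 1.
  apply: le_lt_trans hM; rewrite ler_peMl // ler1n //.
have Qi i : 0 < (1 - p) ^+ i by rewrite exprn_gt0 // subr_gt0.
have hp : 0 <= p <= 1 by rewrite p0 ltW.
have d0 : 0 < 1 - M.+2%:R * p by rewrite subr_gt0.
have Q0 i : (1 - p) ^+ i - 0 != 0 by rewrite subr0 gt_eqF.
have := @survival_telescope p M 0 M.+2 (fun i _ => Q0 i); rewrite !survival_small //.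
rewrite !(mulr0, mul0r) !subr0 expr1n => e.
(* At time [M + 2] nothing survives, so the telescoped identity says that this weighted sum is 1;
   each weight is at least [1 - (M + 2) p]. *)
have {}e : \sum_(i < M.+2) survival p M.+1 i 0 * ((1 - (M.+2%:R - i%:R) * p) / (1 - p) ^+ i.+1) = 1.
  transitivity (- \sum_(i < M.+2) survival p M.+1 i 0 * ((M.+1%:R - i%:R) / ((1 - p) ^+ i.+1 - 0)
     - (M.+2%:R - i%:R) / ((1 - p) ^+ i - 0))); last by lra.
  rewrite -sumrN; apply: eq_bigr => i _.
  have := gt_eqF (Qi i) => h; have h1 : (1 - p != 0) by rewrite subr_eq0 gt_eqF.
  rewrite !subr0 exprS [M.+2%:R]mulrSr.
  by field; rewrite h h1.
rewrite -[leRHS]mul1r ler_pdivlMr // -[leRHS]e mulr_suml.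
apply: ler_sum => i _; apply: ler_wpM2l; first by rewrite survival_ge0 // ltW.
rewrite ler_pdivlMr //.
apply: (@le_trans _ _ (1 - M.+2%:R * p)).
  by apply: ler_piMr; [exact: ltW | apply: exprn_ile1; lra].
rewrite lerB // ler_wpM2r // gerBl //.
Qed.

Lemma survival_le_pow p M m c : 0 <= p <= 1 -> c <= (1 - p) ^+ m ->
  survival p M m c <= (1 - c) ^+ M.
Proof.
move=> hp hc; rewrite survival_sum gerBl; apply: sumr_ge0 => i _.
rewrite !mulr_ge0 ?ler0n ?busy_ge0 // exprn_ge0 // subr_ge0.
apply: (le_trans hc); move: hp => /andP[p0 p1].
by rewrite ler_wiXn2l ?subr_ge0 //; lra.
Qed.

(* Chernoff bound: survival up to time [m] forces [m] of the [M] balls into the first [m] boxes. *)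
Lemma survival0_chernoff p M m z : 0 <= p <= 1 -> 1 <= z -> (m <= M)%N ->
  z ^+ m * survival p M m 0 <= (1 + (1 - (1 - p) ^+ m) * (z - 1)) ^+ M.
Proof.
move=> hp z1 mM; have z0 : 0 < z by apply: lt_le_trans z1.
have [p0 p1] := andP hp.
have Qm0 : 0 <= (1 - p) ^+ m by rewrite exprn_ge0 // subr_ge0.
(* With this [c] the mass left after [m] boxes is divided by [z]; after multiplication by [z ^ M]
   each placed ball carries a factor [z], and at least [m] balls are placed. *)
pose c := (1 - p) ^+ m * (1 - z^-1).
have eD : (1 - p) ^+ m - c = (1 - p) ^+ m / z by rewrite /c; ring.
have hc : c <= (1 - p) ^+ m by rewrite -subr_ge0 eD divr_ge0 // ltW.
have e1 : 1 + (1 - (1 - p) ^+ m) * (z - 1) = z * (1 - c).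
  by rewrite /c; field; rewrite gt_eqF.
rewrite e1 exprMn.
apply: (@le_trans _ _ (z ^+ M * survival p M m c)); last first.
  by rewrite ler_wpM2l ?exprn_ge0 ?(ltW z0) // survival_le_pow.
rewrite /survival !mulr_sumr; apply: ler_sum => N _.
have [Nm|mN] := ltnP N m; first by rewrite busy_small // !(mulr0, mul0r).
rewrite eD subr0 expr_div_n.
have NM : (N <= M)%N by rewrite -ltnS.
have e2 : z ^+ M = z ^+ (M - N) * z ^+ N by rewrite -exprD subnK.
have zz : z ^+ (M - N) != 0 by rewrite expf_neq0 // gt_eqF.
rewrite e2 [leRHS](_ : _ = z ^+ N * ('C(M, N)%:R * busy p m N * ((1 - p) ^+ m) ^+ (M - N))).
  apply: ler_wpM2r; last by rewrite ler_weXn2l.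
  by rewrite !mulr_ge0 ?ler0n ?busy_ge0 ?exprn_ge0 ?subr_ge0.
by move: zz; set Z := z ^+ (M - N); set W := _ ^+ (M - N); move=> zz; field.
Qed.

Lemma survival_antitone p M i m c : 0 <= p <= 1 -> c <= (1 - p) ^+ m -> (i <= m)%N ->
  survival p M m c <= survival p M i c.
Proof.
move=> hp hc im; rewrite !survival_sum lerB //.
rewrite -!(big_mkord xpredT (fun i => 'C(M, i)%:R * busy p i i * ((1 - p) ^+ i.+1 - c) ^+ (M - i))).
rewrite (@big_cat_nat _ _ _ i 0 m) //= lerDl big_nat; apply: sumr_ge0 => j /andP[_ jm].
rewrite !mulr_ge0 ?ler0n ?busy_ge0 // exprn_ge0 // subr_ge0.
apply: (le_trans hc); move: hp => /andP[p0 p1].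
by rewrite ler_wiXn2l ?subr_ge0 //; lra.
Qed.

Section Conditioned.
(* The exploration started from one vertex and conditioned to have found all
   [M] other vertices by time [k = M + 1]: each of them falls into box [j <= k]
   with probability proportional to [Q ^ (j - 1)], and [cond_survival i] is the probability
   that the queue has not emptied up to time [i]. *)
Variables (p : R) (M : nat).
Hypothesis p01 : 0 < p < 1.
Let Q := 1 - p.
Let k := M.+1.
Definition hit_prob := 1 - (1 - p) ^+ M.+1.
Definition box_mass j := (1 - p) ^+ j - (1 - p) ^+ M.+1.
Definition cond_survival i := survival p M i ((1 - p) ^+ M.+1) / hit_prob ^+ M.
Definition tilt s j := 1 + s / box_mass j.
Let dead i := 'C(M, i)%:R * busy p i i * box_mass i.+1 ^+ (M - i) / hit_prob ^+ M.

Let p0 : 0 < p. Proof. by case/andP: p01. Qed.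
Let p1 : p < 1. Proof. by case/andP: p01. Qed.
Let hp : 0 <= p <= 1. Proof. by rewrite !ltW. Qed.
Let Q0 : 0 < 1 - p. Proof. by rewrite subr_gt0. Qed.
Let Q1 : 1 - p < 1. Proof. by rewrite ltrBlDr ltrDl. Qed.

Lemma hit_prob_gt0 : 0 < hit_prob.
Proof. by rewrite /hit_prob subr_gt0 exprn_ilt1 // ltW. Qed.

Lemma box_mass_gt0 j : (j <= M)%N -> 0 < box_mass j.
Proof. by move=> jM; rewrite /box_mass subr_gt0 ltr_iXn2l. Qed.

Let qM0 : 0 < hit_prob ^+ M. Proof. by rewrite exprn_gt0 // hit_prob_gt0. Qed.

Let dead_ge0 i : (i < M)%N -> 0 <= dead i.
Proof.
move=> iM; rewrite /dead divr_ge0 ?(ltW qM0) // !mulr_ge0 ?ler0n ?busy_ge0 //.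
by rewrite exprn_ge0 // ltW // box_mass_gt0.
Qed.

Let cond_survivalE m : cond_survival m = 1 - \sum_(i < m) dead i.
Proof.
rewrite /cond_survival survival_sum -/hit_prob mulrBl divff ?gt_eqF //; congr (_ - _).
by rewrite mulr_suml; apply: eq_bigr.
Qed.

Lemma cond_survival_ge0 i : (i <= M)%N -> 0 <= cond_survival i.
Proof.
move=> iM; rewrite divr_ge0 ?(ltW qM0) // survival_ge0 //.
by rewrite -subr_ge0 ltW // box_mass_gt0.
Qed.

Lemma cond_survival_le1 i : (i <= M)%N -> cond_survival i <= 1.
Proof.
move=> iM; rewrite cond_survivalE gerBl; apply: sumr_ge0 => j _.
by rewrite dead_ge0 // (leq_trans _ iM).
Qed.

Lemma cond_survival_antitone i j : (i <= j <= M)%N -> cond_survival j <= cond_survival i.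
Proof.
move=> /andP[ij jM]; rewrite ler_wpM2r ?invr_ge0 ?(ltW qM0) // survival_antitone //.
by rewrite -subr_ge0 ltW // box_mass_gt0.
Qed.

Let tilt_ge1 s j : 0 <= s -> (j <= M)%N -> 1 <= tilt s j.
Proof. by move=> s0 jM; rewrite lerDl divr_ge0 // ltW // box_mass_gt0. Qed.

(** Optional stopping for [tilt s j] raised to the number of unplaced balls. It is [survival_sum] at
    [c = (1 - p) ^ (M + 1) - s], for which the mass left after [j] boxes is [box_mass j * tilt s j].
    [X] collects the runs alive at time [m], which have at most [M - m] unplaced balls. *)
Let tilt_mart s m : 0 <= s -> (m <= M)%N ->
  exists2 X, 0 <= X <= tilt s m ^+ (M - m) * cond_survival m &
  \sum_(i < m) dead i * tilt s i.+1 ^+ (M - i) + X = tilt s 0 ^+ M.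
Proof.
move=> s0 mM; exists (survival p M m ((1 - p) ^+ M.+1 - s) / hit_prob ^+ M).
  apply/andP; split.
    rewrite divr_ge0 ?(ltW qM0) // survival_ge0 // lerBlDr -lerBlDl.
    by rewrite (le_trans _ s0) // subr_le0 -subr_ge0 ltW // box_mass_gt0.
  rewrite /cond_survival mulrA ler_wpM2r ?invr_ge0 ?(ltW qM0) // /survival mulr_sumr; apply: ler_sum => N _.
  have [Nm|mN] := ltnP N m; first by rewrite busy_small // !(mulr0, mul0r).
  have D0 := box_mass_gt0 mM; have := tilt_ge1 s0 mM => t1.
  rewrite -/(box_mass m) [X in X ^+ (M - N)](_ : _ = box_mass m * tilt s m); last first.
    by rewrite /tilt /box_mass; field; rewrite -/(box_mass m) gt_eqF.
  rewrite exprMn mulrA mulrC ler_wpM2r //; last by rewrite ler_weXn2l // leq_sub2l.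
  by rewrite !mulr_ge0 ?ler0n ?busy_ge0 ?exprn_ge0 // ltW.
rewrite survival_sum mulrBl.
have -> : (1 - ((1 - p) ^+ M.+1 - s)) ^+ M / hit_prob ^+ M = tilt s 0 ^+ M.
  rewrite -expr_div_n; congr (_ ^+ _); rewrite /tilt /box_mass expr0 -/hit_prob /hit_prob.
  by field; rewrite gt_eqF // hit_prob_gt0.
rewrite addrCA -[RHS]addr0; congr (_ + _); apply/eqP; rewrite subr_eq0; apply/eqP.
rewrite mulr_suml; apply: eq_bigr => i _; rewrite /dead.
have iM : (i < M)%N by rewrite (leq_trans _ mM).
have D0 := box_mass_gt0 iM.
rewrite [X in _ = _ * X ^+ _ / _](_ : _ = box_mass i.+1 * tilt s i.+1); last first.
  by rewrite /tilt /box_mass; field; rewrite -/(box_mass i.+1) gt_eqF.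
by rewrite exprMn; ring.
Qed.

(** A death at step [j] leaves exactly [k - j] balls unplaced. Divided by [tilt s 0 ^ k], the
    martingale identity gives [1 / tilt s 0 <= (1 - f) + e f], where [f] is the survival probability
    at time [m]. *)
Lemma cond_survival_upper s m e : 0 <= s -> (m <= M)%N ->
  (forall j, (0 < j <= m)%N -> tilt s j ^+ (k - j) <= tilt s 0 ^+ k) ->
  tilt s m ^+ (k - m) <= e * tilt s 0 ^+ k ->
  cond_survival m * (1 - e) <= 1 - (tilt s 0)^-1.
Proof.
move=> s0 mM hA hE; have [X /andP[X0 X1] e1] := tilt_mart s0 mM.
have t0 : 0 < tilt s 0 by apply: lt_le_trans (tilt_ge1 s0 (leq0n M)).
have T0 : 0 < tilt s 0 ^+ k by rewrite exprn_gt0.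
have f0 := cond_survival_ge0 mM.
have h1 : \sum_(i < m) dead i * tilt s i.+1 ^+ (M - i) <= tilt s 0 ^+ k * (1 - cond_survival m).
  rewrite cond_survivalE opprB addrC subrK mulr_sumr; apply: ler_sum => i _.
  rewrite mulrC ler_wpM2r ?dead_ge0 ?(leq_trans _ mM) //.
  by have := hA i.+1; rewrite /k subSS; apply; rewrite /= .
have h2 : X <= e * tilt s 0 ^+ k * cond_survival m.
  apply: (le_trans X1); rewrite ler_wpM2r //; apply: le_trans hE.
  by rewrite ler_weXn2l ?tilt_ge1 // /k leq_sub2r.
have h3 : tilt s 0 ^+ M = tilt s 0 ^+ k * (tilt s 0)^-1.
  by rewrite /k exprSr mulfK // gt_eqF.
rewrite -(ler_pM2l T0).
move: e1 h1 h2; rewrite h3; set S := \sum_(i < m) _; nra.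
Qed.

(** The reverse count: deaths up to [K] weigh at least 1, deaths between [K] and [m] at least [G],
    and survivors are dropped. [K = m] with [G = 1] bounds survival from below; a large [G] shows
    that few deaths happen after [K]. *)
Lemma cond_survival_lower s m K G : 0 <= s -> (K <= m <= M)%N ->
  (forall j, (0 < j <= K)%N -> tilt s 0 ^+ k <= tilt s j ^+ (k - j)) ->
  (forall j, (K < j <= m)%N -> G * tilt s 0 ^+ k <= tilt s j ^+ (k - j)) ->
  G * (cond_survival K - cond_survival m) <= cond_survival K - (1 - (tilt s 0)^-1).
Proof.
move=> s0 /andP[Km mM] hA hG; have [X /andP[X0 X1] e1] := tilt_mart s0 mM.
have t0 : 0 < tilt s 0 by apply: lt_le_trans (tilt_ge1 s0 (leq0n M)).
have T0 : 0 < tilt s 0 ^+ k by rewrite exprn_gt0.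
have h3 : tilt s 0 ^+ M = tilt s 0 ^+ k * (tilt s 0)^-1.
  by rewrite /k exprSr mulfK // gt_eqF.
have e2 : cond_survival K - cond_survival m = \sum_(K <= i < m) dead i.
  rewrite !cond_survivalE -!(big_mkord xpredT dead) (@big_cat_nat _ _ _ K 0 m) //=; ring.
have e3 : 1 - cond_survival K = \sum_(0 <= i < K) dead i.
  by rewrite cond_survivalE big_mkord; ring.
move: e1; rewrite -(big_mkord xpredT (fun i => dead i * tilt s i.+1 ^+ (M - i))).
rewrite (@big_cat_nat _ _ _ K 0 m) //= => e1.
have h1 : tilt s 0 ^+ k * (1 - cond_survival K) <= \sum_(0 <= i < K) dead i * tilt s i.+1 ^+ (M - i).
  rewrite e3 mulr_sumr big_nat [leRHS]big_nat; apply: ler_sum => i /andP[_ iK].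
  rewrite mulrC ler_wpM2l ?dead_ge0 ?(leq_trans iK) ?(leq_trans Km) //.
  by have := hA i.+1; rewrite /k subSS; apply.
have h2 : G * tilt s 0 ^+ k * (cond_survival K - cond_survival m) <= \sum_(K <= i < m) dead i * tilt s i.+1 ^+ (M - i).
  rewrite e2 mulr_sumr big_nat [leRHS]big_nat; apply: ler_sum => i /andP[Ki im].
  rewrite mulrC ler_wpM2l ?dead_ge0 ?(leq_trans im) //.
  by have := hG i.+1; rewrite /k subSS ltnS Ki im; apply.
rewrite -(ler_pM2l T0).
move: e1 h1 h2; rewrite h3; set S1 := \sum_(0 <= i < K) _; set S2 := \sum_(K <= i < m) _.
nra.
Qed.

(* One step of the tilt, with [u = 1 - 1 / tilt] and [p' = p Q^j / box_mass j] the
   conditional probability that a ball still unplaced falls into box [j + 1]. *)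
Lemma tilt_step s j : 0 <= s -> (j < M)%N ->
  let u := 1 - (tilt s j.+1)^-1 in
  tilt s j.+1 ^+ (k - j.+1) * (1 - p * (1 - p) ^+ j / box_mass j * u) ^+ (k - j) =
  tilt s j ^+ (k - j) * (1 - u).
Proof.
move=> s0 jM u.
have D0 := box_mass_gt0 (ltnW jM); have D1 := box_mass_gt0 jM.
have t1 := lt_le_trans ltr01 (tilt_ge1 s0 jM).
have -> : 1 - p * (1 - p) ^+ j / box_mass j * u = tilt s j / tilt s j.+1.
  have e : box_mass j = box_mass j.+1 + p * (1 - p) ^+ j by rewrite /box_mass (exprS _ j); ring.
  rewrite /u /tilt.
  have n1 : box_mass j.+1 + s != 0 by rewrite gt_eqF // ltr_wpDr.
  have n0 : box_mass j.+1 + p * (1 - p) ^+ j != 0 by rewrite -e gt_eqF.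
  by rewrite e; field; rewrite n0 n1 gt_eqF.
rewrite expr_div_n /u opprB addrC subrK.
have ek : (k - j = (k - j.+1).+1)%N by rewrite subnSK // ltnS ltnW.
rewrite ek; set n := (k - j.+1)%N; clearbody n; rewrite (exprSr (tilt s j.+1) n).
have h : tilt s j.+1 != 0 by rewrite gt_eqF.
have h' : tilt s j.+1 ^+ n != 0 by rewrite expf_neq0.
field; by rewrite h h'.
Qed.

End Conditioned.

(** Full survival is beyond the reach of the tilts, whose estimates degenerate when few boxes are
    left. Taking [c = (1 - p) ^ (M + 2)] in [survival_telescope] trades it for survival up to all
    earlier times, where a final stretch contributes little; the weights are later shown to be close
    to [p / 2]. *)
Lemma busy_diag_sum p M : 0 < p < 1 ->
  busy p M.+1 M.+1 / hit_prob p M.+1 ^+ M.+1 = box_mass p M.+1 M.+1 / hit_prob p M.+1 +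
   \sum_(i < M.+1) cond_survival p M.+1 i * (box_mass p M.+1 M.+1 *
     ((M.+1%:R - i%:R) / box_mass p M.+1 i.+1 - (M.+2%:R - i%:R) / box_mass p M.+1 i)).
Proof.
move=> hp; have q0 := @hit_prob_gt0 p M.+1 hp.
have D0 i : (i <= M.+1)%N -> box_mass p M.+1 i != 0 by move=> ?; rewrite gt_eqF // box_mass_gt0.
have := @survival_telescope p M ((1 - p) ^+ M.+2) M.+1 D0.
rewrite (@survival_small p M M.+1) // mulr0 subr0 survival_diag [M.+2%:R]mulrSr addrAC subrr add0r mul1r => e.
have -> : busy p M.+1 M.+1 = box_mass p M.+1 M.+1 * (busy p M.+1 M.+1 / box_mass p M.+1 M.+1).
  by rewrite mulrC divfK ?D0.
rewrite [X in _ * X / _]e mulrDr mulrDl; congr (_ + _).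
  rewrite (exprSr (hit_prob p M.+1) M) -/(hit_prob p M.+1).
  have h' : hit_prob p M.+1 ^+ M != 0 by rewrite expf_neq0 // gt_eqF.
  by field; rewrite h' gt_eqF.
rewrite mulr_sumr mulr_suml; apply: eq_bigr => i _.
by rewrite /cond_survival /box_mass !mulrA; ring.
Qed.

End Omega.

(** * Components of the random graph *)

Section RandomSubset.
Variables (R : realFieldType) (U : finType) (p : R).
Implicit Types (S E : {set U}) (f g : {set U} -> R).

Definition pr S f : R :=
  \sum_(E in powerset S) p ^+ #|E| * (1 - p) ^+ (#|S| - #|E|)%N * f E.

Lemma eq_pr S f g : (forall E, E \subset S -> f E = g E) -> pr S f = pr S g.
Proof. by move=> h; apply: eq_bigr => E; rewrite powersetE => /h ->. Qed.

Lemma pr_union S1 S2 f : [disjoint S1 & S2] ->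
  pr (S1 :|: S2) f = pr S1 (fun E1 => pr S2 (fun E2 => f (E1 :|: E2))).
Proof.
move=> dis; rewrite /pr.
have dI : S1 :&: S2 = set0 by apply/eqP; rewrite setI_eq0.
transitivity (\sum_(EE in setX (powerset S1) (powerset S2))
   p ^+ #|EE.1| * (1 - p) ^+ (#|S1| - #|EE.1|) *
   (p ^+ #|EE.2| * (1 - p) ^+ (#|S2| - #|EE.2|) * f (EE.1 :|: EE.2))).
  rewrite (reindex_onto (fun EE => EE.1 :|: EE.2) (fun E => (E :&: S1, E :&: S2))) /=; last first.
    by move=> E; rewrite powersetE => /setIidPl; rewrite setIUr.
  have key (E1 E2 : {set U}) : E1 \subset S1 -> E2 \subset S2 ->
     ((E1 :|: E2) :&: S1 = E1) * ((E1 :|: E2) :&: S2 = E2).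
    move=> s1 s2; split; rewrite setIUl.
      rewrite (setIidPl s1); apply/setUidPl/subsetP => z /setIP[z2 z1].
      by have := in_set0 z; rewrite -dI inE z1 (subsetP s2 _ z2).
    rewrite (setIidPl s2); apply/setUidPr/subsetP => z /setIP[z1 z2].
    by have := in_set0 z; rewrite -dI inE z2 (subsetP s1 _ z1).
  apply: eq_big => [[E1 E2] /=|[E1 E2] /=].
    rewrite in_setX !powersetE /=; apply/andP/andP.
      move=> [h /eqP[e1 e2]]; rewrite -e1 -e2; split; exact: subsetIr.
    move=> [s1 s2]; split; first exact: setUSS.
    by rewrite !(key _ _ s1 s2).
  rewrite powersetE => /andP[h /eqP[e1 e2]].
  have s1 : E1 \subset S1 by rewrite -e1 subsetIr.
  have s2 : E2 \subset S2 by rewrite -e2 subsetIr.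
  have d12 : E1 :&: E2 = set0.
    by apply/eqP; rewrite -subset0 -dI setISS.
  have c1 := subset_leq_card s1; have c2 := subset_leq_card s2.
  rewrite !cardsU d12 dI cards0 !subn0 exprD.
  rewrite (_ : (#|S1| + #|S2| - (#|E1| + #|E2|) = (#|S1| - #|E1|) + (#|S2| - #|E2|))%N); last first.
    by move: c1 c2; clear; lia.
  by rewrite exprD; ring.
under [RHS]eq_bigr => E1 _ do rewrite mulr_sumr.
by rewrite pair_big /=; apply: eq_bigl => -[E1 E2]; rewrite in_setX.
Qed.

Lemma pr_set0 f : pr set0 f = f set0.
Proof. by rewrite /pr powerset0 big_set1 cards0 !mul1r. Qed.

Lemma pr_set1 u f : pr [set u] f = (1 - p) * f set0 + p * f [set u].
Proof.
rewrite /pr (bigD1 set0) ?powersetE ?sub0set //= (bigD1 [set u]) /=; last first.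
  by rewrite powersetE subxx -card_gt0 cards1.
rewrite big1 ?addr0 ?cards0 ?cards1 /= ?expr1 ?mul1r ?subn0 ?subnn ?expr0 ?mulr1 //.
move=> E /andP[/andP[]]; rewrite powersetE subset1 => /orP[/eqP->|/eqP->].
  by move=> _ /eqP.
by move=> /eqP.
Qed.

Lemma pr_cst S a : pr S (fun _ => a) = a.
Proof.
have [m] := ubnP #|S|; elim: m S => // m IH S0 hS.
have [->|[u uS]] := set_0Vmem S0; first by rewrite pr_set0.
rewrite -(setD1K uS) pr_union; last by rewrite disjoints1 !inE eqxx.
rewrite pr_set1 IH; first by ring.
by move: hS; rewrite (cardsD1 u) uS.
Qed.

Lemma pr_sum (I : Type) (r : seq I) (P : pred I) S (F : I -> {set U} -> R) :
  pr S (fun E => \sum_(i <- r | P i) F i E) = \sum_(i <- r | P i) pr S (F i).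
Proof.
rewrite /pr exchange_big /=; apply: eq_bigr => E _.
by rewrite mulr_sumr.
Qed.

Lemma prZ S a f : pr S (fun E => a * f E) = a * pr S f.
Proof. by rewrite /pr mulr_sumr; apply: eq_bigr => E _; rewrite mulrCA. Qed.

Lemma prB S f g : pr S (fun E => f E - g E) = pr S f - pr S g.
Proof. by rewrite /pr -sumrB; apply: eq_bigr => E _; rewrite mulrBr. Qed.

Lemma ler_pr S f g : 0 <= p <= 1 -> (forall E, E \subset S -> f E <= g E) ->
  pr S f <= pr S g.
Proof.
move=> /andP[p0 p1] h; apply: ler_sum => E; rewrite powersetE => ES.
by rewrite ler_wpM2l ?h // mulr_ge0 ?exprn_ge0 // subr_ge0.
Qed.

Lemma pr_split S S1 f g : S1 \subset S ->
  pr S (fun E => f (E :&: S1) * g (E :&: (S :\: S1))) = pr S1 f * pr (S :\: S1) g.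
Proof.
move=> h; have eS : S1 :|: (S :\: S1) = S.
  by rewrite -{1}(setIidPr h) setID.
have dis : [disjoint S1 & S :\: S1] by rewrite -setI_eq0; apply/eqP/setP => z; rewrite !inE; case: (z \in S1).
rewrite -{1}eS pr_union // mulrC -prZ; apply: eq_pr => E1 s1.
rewrite mulrC -prZ; apply: eq_pr => E2 s2.
congr (f _ * g _); apply/setP => z; move: (subsetP s1 z) (subsetP s2 z); rewrite !inE;
  case: (z \in E1); case: (z \in E2); case: (z \in S1); case: (z \in S) => //= h1 h2;
  solve [by have := h1 isT | by have := h2 isT].
Qed.

Lemma pr_restrict S S1 f : S1 \subset S -> pr S (fun E => f (E :&: S1)) = pr S1 f.
Proof.
move=> h; transitivity (pr S1 f * pr (S :\: S1) (fun=> 1)); last by rewrite pr_cst mulr1.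
by rewrite -pr_split //; apply: eq_pr => E _; rewrite mulr1.
Qed.

Lemma pr_empty S S1 : S1 \subset S ->
  pr S (fun E => (E :&: S1 == set0)%:R) = (1 - p) ^+ #|S1|.
Proof.
move=> h; rewrite (pr_restrict (fun E => (E == set0)%:R)) //.
rewrite /pr (bigD1 set0) ?powersetE ?sub0set //= eqxx cards0 subn0 mul1r mulr1.
by rewrite big1 ?addr0 // => E /andP[_ /negbTE ->]; rewrite mulr0.
Qed.

Lemma pr_indep S S1 S2 f g : S1 \subset S -> S2 \subset S -> [disjoint S1 & S2] ->
  pr S (fun E => f (E :&: S1) * g (E :&: S2)) = pr S1 f * pr S2 g.
Proof.
move=> s1 s2 dis; have s2' : S2 \subset S :\: S1.
  by rewrite subsetD s2 disjoint_sym.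
rewrite -(pr_restrict g s2') -pr_split //; apply: eq_pr => E _.
by rewrite -setIA (setIidPr s2').
Qed.

End RandomSubset.

(** * Components of a fixed graph *)

Section Components.
Variable n : nat.
Implicit Types (A B V : {set 'I_n}) (E : {set 'I_n * 'I_n}) (v w : 'I_n).

Definition inner V : {set 'I_n * 'I_n} := [set e in pot_edges n | (e.1 \in V) && (e.2 \in V)].
Definition cut A B : {set 'I_n * 'I_n} :=
  [set e in pot_edges n | (e.1 \in A) && (e.2 \in B) || (e.1 \in B) && (e.2 \in A)].
Definition connected_on A E := [forall v in A, forall w in A, connect (adj E) v w].
(** Phrased through the edges that meet [A], separated into inner and outgoing ones, so that
    independence over disjoint edge sets applies directly. *)
Definition is_comp A E := connected_on A (E :&: inner A) && (E :&: cut A (~: A) == set0).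

Lemma adj_sym E : symmetric (adj E).
Proof. by move=> v w; rewrite /adj orbC. Qed.

Lemma comp_self E v : v \in comp E v.
Proof. by rewrite inE connect0. Qed.

Lemma adj_inner E A v w : E \subset pot_edges n -> v \in A -> w \in A ->
  adj E v w -> adj (E :&: inner A) v w.
Proof.
move=> Ep vA wA; rewrite /adj !inE vA wA !andbT => /orP[] h; rewrite h /=.
  by have := subsetP Ep _ h; rewrite inE => ->.
by have := subsetP Ep _ h; rewrite inE => ->; rewrite orbT.
Qed.

Lemma adj_cut E A v w : E \subset pot_edges n -> E :&: cut A (~: A) = set0 ->
  adj E v w -> v \in A -> w \in A.
Proof.
move=> Ep E0 h vA; apply: contraT => wA; case/orP: h => h.
  have := in_set0 (v, w); rewrite -E0 !inE h wA vA /=.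
  by have := subsetP Ep _ h; rewrite inE => /= ->.
have := in_set0 (w, v); rewrite -E0 !inE h wA vA /= ?orbT ?andbF /=.
by have := subsetP Ep _ h; rewrite inE => /= ->.
Qed.

Lemma compP E A v : E \subset pot_edges n -> v \in A -> (comp E v == A) = is_comp A E.
Proof.
move=> Ep vA; apply/eqP/andP => [e|[hc /eqP h0]].
  have E0 : E :&: cut A (~: A) = set0.
    apply/setP => -[x y]; rewrite [RHS]inE; apply/negP; rewrite !inE /= -e !inE.
    move=> /andP[xyE /andP[_ /orP[/andP[cx /negP cy]|/andP[/negP cx cy]]]].
      by apply: cy; apply: connect_trans cx _; apply: connect1; rewrite /adj xyE.
    by apply: cx; apply: connect_trans cy _; apply: connect1; rewrite /adj xyE orbT.
  split; last by rewrite E0.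
  have cv w : w \in A -> connect (adj (E :&: inner A)) v w.
    rewrite -{1}e inE => /connectP[q + ->].
    elim/last_ind: q => [|q z IH]; first by rewrite connect0.
    rewrite rcons_path last_rcons => /andP[hq hz].
    have zA u : u \in A -> adj E u z -> z \in A by move=> uA /(adj_cut Ep E0); apply.
    have lA : last v q \in A by rewrite -e inE; apply/connectP; exists q.
    apply: connect_trans (IH hq) _; apply: connect1.
    by apply: adj_inner => //; apply: zA hz.
  apply/forall_inP => x xA; apply/forall_inP => y yA.
  apply: (@connect_trans _ _ v); last exact: cv.
  by rewrite (sym_connect_sym (adj_sym _)); exact: cv.
apply/setP => w; rewrite inE; apply/idP/idP.
  move=> /connectP[q + ->]; elim/last_ind: q => [//|q z IH].
  rewrite rcons_path last_rcons => /andP[/IH hq hz].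
  exact: (adj_cut Ep h0 hz).
move=> wA; have /forall_inP/(_ v vA)/forall_inP/(_ w wA) := hc.
apply: connect_sub => x y; rewrite /adj => h; apply: connect1.
by move: h; rewrite /adj !inE => /orP[/andP[->]|/andP[->]]; rewrite ?orbT.
Qed.

Lemma is_comp_eq E A B v : E \subset pot_edges n -> is_comp A E -> is_comp B E ->
  v \in A -> v \in B -> A = B.
Proof.
by move=> Ep hA hB vA vB; move: hA hB; rewrite -(compP Ep vA) -(compP Ep vB) => /eqP <- /eqP.
Qed.

Lemma comp_is_comp E v : E \subset pot_edges n -> is_comp (comp E v) E.
Proof. by move=> Ep; rewrite -(compP Ep (comp_self E v)). Qed.

Lemma inner_pot V : inner V \subset pot_edges n.
Proof. by apply/subsetP => e; rewrite inE => /andP[]. Qed.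

Lemma cut_pot A B : cut A B \subset pot_edges n.
Proof. by apply/subsetP => e; rewrite inE => /andP[]. Qed.

Lemma innerT : inner [set: 'I_n] = pot_edges n.
Proof. by apply/setP => e; rewrite !inE !andbT. Qed.

Lemma disjoint_inner_cut A B : [disjoint A & B] -> [disjoint inner A & cut A B].
Proof.
move=> dis; rewrite -setI_eq0; apply/eqP/setP => e; rewrite !inE.
have h z : z \in A -> z \in B = false by move=> zA; apply/negbTE; by rewrite (disjointFr dis zA).
case: (boolP (e.1 \in A)) => [/h ->|]; case: (boolP (e.2 \in A)) => [/h ->|];
  by rewrite ?(andbF, andbT, orbF).
Qed.

Lemma card_cut A B : [disjoint A & B] -> #|cut A B| = (#|A| * #|B|)%N.
Proof.
move=> dis; rewrite -cardsX.
(* Potential edges are increasing pairs, so an element of [A] times [B] may have to be swapped. *)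
pose f (e : 'I_n * 'I_n) := if (e.1 < e.2)%N then e else (e.2, e.1).
have hAB z w : z \in A -> w \in B -> (z : nat) != w.
  move=> zA wB; apply/eqP => /val_inj e; move: wB; rewrite -e.
  by rewrite (disjointFr dis zA).
have -> : cut A B = f @: setX A B.
  apply/setP => -[x y]; apply/idP/imsetP.
    rewrite !inE /= => /andP[xy /orP[/andP[h1 h2]|/andP[h1 h2]]].
      by exists (x, y); rewrite ?inE /= ?h1 // /f /= xy.
    by exists (y, x); rewrite ?inE /= ?h2 // /f /= ltnNge (ltnW xy).
  move=> [[a b]]; rewrite inE /= => /andP[aA bB].
  have := hAB _ _ aA bB; rewrite neq_ltn /f /=.
  case: ltngtP => //= h _ [-> ->]; rewrite !inE /= h aA bB //= ?orbT //.
rewrite card_in_imset // => -[a b] [c d]; rewrite !inE /= /f => /andP[aA bB] /andP[cA dB] /=.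
have ac z w : z \in A -> w \in B -> z <> w by move=> zA wB e; have := hAB z w zA wB; rewrite e eqxx.
case: ifP => _; case: ifP => _ [e1 e2]; rewrite ?e1 ?e2 //.
  by case: (ac a d).
by case: (ac c b).
Qed.

End Components.

(** * Probabilities that given vertex sets are components *)

Section Probabilities.
Variables (R : realFieldType) (n : nat) (p : R).
Hypothesis p01 : 0 <= p <= 1.
Implicit Types (A B V : {set 'I_n}) (E : {set 'I_n * 'I_n}) (v w : 'I_n).

Definition conn_prob A : R := pr p (inner A) (fun E => (connected_on A E)%:R).

Lemma pr_is_comp V A : A \subset V ->
  pr p (inner V) (fun E => (is_comp A E)%:R) =
  conn_prob A * (1 - p) ^+ (#|A| * (#|V| - #|A|)).
Proof.
move=> AV; have dis : [disjoint A & V :\: A].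
  by rewrite -setI_eq0; apply/eqP/setP => z; rewrite !inE; case: (z \in A).
rewrite -cardsDS // -card_cut //.
have cV : cut A (V :\: A) \subset inner V.
  apply/subsetP => e; rewrite !inE => /andP[-> /= /orP[/andP[h /andP[_ ->]]|/andP[/andP[_ ->] h]]];
  by rewrite (subsetP AV _ h).
have iV : inner A \subset inner V.
  by apply/subsetP => e; rewrite !inE => /andP[-> /andP[/(subsetP AV) -> /(subsetP AV) ->]].
rewrite -(pr_empty p (subxx (cut A (V :\: A)))) /conn_prob.
rewrite -(pr_indep p _ (fun E => (E :&: cut A (V :\: A) == set0)%:R) iV cV); last exact: disjoint_inner_cut.
apply: eq_pr => E EV; rewrite /is_comp -mulnb natrM; congr (_ * (_ == _)%:R).
rewrite -setIA setIid; apply/setP => e; rewrite !inE.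
case: (boolP (e \in E)) => //= /(subsetP EV); rewrite !inE => /andP[-> /andP[-> ->]].
by rewrite !andbT.
Qed.

(** Exactly one set containing [v] is a component of the random graph on [A]. *)
Lemma conn_prob_sum A v : v \in A ->
  \sum_(B : {set 'I_n} | (v \in B) && (B \subset A)) conn_prob B * (1 - p) ^+ (#|B| * (#|A| - #|B|)) = 1.
Proof.
move=> vA.
transitivity (\sum_(B : {set 'I_n} | (v \in B) && (B \subset A)) pr p (inner A) (fun E => (is_comp B E)%:R)).
  by apply: eq_bigr => B /andP[_ BA]; rewrite pr_is_comp.
rewrite -pr_sum -[RHS](pr_cst p (inner A)); apply: eq_pr => E EA.
have Ep : E \subset pot_edges n by apply: subset_trans (inner_pot A).
have cA : comp E v \subset A.
  apply/subsetP => w; rewrite inE => /connectP[q + ->].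
  elim/last_ind: q => [//|q z _]; rewrite rcons_path last_rcons => /andP[_].
  by move=> /orP[] /(subsetP EA); rewrite !inE => /andP[_ /andP[]].
rewrite (bigD1 (comp E v)) /=; last by rewrite comp_self.
rewrite comp_is_comp // big1 ?addr0 // => B /andP[/andP[vB _] BE].
by rewrite -(compP Ep vB) eq_sym (negbTE BE).
Qed.

(** The exploration counterpart of [conn_prob_sum]: nothing survives up to time [M + 1], so the
    death probabilities add up to 1. *)
Lemma sum_busy_diag M :
  \sum_(j < M.+1) 'C(M, j)%:R * (busy p j j * (1 - p) ^+ (j.+1 * (M - j))) = 1.
Proof.
have := survival_sum p M M.+1 0; rewrite survival_small // subr0 expr1n => /eqP.
rewrite eq_sym subr_eq0 => /eqP e; rewrite [RHS]e; apply: eq_bigr => j _.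
by rewrite subr0 -exprM mulrA.
Qed.

Lemma card_sets_containing A v m : v \in A ->
  #|[set B : {set 'I_n} | [&& v \in B, B \subset A & #|B| == m.+1]]| = 'C(#|A|.-1, m).
Proof.
move=> vA; have cA : #|A :\ v| = #|A|.-1 by rewrite (cardsD1 v A) vA.
rewrite -cA -cards_draws -[RHS](card_in_imset (f := fun B => v |: B)); last first.
  move=> B C; rewrite !inE => /andP[hB _] /andP[hC _] e.
  have vB : v \notin B by apply/negP => /(subsetP hB); rewrite !inE eqxx.
  have vC : v \notin C by apply/negP => /(subsetP hC); rewrite !inE eqxx.
  by rewrite -(setU1K vB) e setU1K.
congr #|pred_of_set _|; apply/setP => B; rewrite inE; apply/idP/imsetP.
  move=> /and3P[vB BA cB]; exists (B :\ v); last by rewrite setD1K.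
  by rewrite inE setSD //=; move: cB; rewrite (cardsD1 v B) vB.
move=> [C]; rewrite inE => /andP[hC /eqP cC] ->.
have vC : v \notin C by apply/negP => /(subsetP hC); rewrite !inE eqxx.
rewrite setU11 cardsU1 vC cC eqxx andbT subUset sub1set vA /=.
exact: subset_trans hC (subsetDl _ _).
Qed.

(** Grouped by the size of [B], [conn_prob_sum] becomes the same triangular system as
    [sum_busy_diag]. By strong induction the proper subsets contribute equally to both, and the
    remaining term [B = A] has coefficient 1. No coupling between graph and exploration is
    needed. *)
Lemma conn_probE A : (0 < #|A|)%N -> conn_prob A = busy p #|A|.-1 #|A|.-1.
Proof.
have [m] := ubnP #|A|; elim: m A => // m IH A Am /card_gt0P[v vA].
have cA : #|A| = #|A|.-1.+1 by rewrite prednK //; apply/card_gt0P; exists v.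
pose F j := busy p j.-1 j.-1 * (1 - p) ^+ (j * (#|A| - j)) : R.
have e1 := conn_prob_sum vA.
have e2 : \sum_(B : {set 'I_n} | (v \in B) && (B \subset A)) F #|B| = 1.
  rewrite -(sum_busy_diag #|A|.-1).
  rewrite (partition_big (fun B : {set 'I_n} => inord #|B|.-1 : 'I_(#|A|.-1.+1)) xpredT) //=.
  apply: eq_bigr => j _.
  transitivity (\sum_(B in [set B : {set 'I_n} | [&& v \in B, B \subset A & #|B| == j.+1]]) F j.+1).
    apply: eq_big => [B|B /andP[/andP[vB BA] /eqP jB]].
      rewrite inE -andbA; case: (boolP (v \in B)) => //= vB; case: (boolP (B \subset A)) => //= BA.
      have cB : (0 < #|B|)%N by apply/card_gt0P; exists v.
      have BAc : (#|B|.-1 < #|A|.-1.+1)%N by rewrite -cA prednK // subset_leq_card.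
      by rewrite -val_eqE /= inordK // -eqSS prednK.
    have cB : (0 < #|B|)%N by apply/card_gt0P; exists v.
    have BAc : (#|B|.-1 < #|A|.-1.+1)%N by rewrite -cA prednK // subset_leq_card.
    by rewrite -jB /= inordK // prednK.
  rewrite sumr_const card_sets_containing // -[_ *+ _]mulr_natl; congr (_ * (_ * _ ^+ (_ * _))).
  by rewrite {1}cA subSS.
rewrite -[RHS]e2 (bigD1 A) /= in e1; last by rewrite vA subxx.
move: e1.
rewrite [RHS](bigD1 A) /=; last by rewrite vA subxx.
rewrite (eq_bigr (fun B : {set 'I_n} => F #|B|)) => [|B /andP[/andP[vB BA] BnA]].
  by move=> h; have := addIr _ h; rewrite /F subnn muln0 expr0 !mulr1.
have cB : (0 < #|B|)%N by apply/card_gt0P; exists v.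
rewrite IH // -ltnS; apply: leq_trans Am; rewrite ltnS; apply: proper_card.
by rewrite properEneq BnA.
Qed.

(** Once [A] is a component no edge leaves it, so whether [B] is one depends only on the edges
    inside the complement of [A], a set disjoint from the edges that decide about [A]. *)
Lemma pr_is_comp2 A B : [disjoint A & B] ->
  pr p (pot_edges n) (fun E => (is_comp A E && is_comp B E)%:R) =
  conn_prob A * (1 - p) ^+ (#|A| * (n - #|A|)) *
  (conn_prob B * (1 - p) ^+ (#|B| * (n - #|A| - #|B|))).
Proof.
move=> dis; have AB : B \subset ~: A by rewrite -disjoints_subset disjoint_sym.
have cAn : #|~: A| = (n - #|A|)%N by rewrite cardsCs setCK card_ord.
have dAB : [disjoint inner A & inner B].
  rewrite -setI_eq0; apply/eqP/setP => e; rewrite !inE.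
  case: (boolP (e.1 \in A)) => [h|]; last by rewrite andbF.
  by rewrite (disjointFr dis h) !andbF.
have dA : [disjoint A & ~: A] by rewrite -setI_eq0 setICr.
have sAc : cut A (~: A) \subset pot_edges n := cut_pot _ _.
have sT : inner (~: A) \subset pot_edges n := inner_pot _.
have sA := inner_pot A.
have dA1 : [disjoint inner A & cut A (~: A)] by apply: disjoint_inner_cut.
have dA2 : [disjoint inner A :|: cut A (~: A) & inner (~: A)].
  rewrite -setI_eq0; apply/eqP/setP => e; rewrite !inE.
  by case: (e.1 \in A); case: (e.2 \in A); rewrite ?(andbF, andbT, orbF).
transitivity (pr p (pot_edges n) (fun E =>
   (fun E' => (is_comp A E')%:R : R) (E :&: (inner A :|: cut A (~: A))) *
   (fun E' => (is_comp B E')%:R : R) (E :&: inner (~: A)))).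
  apply: eq_pr => E Ep; rewrite -natrM mulnb; congr (_%:R).
  have isA : is_comp A (E :&: (inner A :|: cut A (~: A))) = is_comp A E.
    rewrite /is_comp -!setIA (setIidPr (subsetUl _ _)) (setIidPr (subsetUr _ _)) //.
  rewrite isA; case: (boolP (is_comp A E)) => //= hA.
  have E0 : E :&: cut A (~: A) = set0 by move/andP: hA => [_ /eqP].
  congr nat_of_bool; rewrite /is_comp -!setIA.
  have -> : inner (~: A) :&: inner B = inner B.
    apply/setIidPr/subsetP => e; rewrite !inE => /andP[-> /andP[/(subsetP AB) + /(subsetP AB)]].
    by rewrite !inE => -> ->.
  congr (_ && (_ == _)); apply/setP => e.
  have := in_set0 e; rewrite -E0 !inE.
  have := subsetP AB e.1; have := subsetP AB e.2; rewrite !inE.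
  case: (e \in E) => //=; case: (e.1 < e.2)%N => //=.
  by case: (e.1 \in A); case: (e.2 \in A); case: (e.1 \in B); case: (e.2 \in B) => //= h1 h2;
    first [by have := h1 isT | by have := h2 isT].
have sU : inner A :|: cut A (~: A) \subset pot_edges n by rewrite subUset sA.
rewrite (pr_indep p (fun E' => (is_comp A E')%:R) (fun E' => (is_comp B E')%:R) sU sT dA2).
rewrite pr_is_comp // cAn; congr (_ * _).
have := pr_is_comp (subsetT A); rewrite innerT cardsT card_ord => <-.
rewrite -(pr_restrict p (fun E' => (is_comp A E')%:R) sU); apply: eq_pr => E Ep; congr (_%:R).
by rewrite /is_comp -!setIA (setIidPr (subsetUl _ _)) (setIidPr (subsetUr _ _)).
Qed.

End Probabilities.

(* Mean number of components of size [j] in [G(n, p)]. *)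
Definition mean_comps (R : realFieldType) (p : R) (n j : nat) : R :=
  'C(n, j)%:R * busy p j.-1 j.-1 * (1 - p) ^+ (j * (n - j)).

Lemma mean_comps_ge0 (R : realFieldType) (p : R) n j : 0 <= p <= 1 -> 0 <= mean_comps p n j.
Proof.
by move=> hp; rewrite !mulr_ge0 ?busy_ge0 // exprn_ge0 // subr_ge0; case/andP: hp.
Qed.

(** * Sums of mean component counts, via the cluster of one vertex *)

Section MeanSums.
Variables (R : realFieldType) (p : R).
Hypothesis p01 : 0 <= p <= 1.

Let hitE M j : 'C(M, j)%:R * busy p j j * (1 - p) ^+ (j.+1 * (M - j)) = survival p M j 0 - survival p M j.+1 0.
Proof. by rewrite survival_step subr0 exprM; ring. Qed.

(** Both sides are the mean number of vertices lying in components of size [j + 1]. *)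
Let mean_compsE M j : (j <= M)%N ->
  j.+1%:R * mean_comps p M.+1 j.+1 = M.+1%:R * (survival p M j 0 - survival p M j.+1 0).
Proof.
move=> jM; rewrite -hitE /mean_comps /= subSS !mulrA; congr (_ * _ * _).
by rewrite -!natrM -mul_bin_diag.
Qed.

(** A component with more than [J] vertices uses up more than [J] of the vertices whose cluster
    exceeds [J]. *)
Lemma mean_comps_tail M J : (0 < J)%N -> (J <= M)%N ->
  \sum_(J <= j < M.+1) mean_comps p M.+1 j.+1 <= M.+1%:R / J%:R * survival p M J 0.
Proof.
move=> J0 JM; have J0' : 0 < J%:R :> R by rewrite ltr0n.
have e : \sum_(J <= j < M.+1) (survival p M j 0 - survival p M j.+1 0) = survival p M J 0.
  transitivity (- \sum_(J <= j < M.+1) (survival p M j.+1 0 - survival p M j 0)).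
    by rewrite -sumrN; apply: eq_bigr => j _; rewrite opprB.
  by rewrite (telescope_sumr (fun j => survival p M j 0)) ?leqW // survival_small // sub0r opprK.
rewrite -e mulr_sumr big_nat [leRHS]big_nat; apply: ler_sum => j /andP[Jj jM].
have j0 : 0 < j.+1%:R :> R by rewrite ltr0n.
rewrite -(ler_pM2l j0) mean_compsE //.
have h : 0 <= M.+1%:R * (survival p M j 0 - survival p M j.+1 0).
  by rewrite -mean_compsE // mulr_ge0 ?mean_comps_ge0.
rewrite [leRHS](_ : _ = M.+1%:R * (survival p M j 0 - survival p M j.+1 0) * (j.+1%:R / J%:R)); last by ring.
by rewrite ler_peMr // ler_pdivlMr // mul1r ler_nat leqW.
Qed.

(** For [j >= k] one has [1 <= (j / k) ^ 2], so the count is at most [k ^ -2] times the sum of the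
    squared component sizes, whose mean is the number of vertices times the mean cluster size. *)
Lemma sum_mean_comps_le M k : (0 < k)%N -> M.+2%:R * p < 1 ->
  \sum_(j < M.+3 | (k <= j)%N) mean_comps p M.+2 j <= M.+2%:R / k%:R ^+ 2 / (1 - M.+2%:R * p).
Proof.
move=> k0 hM; have [p0 p1] := andP p01.
have k0' : 0 < k%:R :> R by rewrite ltr0n.
have h0 : 0 <= M.+2%:R / k%:R ^+ 2 :> R by rewrite divr_ge0 // exprn_ge0.
apply: le_trans (ler_wpM2l h0 (sum_survival_le p0 hM)).
have abel N : \sum_(i < N) i.+1%:R * (survival p M.+1 i 0 - survival p M.+1 i.+1 0) =
   \sum_(i < N) survival p M.+1 i 0 - N%:R * survival p M.+1 N 0.
  elim: N => [|N IH]; first by rewrite !big_ord0 mul0r subr0.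
  by rewrite !big_ord_recr /= IH [N.+1%:R]mulrSr; ring.
have := abel M.+2; rewrite survival_small // mulr0 subr0 => <-.
rewrite big_mkcond big_ord_recl /= leqNgt k0 add0r mulr_sumr; apply: ler_sum => j _.
rewrite /bump /= add1n.
have j0 : 0 < j.+1%:R :> R by rewrite ltr0n.
have jM : (j <= M.+1)%N by rewrite -ltnS.
have h : 0 <= M.+2%:R * (survival p M.+1 j 0 - survival p M.+1 j.+1 0).
  by rewrite -mean_compsE // mulr_ge0 ?mean_comps_ge0.
case: ifP => kj; last first.
  rewrite [leRHS](_ : _ = M.+2%:R * (survival p M.+1 j 0 - survival p M.+1 j.+1 0) * (j.+1%:R / k%:R ^+ 2)); last by ring.
  by rewrite mulr_ge0 // divr_ge0 // exprn_ge0.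
rewrite -(ler_pM2l j0) mean_compsE //.
rewrite [leRHS](_ : _ = M.+2%:R * (survival p M.+1 j 0 - survival p M.+1 j.+1 0) * (j.+1%:R / k%:R) ^+ 2); last first.
  by rewrite expr_div_n; ring.
rewrite ler_peMr // exprn_ege1 // ler_pdivlMr // mul1r ler_nat //.
Qed.

End MeanSums.

(** * The law of [L1] between its first and second moment bounds *)

Section LargestComponent.
Variables (R : realType) (n : nat) (p : R).
Hypothesis p01 : 0 <= p <= 1.
Implicit Types (A B : {set 'I_n}) (E : {set 'I_n * 'I_n}).

Lemma Gnp_probE (Ev : pred {set 'I_n * 'I_n}) :
  Gnp_prob p Ev = pr p (pot_edges n) (fun E => (Ev E)%:R).
Proof.
rewrite /Gnp_prob /pr big_mkcondr; apply: eq_bigr => E _.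
by case: ifP; rewrite ?mulr1 ?mulr0.
Qed.

Lemma sum_by_card (S : {set 'I_n}) (F : nat -> R) :
  \sum_(B : {set 'I_n} | B \subset S) F #|B| = \sum_(j < #|S|.+1) 'C(#|S|, j)%:R * F j.
Proof.
rewrite (partition_big (fun B : {set 'I_n} => inord #|B| : 'I_(#|S|.+1)) xpredT) //=.
apply: eq_bigr => j _; rewrite -cards_draws mulr_natl -sumr_const.
apply: eq_big => [B|B /andP[BS /eqP <-]].
  rewrite inE; case: (boolP (B \subset S)) => //= BS.
  by rewrite -val_eqE /= inordK // ltnS subset_leq_card.
by rewrite inordK // ltnS subset_leq_card.
Qed.

Lemma L1_attained E k : (0 < k)%N -> (k <= L1 E)%N -> exists v, (k <= #|comp E v|)%N.
Proof.
move=> k0 h; apply/existsP; apply: contraLR h; rewrite negb_exists => /forallP h.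
rewrite -ltnNge; apply: (@leq_ltn_trans k.-1); last by rewrite prednK.
by apply/bigmax_leqP => v _; rewrite -ltnS prednK // ltnNge h.
Qed.

Lemma card_comp_L1 E v : (#|comp E v| <= L1 E)%N.
Proof. exact: (leq_bigmax v). Qed.

Let is_comp_pr A : pr p (pot_edges n) (fun E => (is_comp A E)%:R) =
  conn_prob p A * (1 - p) ^+ (#|A| * (n - #|A|)).
Proof. by have := pr_is_comp p (subsetT A); rewrite innerT cardsT card_ord. Qed.

Let sum_is_comp k : (0 < k)%N ->
  \sum_(A : {set 'I_n} | #|A| == k) pr p (pot_edges n) (fun E => (is_comp A E)%:R) = mean_comps p n k.
Proof.
move=> k0; rewrite (eq_bigr (fun=> busy p k.-1 k.-1 * (1 - p) ^+ (k * (n - k)))).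
  rewrite sumr_const -[_ *+ _]mulr_natl /mean_comps mulrA; congr (_%:R * _ * _).
  by rewrite -[X in 'C(X, _)]card_ord -card_draws; apply: eq_card => A; rewrite !inE.
by move=> A /eqP cA; rewrite is_comp_pr conn_probE ?cA.
Qed.

Lemma Gnp_L1_eq_le k : (0 < k)%N -> @Gnp_prob R n p (fun E => L1 E == k) <= mean_comps p n k.
Proof.
move=> k0; rewrite Gnp_probE -sum_is_comp // -pr_sum; apply: ler_pr => // E Ep.
case: eqP => /= [e|_]; last by apply: sumr_ge0.
have [|v hv] := @L1_attained E k k0; first by rewrite e.
have cv : #|comp E v| == k by rewrite eqn_leq hv andbT -e card_comp_L1.
rewrite (bigD1 (comp E v)) //= comp_is_comp // lerDl.
by apply: sumr_ge0.
Qed.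

Lemma Gnp_L1_ge k : @Gnp_prob R n p (fun E => (k <= L1 E)%N) =
  \sum_(k <= j < n.+1) @Gnp_prob R n p (fun E => L1 E == j).
Proof.
rewrite Gnp_probE; under [RHS]eq_bigr => j _ do rewrite Gnp_probE.
rewrite -pr_sum; apply: eq_pr => E _.
have Ln : (L1 E < n.+1)%N.
  by rewrite ltnS; apply/bigmax_leqP => v _; rewrite -[X in (_ <= X)%N]card_ord max_card.
case: (leqP k (L1 E)) => h.
  rewrite (bigD1_seq (L1 E)) ?mem_index_iota ?h ?iota_uniq //= eqxx big1 ?addr0 //.
  by move=> j /negbTE; rewrite eq_sym => ->.
rewrite big_nat big1 // => j /andP[kj _].
by rewrite ltn_eqF // (leq_trans h).
Qed.

Lemma Gnp_prob_ge0 (Ev : pred {set 'I_n * 'I_n}) : 0 <= Gnp_prob p Ev.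
Proof.
have [p0 p1] := andP p01.
by apply: sumr_ge0 => E _; rewrite mulr_ge0 // exprn_ge0 // subr_ge0.
Qed.

(* If [A] is the only component of size at least [k], and it has size [k], then
   [L1 = k]; with [r] components of size [k] the right-hand side is at most [r (2 - r)]. *)
Let indicator_lb E k : (0 < k)%N -> E \subset pot_edges n ->
  \sum_(A : {set 'I_n} | #|A| == k) ((is_comp A E)%:R -
     \sum_(B : {set 'I_n} | (B \subset ~: A) && (k <= #|B|)%N) (is_comp A E && is_comp B E)%:R)
  <= (L1 E == k)%:R :> R.
Proof.
move=> k0 Ep.
have dis A B : is_comp A E -> is_comp B E -> (0 < #|A|)%N -> B != A -> B \subset ~: A.
  move=> hA hB A0 BA; rewrite -disjoints_subset disjoint_sym -setI_eq0.
  apply/negPn/negP => /set0Pn[v /setIP[vA vB]].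
  by move: BA; rewrite (is_comp_eq Ep hA hB vA vB) eqxx.
case: (eqVneq (L1 E) k) => [e|ne] /=; last first.
  apply: sumr_le0 => A /eqP cA; rewrite subr_le0.
  case: (boolP (is_comp A E)) => //= hA; last by apply: sumr_ge0.
  have A0 : (0 < #|A|)%N by rewrite cA.
  have [v vA] := card_gt0P A0.
  have kL : (k < L1 E)%N.
    rewrite ltn_neqAle eq_sym ne -cA.
    by move: hA; rewrite -(compP Ep vA) => /eqP <-; rewrite card_comp_L1.
  have [w hw] := L1_attained (ltn0Sn k) kL.
  rewrite (bigD1 (comp E w)) /=; last first.
    rewrite (ltnW hw) andbT; apply: dis => //; first exact: comp_is_comp.
    by apply: contraTneq hw => ->; rewrite cA ltnn.
  rewrite comp_is_comp // lerDl; exact: sumr_ge0.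
pose r : R := \sum_(A : {set 'I_n} | #|A| == k) (is_comp A E)%:R.
apply: (@le_trans _ _ (\sum_(A : {set 'I_n} | #|A| == k) (is_comp A E)%:R * (2 - r))).
  apply: ler_sum => A cA; case: (boolP (is_comp A E)) => /= hA; last first.
    by rewrite mul0r big1 // subr0.
  rewrite mul1r lerBlDr.
  have A0 : (0 < #|A|)%N by rewrite (eqP cA).
  have : r - 1 <= \sum_(B : {set 'I_n} | (B \subset ~: A) && (k <= #|B|)%N) (is_comp B E)%:R.
    rewrite /r (bigD1 A) //= hA [X in X - _]addrC addrK.
    rewrite big_mkcond [leRHS]big_mkcond /=; apply: ler_sum => B _.
    case: (boolP (is_comp B E)) => hB; last by do 2 case: ifP.
    case: ifP => [/andP[/eqP cB BA]|_]; last by case: ifP.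
    by rewrite cB leqnn (dis A B).
  lra.
rewrite -mulr_suml -/r; have := sqr_ge0 (r - 1); lra.
Qed.

(** The expectation of [indicator_lb]. Given a component [A] of size [k], the rest is a random graph
    on [n - k] vertices, so the inner sum is the same for every [A] and factors out. *)
Lemma Gnp_L1_eq_ge k : (0 < k)%N ->
  mean_comps p n k * (1 - \sum_(j < (n - k).+1 | (k <= j)%N) mean_comps p (n - k) j)
  <= @Gnp_prob R n p (fun E => L1 E == k).
Proof.
move=> k0; rewrite Gnp_probE.
apply: le_trans (ler_pr p01 (fun E Ep => indicator_lb k0 Ep)).
rewrite pr_sum -sum_is_comp // mulr_suml le_eqVlt; apply/orP; left; apply/eqP.
apply: eq_bigr => A /eqP cA; rewrite prB pr_sum mulrBr mulr1; congr (_ - _).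
rewrite is_comp_pr.
rewrite (eq_bigr (fun B : {set 'I_n} => conn_prob p A * (1 - p) ^+ (#|A| * (n - #|A|)) *
   (busy p #|B|.-1 #|B|.-1 * (1 - p) ^+ (#|B| * (n - k - #|B|))))); last first.
  move=> B /andP[BA kB]; rewrite pr_is_comp2 ?cA; last by rewrite disjoint_sym disjoints_subset.
  by congr (_ * (_ * _)); rewrite conn_probE // (leq_trans k0).
rewrite -mulr_sumr; congr (_ * _).
have cAn : #|~: A| = (n - k)%N by rewrite cardsCs setCK card_ord cA.
rewrite big_mkcondr /= (sum_by_card (~: A) (fun j => if (k <= j)%N then
    busy p j.-1 j.-1 * (1 - p) ^+ (j * (n - k - j)) else 0)) cAn [LHS]big_mkcond.
by apply: eq_bigr => j _; case: ifP; rewrite /mean_comps ?mulr0 // mulrA.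
Qed.

End LargestComponent.

From mathcomp Require Import all_classical all_reals all_analysis.
Import numFieldNormedType.Exports.
Local Open Scope ring_scope.

(** * Survival probability of the conditioned exploration *)

Section ExpBounds.
Variable R : realType.
Implicit Types x y u a b : R.

Lemma is_derive_nondecreasing (f df : R -> R) a b : a <= b ->
  (forall x, a <= x <= b -> is_derive x 1 f (df x)) ->
  (forall x, a <= x <= b -> 0 <= df x) -> f a <= f b.
Proof.
move=> ab fd fd0.
have [||c cab e] := @MVT_segment R f df a b ab.
- by move=> x /[!in_itv] /= /andP[h1 h2]; apply: fd; rewrite !ltW.
- apply: derivable_within_continuous => x /[!in_itv] /= h.
  by have [] := fd x h.
move: cab; rewrite in_itv /= => h.
by rewrite -subr_ge0 e mulr_ge0 ?fd0 // subr_ge0.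
Qed.

Lemma is_derive_nonincreasing (f df : R -> R) a b : a <= b ->
  (forall x, a <= x <= b -> is_derive x 1 f (df x)) ->
  (forall x, a <= x <= b -> df x <= 0) -> f b <= f a.
Proof.
move=> ab fd fd0; rewrite -lerN2.
apply: (@is_derive_nondecreasing (- f) (- df) a b ab) => x h.
  by apply: is_deriveN; exact: fd.
by rewrite oppr_ge0 fd0.
Qed.

Let ecub a1 a2 a3 x : R := expR (a1 * x + a2 * x ^+ 2 + a3 * x ^+ 3) * (1 + x).
Let decub a1 a2 a3 x : R := expR (a1 * x + a2 * x ^+ 2 + a3 * x ^+ 3) *
    ((a1 + 2 * a2 * x + 3 * a3 * x ^+ 2) * (1 + x) + 1).

Let is_derive_ecub a1 a2 a3 u : is_derive u 1 (ecub a1 a2 a3) (decub a1 a2 a3 u).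
Proof.
have h : is_derive u 1 (fun x => a1 * x + a2 * x ^+ 2 + a3 * x ^+ 3) (a1 + 2 * a2 * u + 3 * a3 * u ^+ 2).
  apply: is_derive_eq; rewrite /GRing.scale /=; ring.
have := @is_derive1_comp _ expR _ u _ _ (is_derive_expR _) h => {}h.
apply: (@is_derive_eq _ _ _ (fun x => (expR \o (fun x => a1 * x + a2 * x ^+ 2 + a3 * x ^+ 3)) x * (1 + x))).
rewrite /GRing.scale /= /decub; ring.
Qed.

(** With these coefficients the polynomial factor of the derivative [decub] collapses to [- x ^ 3],
    so the quotient of the two sides is maximal at 0, where it is 1. *)
Lemma expR_cubic_ge x : -1 <= x -> 1 + x <= expR (x - x ^+ 2 / 2 + x ^+ 3 / 3).
Proof.
move=> x1; pose E := ecub (-1) 2^-1 (- 3^-1).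
have e : E 0 = 1 by rewrite /E /ecub !(expr0n, mulr0, addr0) expR0 mul1r.
have : E x <= 1.
  have [x0|x0] := leP 0 x.
    rewrite -{}e.
    apply: (@is_derive_nonincreasing E (decub (-1) 2^-1 (- 3^-1)) 0 x x0) => y /andP[y0 yx].
      exact: is_derive_ecub.
    rewrite /decub mulr_ge0_le0 ?expR_ge0 //.
    have : 0 <= y ^+ 3 by rewrite exprn_ge0.
    lra.
  rewrite -{}e; apply: (@is_derive_nondecreasing E (decub (-1) 2^-1 (- 3^-1)) x 0 (ltW x0)) => y /andP[xy y0].
    exact: is_derive_ecub.
  rewrite /decub mulr_ge0 ?expR_ge0 //.
  have : y ^+ 3 <= 0 by rewrite exprS mulr_le0_ge0 ?sqr_ge0 // ltW.
  lra.
rewrite /E /ecub -ler_pdivlMl ?expR_gt0 // -expRN mulr1; congr (_ <= expR _); ring.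
Qed.

Lemma expR_cubic_le x : - 2^-1 <= x -> expR (x - x ^+ 2 / 2 - `|x| ^+ 3) <= 1 + x.
Proof.
move=> x1.
have [x0|x0] := leP 0 x.
  pose E := ecub (-1) 2^-1 0.
  have e : E 0 = 1 by rewrite /E /ecub !(expr0n, mulr0, addr0) expR0 mul1r.
  have h : 1 <= E x.
    rewrite -{}e; apply: (@is_derive_nondecreasing E (decub (-1) 2^-1 0) 0 x x0) => y /andP[y0 yx].
      exact: is_derive_ecub.
    by rewrite /decub mulr_ge0 ?expR_ge0 //; nra.
  apply: (@le_trans _ _ (expR (x - x ^+ 2 / 2))).
    by rewrite ler_expR ger0_norm // gerBl exprn_ge0.
  move: h; rewrite /E /ecub -ler_pdivrMl ?expR_gt0 // -expRN mulr1.
  by congr (expR _ <= _); ring.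
pose E := ecub (-1) 2^-1 (-1).
have e : E 0 = 1 by rewrite /E /ecub !(expr0n, mulr0, addr0) expR0 mul1r.
have h : 1 <= E x.
  rewrite -{}e; apply: (@is_derive_nonincreasing E (decub (-1) 2^-1 (-1)) x 0 (ltW x0)) => y /andP[y0 yx].
    exact: is_derive_ecub.
  by rewrite /decub mulr_ge0_le0 ?expR_ge0 //; nra.
rewrite ltr0_norm //.
move: h; rewrite /E /ecub -ler_pdivrMl ?expR_gt0 // -expRN mulr1.
by congr (expR _ <= _); ring.
Qed.

Lemma ler_1BexpR u : 0 <= u <= 1 -> 1 - u <= expR (- u - u ^+ 2 / 2).
Proof.
move=> /andP[u0 u1]; have := @expR_cubic_ge (- u); rewrite lerN2 => /(_ u1) h.
apply: (le_trans h); rewrite ler_expR.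
have : 0 <= u ^+ 3 by rewrite exprn_ge0.
lra.
Qed.

Lemma ler_expR1B u : 0 <= u <= 2^-1 -> expR (- u - u ^+ 2) <= 1 - u.
Proof.
move=> /andP[u0 u1]; have := @expR_cubic_le (- u); rewrite lerN2 => /(_ u1).
apply: le_trans; rewrite ler_expR normrN ger0_norm // sqrrN.
have : u ^+ 3 <= u ^+ 2 / 2 by rewrite exprSr ler_wpM2l // exprn_ge0.
lra.
Qed.

Lemma expRN_le_inv y : 0 <= y -> expR (- y) <= (1 + y)^-1.
Proof.
move=> y0; rewrite expRN lef_pV2 ?posrE ?expR_gt0 ?expR_ge1Dx //.
by rewrite ltr_wpDr.
Qed.

End ExpBounds.

(** * Truncated binomial expansions of [(1 - p) ^ l], each proved from the preceding one *)

Section Bernoulli.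
Variables (R : realFieldType) (p : R).
Hypothesis p01 : 0 <= p <= 1.
Implicit Types l : nat.

Let step l : (1 - p) ^+ l.+1 = (1 - p) ^+ l - p * (1 - p) ^+ l.
Proof. by rewrite exprS; ring. Qed.

Lemma bernoulli1 l : 1 - l%:R * p <= (1 - p) ^+ l.
Proof.
have [p0 p1] := andP p01.
elim: l => [|l IH]; first by rewrite expr0 mul0r subr0.
have : (1 - p) ^+ l <= 1 by rewrite exprn_ile1; lra.
rewrite step [l.+1%:R]mulrSr; nra.
Qed.

Lemma bernoulli2 l : (1 - p) ^+ l <= 1 - l%:R * p + l%:R * (l%:R - 1) / 2 * p ^+ 2.
Proof.
have [p0 p1] := andP p01.
elim: l => [|l IH]; first by rewrite expr0; lra.
have := bernoulli1 l; rewrite step [l.+1%:R]mulrSr => h.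
have := ler_wpM2l p0 h; set a := l%:R in IH *; set y := _ ^+ l in IH *; lra.
Qed.

Lemma bernoulli3 l : 1 - l%:R * p + l%:R * (l%:R - 1) / 2 * p ^+ 2
   - l%:R * (l%:R - 1) * (l%:R - 2) / 6 * p ^+ 3 <= (1 - p) ^+ l.
Proof.
have [p0 p1] := andP p01.
elim: l => [|l IH]; first by rewrite expr0; lra.
have := bernoulli2 l; rewrite step [l.+1%:R]mulrSr => h.
have := ler_wpM2l p0 h; set a := l%:R in IH *; set y := _ ^+ l in IH *; lra.
Qed.

Lemma bernoulli4 l : (1 - p) ^+ l <= 1 - l%:R * p + l%:R * (l%:R - 1) / 2 * p ^+ 2
   - l%:R * (l%:R - 1) * (l%:R - 2) / 6 * p ^+ 3
   + l%:R * (l%:R - 1) * (l%:R - 2) * (l%:R - 3) / 24 * p ^+ 4.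
Proof.
have [p0 p1] := andP p01.
elim: l => [|l IH]; first by rewrite expr0; lra.
have := bernoulli3 l; rewrite step [l.+1%:R]mulrSr => h.
have := ler_wpM2l p0 h; set a := l%:R in IH *; set y := _ ^+ l in IH *; lra.
Qed.

Lemma mul_expr1B_le l : l%:R * p * (1 - p) ^+ l <= 1 - (1 - p) ^+ l.
Proof.
have [p0 p1] := andP p01.
suff : (1 + l%:R * p) * (1 - p) ^+ l <= 1 by set y := _ ^+ l; lra.
elim: l => [|l IH]; first by rewrite expr0; lra.
apply: le_trans IH; rewrite exprS mulrA ler_wpM2r ?exprn_ge0 ?subr_ge0 //.
rewrite [l.+1%:R]mulrSr; have : 0 <= l%:R * p ^+ 2 by rewrite mulr_ge0 ?sqr_ge0.
have := sqr_ge0 p; lra.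
Qed.

End Bernoulli.

Section BoxProbability.
Variable R : realType.
Variables (p : R) (M : nat).
Hypothesis p01 : 0 < p < 1.

Let p0 : 0 < p. Proof. by case/andP: p01. Qed.
Let p1 : p < 1. Proof. by case/andP: p01. Qed.
Let hp : 0 <= p <= 1. Proof. by rewrite !ltW. Qed.
Let Q0 : 0 < 1 - p. Proof. by rewrite subr_gt0. Qed.

Lemma box_massE j : (j <= M.+1)%N -> box_mass p M j = (1 - p) ^+ j * (1 - (1 - p) ^+ (M.+1 - j)).
Proof. by move=> jM; rewrite mulrBr mulr1 -exprD subnKC. Qed.

Lemma box_prob j : (j <= M)%N ->
  p * (1 - p) ^+ j / box_mass p M j = p / (1 - (1 - p) ^+ (M.+1 - j)).
Proof.
move=> jM; rewrite box_massE ?leqW //.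
have h : (1 - p) ^+ j != 0 by rewrite expf_neq0 // gt_eqF.
have h1 : 1 - (1 - p) ^+ (M.+1 - j) != 0.
  rewrite gt_eqF // subr_gt0 exprn_ilt1 ?(ltW Q0) //; first by move: jM; clear; lia.
  by rewrite ltrBlDr ltrDl.
by field; rewrite h h1.
Qed.

Section Tilt.
Variable u0 : R.
Hypothesis u01 : 0 < u0 < 1.
(** The solution [s] of [1 - 1 / tilt s 0 = u0]. This is the quantity that [cond_survival_upper] and
    [cond_survival_lower] compare with survival, so [u0] is the candidate value of the survival
    probability. *)
Definition tilt_param := hit_prob p M * u0 / (1 - u0).
Definition tilt_gap j := 1 - (tilt p M tilt_param j)^-1.

Let u0_lt : 0 < 1 - u0. Proof. by rewrite subr_gt0; case/andP: u01. Qed.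
Let hit_prob0 : 0 < hit_prob p M. Proof. exact: hit_prob_gt0. Qed.

Lemma tilt_param_ge0 : 0 <= tilt_param.
Proof. by case/andP: u01 => h _; rewrite divr_ge0 ?ltW // mulr_gt0. Qed.

Lemma tilt_gapE j : (j <= M)%N -> tilt_gap j = tilt_param / (box_mass p M j + tilt_param).
Proof.
move=> jM; have D0 := box_mass_gt0 p01 jM; have s0 := tilt_param_ge0.
have ne : box_mass p M j + tilt_param != 0 by rewrite gt_eqF // ltr_wpDr.
by rewrite /tilt_gap /tilt; field; rewrite ne gt_eqF.
Qed.

Lemma tilt_gap0 : tilt_gap 0 = u0.
Proof.
rewrite tilt_gapE // (_ : box_mass p M 0 = hit_prob p M) /tilt_param; last by rewrite /box_mass expr0.
have : hit_prob p M != 0 by rewrite gt_eqF.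
have q2 : 1 - u0 != 0 by rewrite gt_eqF.
move: (hit_prob p M) => q q1; field; rewrite q2 /=.
by rewrite [X in X != 0](_ : _ = q) //; ring.
Qed.

Lemma box_mass_antitone i j : (i <= j)%N -> box_mass p M j <= box_mass p M i.
Proof. by move=> ij; rewrite lerB // ler_wiXn2l // ltW // ltrBlDr ltrDl. Qed.

(** The last bound limits the growth of the gap as the boxes run out. It holds because [tilt_gap j *
    box_mass p M j = s * (1 - tilt_gap j)] with [s = tilt_param], and the gap is at least [u0]. *)
Lemma tilt_gap_bounds j : (j <= M)%N -> [/\ u0 <= tilt_gap j, tilt_gap j < 1 & tilt_gap j * box_mass p M j <= u0 * hit_prob p M].
Proof.
move=> jM; have D0 := box_mass_gt0 p01 jM; have s0 := tilt_param_ge0.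
have ne : 0 < box_mass p M j + tilt_param by rewrite ltr_wpDr.
have D1 := box_mass_antitone (leq0n j); have D00 := box_mass_gt0 p01 (leq0n M).
have e0 : hit_prob p M = box_mass p M 0 by rewrite /box_mass expr0.
have hu : u0 <= tilt_gap j.
  have d0 : 0 < box_mass p M 0 + tilt_param by rewrite ltr_wpDr.
  have dd : box_mass p M j + tilt_param <= box_mass p M 0 + tilt_param by rewrite lerD2r.
  by rewrite -tilt_gap0 !tilt_gapE // ler_wpM2l // lef_pV2.
split=> //.
  by rewrite tilt_gapE // ltr_pdivrMr // mul1r ltrDr.
rewrite -tilt_gap0 !tilt_gapE // e0.
have -> : tilt_param / (box_mass p M j + tilt_param) * box_mass p M j = tilt_param - tilt_param * (tilt_param / (box_mass p M j + tilt_param)).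
  by field; rewrite gt_eqF.
have -> : tilt_param / (box_mass p M 0 + tilt_param) * box_mass p M 0 = tilt_param - tilt_param * (tilt_param / (box_mass p M 0 + tilt_param)).
  by field; rewrite gt_eqF // ltr_wpDr.
by rewrite lerB // ler_wpM2l // -!tilt_gapE // tilt_gap0.
Qed.

End Tilt.

End BoxProbability.

Lemma init_prob_core (F : realFieldType) (x v kk : F) : 0 < x -> x <= 8^-1 -> 0 < v <= 1 ->
  32 <= kk -> 2 / kk <= v ^+ 2 ->
  (x + x ^+ 2 + v) / (1 - 8 / kk) + 2 * v <= x + 2 * x ^+ 2 + 6 * v.
Proof.
move=> x0' x8' /andP[v0 v1] k32' kv.
pose u0 := (x + x ^+ 2 + v) / (1 - 8 / kk); rewrite -/u0.
have x2 : 0 < x ^+ 2 by rewrite exprn_gt0.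
have kk8 : 8 / kk <= 4^-1 by rewrite ler_pdivrMr //; lra.
have d0 : 0 < 1 - 8 / kk by lra.
have u0le : u0 <= (x + x ^+ 2 + v) * (1 + 16 / kk).
  rewrite /u0 ler_pdivrMr //.
  rewrite -[leRHS]mulrA ler_peMr //; first lra.
  have kinv : 0 < kk^-1 by rewrite invr_gt0; lra.
  have : kk^-1 <= 32^-1 by rewrite lef_pV2 ?posrE //; lra.
  nra.
have kvv : 2 / kk <= v by apply: (le_trans kv); rewrite expr2 ler_piMl // ltW.
have e16 : 16 / kk = 8 * (2 / kk) by field; rewrite gt_eqF //; lra.
have c16 : 16 / kk <= 2^-1 by rewrite ler_pdivrMr; lra.
have : (x + x ^+ 2) * (16 / kk) <= 9 / 64 * (8 * v).
  have xx : x ^+ 2 <= 8^-1 * x by rewrite expr2 ler_wpM2r // ltW.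
  have k2 : 0 <= 2 / kk by rewrite divr_ge0 //; lra.
  by rewrite e16 ler_pM //; lra.
nra.
Qed.

(** * Upper bound for the conditioned survival probability *)

Section TreeProbability.
Variable R : realType.
Variables (p x : R) (M : nat).
Hypothesis p01 : 0 < p < 1.
Hypothesis xE : x = M.+1%:R * p.
Hypothesis x8 : x <= 8^-1.

Let p0 : 0 < p. Proof. by case/andP: p01. Qed.
Let p1 : p < 1. Proof. by case/andP: p01. Qed.
Let hp : 0 <= p <= 1. Proof. by rewrite !ltW. Qed.
Let Q0 : 0 < 1 - p. Proof. by rewrite subr_gt0. Qed.
Let x0 : 0 < x. Proof. by rewrite xE mulr_gt0 // ltr0n. Qed.

Let lp_le (l : nat) : (l <= M.+1)%N -> l%:R * p <= x.
Proof. by move=> lk; rewrite xE ler_wpM2r ?(ltW p0) // ler_nat. Qed.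

Let q_gt0 (l : nat) : (0 < l)%N -> 0 < 1 - (1 - p) ^+ l.
Proof.
move=> l0; rewrite subr_gt0 exprn_ilt1 ?(ltW Q0) -?lt0n //.
by rewrite ltrBlDr ltrDl.
Qed.

(** With [l] boxes and [l] balls left, the left-hand side is the mean number of balls in the next
    box. It is about [1 + l p / 2]: at the start this is a branching process of mean [1 + x / 2],
    whose survival probability is about [x]. *)
Lemma box_prob_ub l : (0 < l <= M.+1)%N ->
  l%:R * (p / (1 - (1 - p) ^+ l)) <= 1 + x / 2 + x ^+ 2 / 2.
Proof.
move=> /andP[l0 lk]; have q0 := q_gt0 l0.
rewrite mulrA ler_pdivrMr //.
have := bernoulli2 hp l; have h1 := lp_le lk.
have l1 : 1 <= l%:R :> R by rewrite ler1n.
have x8' := x8; have x0' := x0; set y := l%:R * p in h1 *; set q := _ ^+ l in q0 * => h2.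
have y0 : 0 < y by rewrite mulr_gt0 // (lt_le_trans ltr01).
have h3 : y * (1 - y / 2) <= 1 - q.
  have : l%:R * (l%:R - 1) / 2 * p ^+ 2 <= y ^+ 2 / 2.
    have : 0 <= l%:R * p ^+ 2 by rewrite mulr_ge0 ?sqr_ge0 // ltW // (lt_le_trans ltr01).
    rewrite /y; lra.
  lra.
have h4 : y <= (1 + y / 2 + y ^+ 2 / 2) * (y * (1 - y / 2)).
  have : 0 <= y ^+ 3 * (1 - y) by rewrite mulr_ge0 ?exprn_ge0 ?(ltW y0) //; lra.
  lra.
apply: (le_trans h4).
have h5 : 0 <= y * (1 - y / 2) by rewrite mulr_ge0 ?(ltW y0) //; lra.
apply: (@le_trans _ _ ((1 + x / 2 + x ^+ 2 / 2) * (y * (1 - y / 2)))).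
  by rewrite ler_wpM2r //; nra.
by rewrite ler_wpM2l //; nra.
Qed.

Lemma box_prob_lb l : (0 < l <= M.+1)%N ->
  1 + (l%:R - 1) * p / 2 <= l%:R * (p / (1 - (1 - p) ^+ l)).
Proof.
move=> /andP[l0 lk]; have q0 := q_gt0 l0.
rewrite mulrA ler_pdivlMr //.
have := bernoulli3 hp l; have h1 := lp_le lk.
have l1 : 1 <= l%:R :> R by rewrite ler1n.
have x8' := x8; have x0' := x0; have p0' := p0; set q := _ ^+ l in q0 *; set L : R := l%:R in h1 l1 * => h2.
have h3 : 1 - q <= L * p * (1 - (L - 1) * p / 2 + (L - 1) * (L - 2) * p ^+ 2 / 6) by lra.
set y := (L - 1) * p / 2.
have y0 : 0 <= y by rewrite /y divr_ge0 // mulr_ge0 ?(ltW p0) //; lra.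
have y1 : y <= 16^-1 by rewrite /y; lra.
have h4 : 1 - q <= L * p * (1 - y + 2 * y ^+ 2 / 3).
  apply: (le_trans h3); rewrite ler_wpM2l //; first by rewrite mulr_ge0 ?(ltW p0) //; lra.
  have : 0 <= (L - 1) * p ^+ 2 by rewrite mulr_ge0 ?sqr_ge0 //; lra.
  rewrite /y; lra.
apply: (@le_trans _ _ ((1 + y) * (L * p * (1 - y + 2 * y ^+ 2 / 3)))).
  by rewrite ler_wpM2l //; lra.
have Lp0 : 0 <= L * p by rewrite mulr_ge0 ?(ltW p0) //; lra.
rewrite mulrCA -[leRHS]mulr1 ler_wpM2l //.
have : 0 <= y ^+ 2 * (1 - 2 * y) by rewrite mulr_ge0 ?sqr_ge0 //; lra.
lra.
Qed.

Section Tilt.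
Variable u0 : R.
Hypothesis u01 : 0 < u0 < 1.
Let sof := tilt_param p M u0.
Let uof := tilt_gap p M u0.

(* One upper step: [w] is the box probability and [l] the number of remaining boxes. *)
Let upper_num (kk u v l w : R) : u0 <= u -> u < 1 -> 32 <= kk -> kk / 2 <= l ->
  0 <= w -> l * w <= 1 + x / 2 + x ^+ 2 / 2 -> 0 <= v ->
  u0 * (1 - 8 / kk) = x + x ^+ 2 + v ->
  l * (w * u + (w * u) ^+ 2) - u - u ^+ 2 / 2 <= - (u0 * v / 2).
Proof.
move=> hu hu1 hk hl hw hlw v0 he.
have [u00 u10] := andP u01; have x8' := x8; have x0' := x0.
have kk0 : 0 < kk by lra.
have l0 : 0 < l by lra.
have hw2 : l * w ^+ 2 <= 4 / kk.
  rewrite ler_pdivlMr //.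
  have : l * w ^+ 2 * kk <= 2 * (l * w) ^+ 2.
    have : 0 <= l * w ^+ 2 by rewrite mulr_ge0 ?sqr_ge0 // ltW.
    nra.
  have : (l * w) ^+ 2 <= 2.
    have : 0 <= l * w by rewrite mulr_ge0 // ltW.
    have : x ^+ 2 <= x / 8 by rewrite expr2; nra.
    nra.
  lra.
have uu : 0 < u by lra.
have h1 : l * (w * u + (w * u) ^+ 2) <= u * (1 + x / 2 + x ^+ 2 / 2) + u ^+ 2 * (4 / kk).
  have := ler_wpM2l (ltW uu) hlw; have := ler_wpM2l (sqr_ge0 u) hw2; lra.
have h2 : u * (x + x ^+ 2 + v) <= u * (u * (1 - 8 / kk)).
  rewrite ler_wpM2l ?(ltW uu) // -he ler_wpM2r // subr_ge0 ler_pdivrMr //; lra.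
have : u0 * v <= u * v by rewrite ler_wpM2r.
have e4 : u ^+ 2 * (4 / kk) = u * (u * (8 / kk)) / 2 by field; rewrite gt_eqF.
move: h1; rewrite e4; lra.
Qed.

(** By [tilt_step] the value on death states changes by [(1 - u) / (1 - w u) ^ l], whose exponent
    changes sign near [u = x + x ^ 2]; [v] is the excess over that value. The term [8 / k] absorbs
    [l (w u) ^ 2], since [l >= k / 2] makes [l w ^ 2 <= 4 / k]. *)
Lemma tilt_upper v j : (32 <= M.+1)%N -> (j.*2 <= M.+1)%N -> 0 <= v ->
  u0 * (1 - 8 / M.+1%:R) = x + x ^+ 2 + v ->
  tilt p M sof j ^+ (M.+1 - j) <= expR (- (u0 * v / 2) * j%:R) * tilt p M sof 0 ^+ M.+1.
Proof.
move=> k32 hj v0 he; elim: j hj => [|j IH] hj.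
  by rewrite mulr0 expR0 mul1r subn0.
have jM : (j < M)%N by move: hj; clear; lia.
have jM' : (j.+1 <= M)%N by [].
have {}IH : tilt p M sof j ^+ (M.+1 - j) <= expR (- (u0 * v / 2) * j%:R) * tilt p M sof 0 ^+ M.+1.
  by apply: IH; move: hj; clear; lia.
have := tilt_step p01 (tilt_param_ge0 M p01 u01) jM => /=; rewrite -/sof -/(tilt_gap p M u0 j.+1) box_prob ?(ltnW jM) //.
have [hu1 hu2 _] := tilt_gap_bounds p01 u01 jM'; rewrite -/uof in hu1 hu2.
set u := uof j.+1 in hu1 hu2 *; set w := p / _ => e.
have lk : (0 < M.+1 - j <= M.+1)%N by move: jM; clear; lia.
have hw := box_prob_ub lk; have q0 : 0 < 1 - (1 - p) ^+ (M.+1 - j) by apply: q_gt0; case/andP: lk.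
have w0 : 0 <= w by rewrite divr_ge0 // ltW.
have kl : M.+1%:R / 2 <= (M.+1 - j)%:R :> R.
  by rewrite ler_pdivrMr // -natrM ler_nat; move: hj; clear; lia.
have k32' : 32 <= M.+1%:R :> R by rewrite ler_nat.
have hnum := upper_num hu1 hu2 k32' kl w0 hw v0 he.
have [u00 _] := andP u01.
have ww : w * u <= 2^-1.
  have l16 : 16 <= (M.+1 - j)%:R :> R by apply: le_trans kl; lra.
  have : 16 * w <= 1 + x / 2 + x ^+ 2 / 2.
    by apply: le_trans hw; rewrite ler_wpM2r.
  have x8' := x8; have x0' := x0; nra.
have wu0 : 0 <= w * u by rewrite mulr_ge0 //; lra.
have t0 : 0 <= tilt p M sof j ^+ (M.+1 - j).
  by rewrite exprn_ge0 // addr_ge0 // divr_ge0 ?(tilt_param_ge0 M p01 u01) // ltW // box_mass_gt0 // ltnW.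
have h1 : expR (- (w * u) - (w * u) ^+ 2) ^+ (M.+1 - j) <= (1 - w * u) ^+ (M.+1 - j).
  apply: lerXn2r; rewrite ?nnegrE ?expR_ge0 //; first by lra.
  by apply: ler_expR1B; rewrite wu0.
have h2 : 1 - u <= expR (- u - u ^+ 2 / 2) by apply: ler_1BexpR; lra.
have t1 : 0 <= tilt p M sof j.+1 ^+ (M.+1 - j.+1).
  by rewrite exprn_ge0 // addr_ge0 // divr_ge0 ?(tilt_param_ge0 M p01 u01) // ltW // box_mass_gt0.
have h3 : tilt p M sof j.+1 ^+ (M.+1 - j.+1) * expR ((- (w * u) - (w * u) ^+ 2) * (M.+1 - j)%:R) <=
   tilt p M sof j ^+ (M.+1 - j) * expR (- u - u ^+ 2 / 2).
  apply: (@le_trans _ _ (tilt p M sof j.+1 ^+ (M.+1 - j.+1) * (1 - w * u) ^+ (M.+1 - j))).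
    by rewrite ler_wpM2l // expRM_natr.
  by rewrite e ler_wpM2l.
rewrite -ler_pdivlMr ?expR_gt0 // -mulrA -expRB in h3.
apply: (le_trans h3).
have -> : - (u0 * v / 2) * j.+1%:R = - (u0 * v / 2) * j%:R + - (u0 * v / 2).
  by rewrite [j.+1%:R]mulrSr; ring.
rewrite (expRD (- (u0 * v / 2) * j%:R)) [leRHS]mulrAC ler_pM ?expR_ge0 //.
rewrite ler_expR; move: hnum; set L := (M.+1 - j)%:R; lra.
Qed.

End Tilt.

Lemma cond_survival_le m : (32 <= M.+1)%N -> (0 < m)%N -> (m.*2 <= M.+1)%N ->
  cond_survival p M m <= x + 2 * x ^+ 2 + 6 / Num.sqrt m%:R.
Proof.
move=> k32 m0 hm; have x8' := x8; have x0' := x0.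
have k32' : 32 <= M.+1%:R :> R by rewrite ler_nat.
have m1 : 1 <= m%:R :> R by rewrite ler1n.
(* With [y = u0 v m / 2], the bound becomes [u0 (1 + 1 / y) = u0 + 2 / (v m)]. The choice
   [v = m ^ (-1/2)] balances [2 / (v m)] against the excess [v] contained in [u0]. *)
pose v : R := (Num.sqrt m%:R)^-1.
have s0 : 0 < Num.sqrt m%:R :> R by rewrite sqrtr_gt0 (lt_le_trans ltr01).
have v0 : 0 < v by rewrite invr_gt0.
have v2 : m%:R * v ^+ 2 = 1 by rewrite exprVn sqr_sqrtr ?divff // ?gt_eqF // (lt_le_trans ltr01).
have mM : (m <= M)%N by move: hm m0; clear; lia.
have f1 := cond_survival_le1 p01 mM; have f0 := cond_survival_ge0 p01 mM.
have kv : 2 / M.+1%:R <= v ^+ 2.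
  rewrite exprVn sqr_sqrtr // ler_pdivrMr // mulrC ler_pdivlMr ?(lt_le_trans ltr01) //.
  by rewrite -natrM ler_nat; move: hm; clear; lia.
have v1 : v <= 1 by rewrite invf_le1 // -[leLHS]sqrtr1; apply: ler_wsqrtr.
have [kk kkE] : exists kk : R, kk = M.+1%:R by exists M.+1%:R.
rewrite -kkE in k32' kv.
have kk8 : 8 / kk <= 4^-1 by rewrite ler_pdivrMr //; lra.
pose u0 := (x + x ^+ 2 + v) / (1 - 8 / kk).
have d0 : 0 < 1 - 8 / kk by lra.
have x2 : 0 < x ^+ 2 by rewrite exprn_gt0.
have u00 : 0 < u0 by rewrite divr_gt0 //; lra.
have u0e : u0 * (1 - 8 / kk) = x + x ^+ 2 + v by rewrite divfK // gt_eqF.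
(* If [u0 >= 1], then [v >= 1 / 6] and the claimed bound is at least 1. *)
have [u1|u1] := ltP u0 1; last first.
  have : 6^-1 <= v by nra.
  rewrite -/v; nra.
have u01 : 0 < u0 < 1 by rewrite u00.
pose y := u0 * v / 2 * m%:R.
have m0' : 0 < m%:R :> R by lra.
have y0 : 0 < y by rewrite /y; apply: mulr_gt0 => //; apply: divr_gt0 => //; exact: mulr_gt0.
have tu j : (j.*2 <= M.+1)%N -> tilt p M (tilt_param p M u0) j ^+ (M.+1 - j) <=
    expR (- (u0 * v / 2) * j%:R) * tilt p M (tilt_param p M u0) 0 ^+ M.+1.
  by move=> hj; apply: tilt_upper => //; [exact: ltW | rewrite -kkE].
have t00 : 0 <= tilt p M (tilt_param p M u0) 0.
  by rewrite addr_ge0 // divr_ge0 ?(tilt_param_ge0 M p01 u01) // ltW // box_mass_gt0.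
have := @cond_survival_upper _ p M p01 (tilt_param p M u0) m (expR (- y)) (tilt_param_ge0 M p01 u01) mM.
rewrite -/(tilt_gap p M u0 0) tilt_gap0 // => h.
have {}h : cond_survival p M m * (1 - expR (- y)) <= u0.
  apply: h; last by apply: (le_trans (tu _ hm)); rewrite /y mulNr.
  move=> j /andP[j0 jm].
  have jm2 : (j.*2 <= M.+1)%N by move: hm jm; clear; lia.
  apply: (le_trans (tu _ jm2)); rewrite ler_piMl ?exprn_ge0 //.
  have uv : 0 <= u0 * v by rewrite mulr_ge0 // ltW.
  by rewrite expR_le1 mulNr oppr_le0 mulr_ge0 // divr_ge0.
have e1 := expRN_le_inv (ltW y0).
have h2 : cond_survival p M m * (y / (1 + y)) <= u0.
  apply: le_trans h; rewrite ler_wpM2l //.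
  have -> : y / (1 + y) = 1 - (1 + y)^-1 by field; rewrite gt_eqF //; lra.
  by rewrite lerB.
have h3 : cond_survival p M m * y <= u0 * (1 + y).
  move: h2; rewrite mulrA ler_pdivrMr //; lra.
have h4 : cond_survival p M m <= u0 + 2 * v.
  have : cond_survival p M m * y <= (u0 + 2 * v) * y.
    apply: (le_trans h3).
    have -> : (u0 + 2 * v) * y = u0 * (y + m%:R * v ^+ 2) by rewrite /y; field.
    by rewrite v2 addrC.
  by rewrite ler_pM2r.
apply: (le_trans h4); rewrite -/v; clear h h2 h3 h4 e1.
by apply: init_prob_core => //; rewrite v0.
Qed.

End TreeProbability.

Lemma init_gap_core (F : realFieldType) (x t u : F) : 0 < x -> x <= 8^-1 -> 0 < t <= 1 -> 0 <= u ->
  u * (1 - x) <= x * t * (1 - 4 * x) -> u <= x * t /\ u * (1 + 2 * u) <= x * t.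
Proof.
move=> x0 x8 /andP[t0 t1] u0 hu.
have xt1 : 0 < x * t by rewrite mulr_gt0.
have xt2 : x * t <= x by rewrite ler_piMr // ltW.
have ux : u <= x * t by nra.
split=> //; have hx : 0 < 1 - x by lra.
rewrite -(ler_pM2r hx).
apply: (@le_trans _ _ (x * t * (1 - 4 * x) * (1 + 2 * x))).
  by rewrite mulrAC ler_pM //; nra.
by rewrite -mulrA ler_wpM2l ?(ltW xt1) //; nra.
Qed.

Lemma stage_gap_core (F : realFieldType) (u0 u L y : F) : 0 <= u0 -> u0 <= u -> 0 <= y <= 8^-1 ->
  u <= y * (2 / 7) -> y <= L -> u0 * (L / 4) <= u * (L / 2 - u / 2 - u ^+ 2).
Proof.
move=> u00 uu /andP[y0 y8] uy yL.
have hh : L / 4 <= L / 2 - u / 2 - u ^+ 2 by nra.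
by rewrite ler_pM //; lra.
Qed.

Lemma decay_core (F : realFieldType) (fK fm u y e : F) : 1 + y <= e -> fm <= fK ->
  e * (fK - fm) <= fK - u -> 0 < u -> 0 < y -> fK * (1 - y^-1) <= fm.
Proof.
move=> he fKm h u0 y0.
have h5 : y * (fK - fm) <= fK.
  apply: (@le_trans _ _ (e * (fK - fm))); last by lra.
  by rewrite ler_wpM2r ?subr_ge0 //; lra.
have : fK - fm <= fK / y by rewrite ler_pdivlMr // mulrC.
lra.
Qed.

(** * Lower bounds for the conditioned survival probability *)

Section TreeLower.
Variable R : realType.
Variables (p x : R) (M : nat).
Hypothesis p01 : 0 < p < 1.
Hypothesis xE : x = M.+1%:R * p.
Hypothesis x8 : x <= 8^-1.

Let p0 : 0 < p. Proof. by case/andP: p01. Qed.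
Let hp : 0 <= p <= 1. Proof. by case/andP: p01 => *; rewrite !ltW. Qed.
Let Q0 : 0 < 1 - p. Proof. by rewrite subr_gt0; case/andP: p01. Qed.
Let x0 : 0 < x. Proof. by rewrite xE mulr_gt0 // ltr0n. Qed.

Section Tilt.
Variable u0 : R.
Hypothesis u01 : 0 < u0 < 1.
Let sof := tilt_param p M u0.
Let uof := tilt_gap p M u0.

Lemma tilt_gap_ub j : (j <= M)%N -> uof j * ((M.+1 - j)%:R * (1 - x)) <= u0 * M.+1%:R.
Proof.
move=> jM; have [hu1 hu2 h] := tilt_gap_bounds p01 u01 jM.
have [u00 _] := andP u01.
have h1 : hit_prob p M <= M.+1%:R * p.
  by have := bernoulli1 hp M.+1; rewrite /hit_prob; lra.
have h2 : p * ((M.+1 - j)%:R * (1 - x)) <= box_mass p M j.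
  rewrite box_massE ?leqW //.
  apply: (@le_trans _ _ ((1 - p) ^+ j * ((M.+1 - j)%:R * p * (1 - p) ^+ (M.+1 - j)))); last first.
    by rewrite ler_wpM2l ?exprn_ge0 ?(ltW Q0) // mul_expr1B_le.
  have -> : (1 - p) ^+ j * ((M.+1 - j)%:R * p * (1 - p) ^+ (M.+1 - j)) =
     p * ((M.+1 - j)%:R * (1 - p) ^+ M.+1).
    have -> : (1 - p) ^+ M.+1 = (1 - p) ^+ j * (1 - p) ^+ (M.+1 - j).
      by rewrite -exprD subnKC // leqW.
    by ring.
  rewrite ler_wpM2l ?(ltW p0) // ler_wpM2l //.
  by have := bernoulli1 hp M.+1; rewrite xE.
rewrite -(ler_pM2l p0) mulrCA.
apply: (@le_trans _ _ (uof j * box_mass p M j)).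
  by rewrite ler_wpM2l // (le_trans (ltW u00)).
apply: (le_trans h); rewrite mulrCA [leRHS]mulrC; move: h1; nra.
Qed.

(** A step gains when the drift [(M - j) p / 2] of the next box exceeds half the gap [u]; the term
    [u ^ 2] pays for the cubic error of [1 - u]. *)
Lemma tilt_lower_step c j : (j < M)%N -> uof j.+1 <= 2^-1 ->
  c <= uof j.+1 * ((M - j)%:R * p / 2 - uof j.+1 / 2 - uof j.+1 ^+ 2) ->
  tilt p M sof j ^+ (M.+1 - j) * expR c <= tilt p M sof j.+1 ^+ (M.+1 - j.+1).
Proof.
move=> jM; have jM' : (j.+1 <= M)%N by [].
have := tilt_step p01 (tilt_param_ge0 M p01 u01) jM => /=.
rewrite -/(tilt_gap p M u0 j.+1) box_prob ?(ltnW jM) // -/sof -/uof.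
have [hu1 hu2 _] := tilt_gap_bounds p01 u01 jM'.
have [u00 _] := andP u01.
rewrite -/uof in hu1 hu2.
have lk : (0 < M.+1 - j <= M.+1)%N by move: jM; clear; lia.
have hw := box_prob_lb p01 xE x8 lk.
have hw' := box_prob_ub p01 xE x8 lk.
have q0 : 0 < 1 - (1 - p) ^+ (M.+1 - j).
  have lk0 : (0 < M.+1 - j)%N by case/andP: lk.
  rewrite subr_gt0 exprn_ilt1 ?(ltW Q0) -?lt0n //.
  by rewrite ltrBlDr ltrDl.
have L1 : (M.+1 - j)%:R = (M - j)%:R + 1 :> R by rewrite subSn 1?ltnW // [LHS]mulrSr.
set u := uof j.+1 in hu1 hu2 *; set w := p / _ in hw hw' * => e hu3 hc.
have w0 : 0 <= w by rewrite divr_ge0 // ltW.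
have t0 : 0 <= tilt p M sof j ^+ (M.+1 - j).
  rewrite exprn_ge0 // addr_ge0 // divr_ge0 ?(tilt_param_ge0 M p01 u01) // ltW // box_mass_gt0 //.
  exact: ltnW.
have t1 : 0 <= tilt p M sof j.+1 ^+ (M.+1 - j.+1).
  by rewrite exprn_ge0 // addr_ge0 // divr_ge0 ?(tilt_param_ge0 M p01 u01) // ltW // box_mass_gt0.
have w1 : w <= 2.
  apply: (@le_trans _ _ ((M.+1 - j)%:R * w)).
    by rewrite ler_peMl // ler1n; case/andP: lk.
  apply: (le_trans hw'); have := x8; have := x0; move: (x) => y; nra.
have h1 : (1 - w * u) ^+ (M.+1 - j) <= expR (- (w * u)) ^+ (M.+1 - j).
  apply: lerXn2r; rewrite ?nnegrE ?expR_ge0 //; first by rewrite subr_ge0; nra.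
  exact: expR_ge1Dx.
have h2 : expR (- u - u ^+ 2 / 2 - u ^+ 3) <= 1 - u.
  have := @expR_cubic_le _ (- u); rewrite lerN2 => /(_ hu3).
  by rewrite sqrrN normrN ger0_norm //; lra.
have h3 : tilt p M sof j ^+ (M.+1 - j) * expR (- u - u ^+ 2 / 2 - u ^+ 3) <=
   tilt p M sof j.+1 ^+ (M.+1 - j.+1) * expR (- (w * u) * (M.+1 - j)%:R).
  apply: (@le_trans _ _ (tilt p M sof j ^+ (M.+1 - j) * (1 - u))).
    by rewrite ler_wpM2l.
  by rewrite -e ler_wpM2l // expRM_natr.
rewrite -ler_pdivrMr ?expR_gt0 // -mulrA -expRB in h3.
apply: le_trans h3; rewrite ler_wpM2l // ler_expR.
have u00' : 0 <= u by lra.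
have := ler_wpM2l u00' hw; rewrite L1 in hw *.
move: hc; set L := (M - j)%:R; lra.
Qed.

End Tilt.

(** The right [u0] keeps the gap below critical up to time [K]. With [t = 1 - K / k], one factor [t]
    accounts for the drift, which falls to about [x t / 2], and the other for the growth of the gap
    by up to [1 / t] in [tilt_gap_ub]. *)
Lemma cond_survival_ge_init K : (K <= M)%N ->
  x * (1 - K%:R / M.+1%:R) ^+ 2 * (1 - 4 * x) <= cond_survival p M K.
Proof.
move=> KM; have x8' := x8; have x0' := x0; have p0' := p0.
have [k kE] : exists k : R, k = M.+1%:R by exists M.+1%:R.
have k0 : 0 < k by rewrite kE ltr0n.
have [t tE] : exists t : R, t = 1 - K%:R / k by exists (1 - K%:R / k).
have Kk : K%:R < k by rewrite kE ltr_nat ltnS.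
have Ki : 0 <= K%:R / k by rewrite divr_ge0 // ltW.
have Ki1 : K%:R / k < 1 by rewrite ltr_pdivrMr // mul1r.
have tk : t * k = k - K%:R by rewrite tE mulrBl mul1r divfK // gt_eqF.
have t01 : 0 < t <= 1 by rewrite tE; apply/andP; split; lra.
have [t0 t1] := andP t01.
rewrite -kE -tE; set u0 := x * t ^+ 2 * (1 - 4 * x).
have t2 : 0 < t ^+ 2 <= 1 by rewrite exprn_gt0 // exprn_ile1 // ltW.
have [t20 t21] := andP t2.
have xt : 0 < x * t ^+ 2 <= 8^-1 by rewrite mulr_gt0 //=; nra.
have u01 : 0 < u0 < 1 by case/andP: xt => *; rewrite /u0; apply/andP; split; nra.
have hstep j : (j < K)%N ->
   tilt p M (tilt_param p M u0) j ^+ (M.+1 - j) <= tilt p M (tilt_param p M u0) j.+1 ^+ (M.+1 - j.+1).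
  move=> jK; have jM : (j < M)%N by apply: leq_trans KM.
  have [hu1 hu2 _] := tilt_gap_bounds p01 u01 jM.
  have := tilt_gap_ub u01 jM; set u := tilt_gap _ _ _ _ in hu1 hu2 *.
  rewrite -kE subSS => hu.
  have Lk : k - K%:R <= (M - j)%:R.
    by rewrite kE -natrB ?leqW // ler_nat; move: jK KM; clear; lia.
  have u00 : 0 <= u by case/andP: u01 => *; lra.
  have hu4 : u * (1 - x) <= x * t * (1 - 4 * x).
    have : u * (1 - x) * (t * k) <= u0 * k.
      apply: le_trans hu; rewrite tk mulrAC -mulrA ler_wpM2l // ler_wpM2r //; lra.
    have -> : u0 * k = x * t * (1 - 4 * x) * (t * k) by rewrite /u0; ring.
    by rewrite ler_pM2r // mulr_gt0.
  have xt2 : x * t <= x by rewrite ler_piMr // ltW.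
  have [hu5 hu6] := init_gap_core x0' x8' t01 u00 hu4.
  have Lp : x * t <= (M - j)%:R * p.
    have -> : x * t = (k - K%:R) * p by rewrite -tk kE xE; ring.
    by rewrite ler_wpM2r // ltW.
  have := @tilt_lower_step u0 u01 0 j jM; rewrite expR0 mulr1; apply.
    by rewrite -/u; lra.
  rewrite -/u mulr_ge0 //.
  move: Lp hu6; set L := (M - j)%:R * p; lra.
have hA j : (j <= K)%N -> tilt p M (tilt_param p M u0) 0 ^+ M.+1 <= tilt p M (tilt_param p M u0) j ^+ (M.+1 - j).
  elim: j => [|j IH] jK; first by rewrite subn0.
  by apply: (le_trans (IH (ltnW jK))); exact: hstep.
have := @cond_survival_lower _ p M p01 (tilt_param p M u0) K K 1 (tilt_param_ge0 M p01 u01).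
rewrite leqnn KM -/(tilt_gap p M u0 0) tilt_gap0 // => /(_ isT) h.
have : 1 * (cond_survival p M K - cond_survival p M K) <= cond_survival p M K - u0.
  apply: h => j /andP[h1 h2]; first exact: hA.
  by move: (leq_trans h1 h2); rewrite ltnn.
lra.
Qed.

(** With the smaller value [u0 = d ^ 2 x / 4], each of the first [K <= k / 2] steps gains a factor
    [exp c], [c = u0 x / 8], and no later step up to [m] loses. A death after [K] thus weighs
    [exp (c K) >= 1 + c K], so at most a share [1 / (c K) = 32 / (K d ^ 2 x ^ 2)] of the runs alive
    at [K] dies before [m]. *)
Lemma cond_survival_ge_stage K m : (0 < K)%N -> (K <= m <= M)%N -> (K.*2 <= M.+1)%N ->
  let d := 1 - m%:R / M.+1%:R in
  cond_survival p M K * (1 - 32 / (K%:R * d ^+ 2 * x ^+ 2)) <= cond_survival p M m.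
Proof.
move=> K0 /andP[Km mM] K2 /=; have x8' := x8; have x0' := x0; have p0' := p0.
have [k kE] : exists k : R, k = M.+1%:R by exists M.+1%:R.
have k0 : 0 < k by rewrite kE ltr0n.
have [t tE] : exists t : R, t = 1 - m%:R / k by exists (1 - m%:R / k).
have Kk : m%:R < k by rewrite kE ltr_nat ltnS.
have Ki : 0 <= m%:R / k by rewrite divr_ge0 // ltW.
have Ki1 : m%:R / k < 1 by rewrite ltr_pdivrMr // mul1r.
have tk : t * k = k - m%:R by rewrite tE mulrBl mul1r divfK // gt_eqF.
have t01 : 0 < t <= 1 by rewrite tE; apply/andP; split; lra.
have [t0 t1] := andP t01.
rewrite -kE -tE; set u0 := t ^+ 2 * x / 4.
have t2 : 0 < t ^+ 2 <= 1 by rewrite exprn_gt0 // exprn_ile1 // ltW.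
have [t20 t21] := andP t2.
have u01 : 0 < u0 < 1 by rewrite /u0; apply/andP; split; nra.
have [u00 u0lt] := andP u01.
have hstep c j : (j < m)%N -> c <= u0 * ((M - j)%:R * p) / 4 ->
   tilt p M (tilt_param p M u0) j ^+ (M.+1 - j) * expR c <=
   tilt p M (tilt_param p M u0) j.+1 ^+ (M.+1 - j.+1).
  move=> jK hc; have jM : (j < M)%N by apply: leq_trans mM.
  have [hu1 hu2 _] := tilt_gap_bounds p01 u01 jM.
  have := tilt_gap_ub u01 jM; set u := tilt_gap _ _ _ _ in hu1 hu2 *.
  rewrite -kE subSS => hu.
  have Lk : k - m%:R <= (M - j)%:R.
    by rewrite kE -natrB ?leqW // ler_nat; move: jK mM; clear; lia.
  have u00' : 0 <= u by lra.
  have hu4 : u * (1 - x) <= x * t / 4.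
    have : u * (1 - x) * (t * k) <= u0 * k.
      apply: le_trans hu; rewrite tk mulrAC -mulrA ler_wpM2l // ler_wpM2r //; lra.
    have -> : u0 * k = x * t / 4 * (t * k) by rewrite /u0; field.
    by rewrite ler_pM2r // mulr_gt0.
  have xt0 : 0 < x * t <= x by rewrite mulr_gt0 //= ler_piMr // ltW.
  have [xt1 xt2] := andP xt0.
  have hu5 : u <= x * t * (2 / 7) by nra.
  have Lp : x * t <= (M - j)%:R * p.
    have -> : x * t = (k - m%:R) * p by rewrite -tk kE xE; ring.
    by rewrite ler_wpM2r // ltW.
  apply: (@tilt_lower_step u0 u01 c j jM); rewrite -/u; first by lra.
  apply: (le_trans hc).
  move: Lp; set L := (M - j)%:R * p => Lp.
  have xt8 : 0 <= x * t <= 8^-1 by rewrite (ltW xt1) (le_trans xt2).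
  have := stage_gap_core (ltW u00) hu1 xt8 hu5 Lp.
  lra.
pose c := u0 * x / 8.
have hA j : (j <= K)%N -> tilt p M (tilt_param p M u0) 0 ^+ M.+1 * expR (c * j%:R) <=
    tilt p M (tilt_param p M u0) j ^+ (M.+1 - j).
  elim: j => [|j IH] jK; first by rewrite mulr0 expR0 mulr1 subn0.
  have -> : c * j.+1%:R = c * j%:R + c by rewrite [j.+1%:R]mulrSr; ring.
  rewrite expRD mulrA.
  apply: (@le_trans _ _ (tilt p M (tilt_param p M u0) j ^+ (M.+1 - j) * expR c)).
    by rewrite ler_wpM2r ?expR_ge0 // IH // ltnW.
  apply: hstep; first by apply: leq_trans Km.
  have : k / 2 <= (M - j)%:R.
    by rewrite ler_pdivrMr // kE -natrM ler_nat; move: jK K2; clear; lia.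
  move=> /(ler_wpM2r (ltW p0)) hk.
  have -> : c = u0 * (k / 2 * p) / 4 by rewrite /c xE kE; field.
  by rewrite ler_pM2r // ler_wpM2l // ltW.
have hB j : (K <= j <= m)%N -> tilt p M (tilt_param p M u0) 0 ^+ M.+1 * expR (c * K%:R) <=
    tilt p M (tilt_param p M u0) j ^+ (M.+1 - j).
  elim: j => [|j IH] /andP[Kj jm]; first by rewrite leqNgt K0 in Kj.
  move: Kj; rewrite leq_eqVlt => /orP[/eqP <-|Kj]; first exact: hA.
  apply: (le_trans (IH _)); first by rewrite -ltnS Kj ltnW.
  have := @hstep 0 j jm; rewrite expR0 mulr1; apply.
  by rewrite divr_ge0 // mulr_ge0 ?(ltW u00) // mulr_ge0 // ltW.
have T0 : 0 <= tilt p M (tilt_param p M u0) 0 ^+ M.+1.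
  by rewrite exprn_ge0 // addr_ge0 // divr_ge0 ?(tilt_param_ge0 M p01 u01) // ltW // box_mass_gt0.
have c0 : 0 < c by rewrite /c divr_gt0 // mulr_gt0.
have := @cond_survival_lower _ p M p01 (tilt_param p M u0) m K (expR (c * K%:R)) (tilt_param_ge0 M p01 u01).
rewrite Km mM -/(tilt_gap p M u0 0) tilt_gap0 // => /(_ isT) h.
have {}h : expR (c * K%:R) * (cond_survival p M K - cond_survival p M m) <= cond_survival p M K - u0.
  apply: h => j /andP[h1 h2].
    apply: le_trans (hA _ h2); rewrite ler_peMr // -expR0 ler_expR mulr_ge0 //.
    exact: ltW.
  by rewrite mulrC; apply: hB; rewrite (ltnW h1).
have K0' : 0 < K%:R :> R by rewrite ltr0n.
have y0 : 0 < c * K%:R by rewrite mulr_gt0.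
have -> : 32 / (K%:R * t ^+ 2 * x ^+ 2) = (c * K%:R)^-1.
  by rewrite /c /u0; field; rewrite !gt_eqF.
have he := expR_ge1Dx (c * K%:R).
have fK := @cond_survival_ge0 _ p M p01 K (leq_trans Km mM).
have fKm : cond_survival p M m <= cond_survival p M K by apply: cond_survival_antitone; rewrite ?Km.
exact: decay_core he fKm h u00 y0.
Qed.

End TreeLower.

Lemma sum_inv_sqrt_le (R : realType) (n : nat) :
  \sum_(i < n) (Num.sqrt i.+1%:R)^-1 <= 2 * Num.sqrt n%:R :> R.
Proof.
elim: n => [|n IH]; first by rewrite big_ord0 mulr_ge0 // sqrtr_ge0.
rewrite big_ord_recr /=; apply: (le_trans (lerD IH (lexx _))).
have a0 : 0 <= Num.sqrt n%:R :> R by apply: sqrtr_ge0.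
have b0 : 0 < Num.sqrt n.+1%:R :> R by rewrite sqrtr_gt0 ltr0n.
have a2 : Num.sqrt n%:R ^+ 2 = n%:R :> R by rewrite sqr_sqrtr.
have b2 : Num.sqrt n.+1%:R ^+ 2 = n%:R + 1 :> R by rewrite sqr_sqrtr // [LHS]mulrSr.
move: a0 b0 a2 b2; set a := Num.sqrt n%:R; set b := Num.sqrt n.+1%:R => a0 b0 a2 b2.
rewrite -lerBrDl -[leLHS]mul1r ler_pdivrMr //.
have := sqr_ge0 (b - a); lra.
Qed.

Definition tree_prob (R : realFieldType) (p : R) (M : nat) : R := busy p M M / hit_prob p M ^+ M.

(** Here [a], [b], [Y] stand for [q (l + 1)], [q (l + 2)], [(1 - p) ^ l]. With [t = (l + 2) p] and
    [s = (l + 1) p], the first order cancels in [t - b], leaving about [t s / 2], while [b a] is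
    about [t s]: this is the origin of the weight [p / 2]. *)
Lemma weight_core (F : realFieldType) (p x L a b Y : F) : 0 < p -> 0 < x -> x <= 8^-1 ->
  1 - x <= Y -> Y <= 1 -> 0 < a -> 0 < b -> 0 <= L -> (L + 1 + 1) * p <= x ->
  1 - b <= 1 - (L + 1 + 1) * p + (L + 1 + 1) * (L + 1 + 1 - 1) / 2 * p ^+ 2 ->
  1 - (L + 1 + 1) * p + (L + 1 + 1) * (L + 1 + 1 - 1) / 2 * p ^+ 2 -
    (L + 1 + 1) * (L + 1 + 1 - 1) * (L + 1 + 1 - 2) / 6 * p ^+ 3 <= 1 - b ->
  1 - a <= 1 - (L + 1) * p + (L + 1) * (L + 1 - 1) / 2 * p ^+ 2 ->
  a <= (L + 1) * p -> b <= (L + 1 + 1) * p ->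
  p / 2 * (1 - 2 * x) <= p * Y * ((L + 1 + 1) * p - b) / (b * a) <= p / 2 * (1 + 2 * x).
Proof.
move=> p0' x0' x8' hQ hQ1 a0 b0 l0 lx h1 h2 h3 u1 u2.
have [t tE] : exists t, t = (L + 1 + 1) * p by exists ((L + 1 + 1) * p).
have [s sE] : exists s, s = (L + 1) * p by exists ((L + 1) * p).
have s0 : 0 < s by rewrite sE mulr_gt0 //; lra.
have st : t = s + p by rewrite tE sE; ring.
have t0 : 0 < t by rewrite st addr_gt0.
have ts0 : 0 < t * s by rewrite mulr_gt0.
have num_ub : t - b <= t * s / 2.
  rewrite tE sE; lra.
clear h1; have num_lb : t * s / 2 * (1 - x / 3) <= t - b.
  have : t * s / 2 - t * s * (L * p) / 6 <= t - b by rewrite tE sE; lra.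
  have : t * s * (L * p) <= t * s * x.
    rewrite ler_wpM2l ?(ltW ts0) //.
    by apply: le_trans lx; rewrite ler_wpM2r ?(ltW p0') //; lra.
  lra.
clear h2; have den_b : t * (1 - x / 2) <= b.
  have : t * s <= t * x by rewrite ler_wpM2l ?(ltW t0) //; lra.
  lra.
have den_a : s * (1 - x / 2) <= a.
  have : s * (L * p) <= s * x.
    rewrite ler_wpM2l ?(ltW s0) //.
    by apply: le_trans lx; rewrite ler_wpM2r ?(ltW p0') //; lra.
  have : s - s * (L * p) / 2 <= a by rewrite sE; lra.
  lra.
have ba0 : 0 < b * a by rewrite mulr_gt0.
have ba_ub : b * a <= t * s by rewrite ler_pM ?(ltW a0) ?(ltW b0) // ?tE ?sE.
have tb : b <= t by rewrite tE.
clear h3 u1 u2.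
have ba_lb : t * s * (1 - x / 2) ^+ 2 <= b * a.
  rewrite (_ : t * s * _ = t * (1 - x / 2) * (s * (1 - x / 2))); last by ring.
  by rewrite ler_pM // mulr_ge0 ?(ltW t0) ?(ltW s0) //; lra.
rewrite -tE; clear tE sE st; apply/andP; split.
  rewrite ler_pdivlMr //.
  apply: (@le_trans _ _ (p / 2 * (1 - 2 * x) * (t * s))).
    by rewrite ler_wpM2l // mulr_ge0 //; lra.
  apply: (@le_trans _ _ (p * ((1 - x) * (t * s / 2 * (1 - x / 3))))).
    have : (1 - 2 * x) * (t * s) <= (1 - x) * (1 - x / 3) * (t * s).
      by rewrite ler_wpM2r ?(ltW ts0) //; nra.
    move: p0' => pp hh; have := ler_wpM2l (ltW pp) hh; lra.
  rewrite -[leRHS]mulrA ler_wpM2l ?(ltW p0') // ler_pM //; first by lra.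
  by rewrite mulr_ge0 // ?divr_ge0 ?(ltW ts0) //; lra.
rewrite ler_pdivrMr //.
apply: (@le_trans _ _ (p * (t * s / 2))).
  rewrite -[leLHS]mulrA ler_wpM2l ?(ltW p0') // (le_trans _ num_ub) // ler_piMl //; lra.
apply: (@le_trans _ _ (p / 2 * (1 + 2 * x) * (t * s * (1 - x / 2) ^+ 2))); last first.
  by rewrite ler_wpM2l // mulr_ge0 //; lra.
have hx : 1 <= (1 + 2 * x) * (1 - x / 2) ^+ 2 by nra.
have pts : 0 <= p * (t * s) by rewrite mulr_ge0 ?(ltW ts0) // ltW.
have := ler_wpM2l pts hx; lra.
Qed.

Lemma tree_prob_ub_core (F : realFieldType) (x b k g : F) : 0 < x -> x <= 8^-1 -> 2^-1 <= b ->
  0 < g -> g ^+ 2 * k = 1 -> b ^+ 3 <= k * x ^+ 2 ->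
  2 * g ^+ 2 + (1 + 2 * x) / 2 * x * (x + 2 * x ^+ 2 + 25 * g) <=
  x ^+ 2 / 2 + 32 * x ^+ 2 * (x + b^-1).
Proof.
move=> x0' x8' b2 g0 gk hb.
set B := x + 2 * x ^+ 2.
have b0 : 0 < b by lra.
have [c cE] : exists c, c = b^-1 by exists b^-1.
have c0 : 0 < c by rewrite cE invr_gt0.
have bc : b * c = 1 by rewrite cE divff // gt_eqF.
rewrite -cE.
have hbg : b * (b * g) ^+ 2 <= x ^+ 2.
  have gg : 0 <= g ^+ 2 by apply: sqr_ge0.
  have := ler_wpM2r gg hb.
  have -> : k * x ^+ 2 * g ^+ 2 = x ^+ 2 by rewrite -[RHS]mul1r -gk; ring.
  by congr (_ <= _); ring.
have bg0 : 0 < b * g by rewrite mulr_gt0.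
have bg : b * g <= 3 / 2 * x.
  rewrite -(@ler_pXn2r _ 2) ?nnegrE ?(ltW bg0) //; last by lra.
  have : (b * g) ^+ 2 / 2 <= b * (b * g) ^+ 2 by have := sqr_ge0 (b * g); nra.
  have := sqr_ge0 x; rewrite exprMn; lra.
have gx : g <= 3 / 2 * x * c.
  have := ler_wpM2r (ltW c0) bg; rewrite mulrAC bc mul1r //.
have g2x : g ^+ 2 <= 4 * x ^+ 2 * c.
  have b4 : b * (g ^+ 2) <= 4 * x ^+ 2.
    have : b * g ^+ 2 <= 4 * (b * (b * g) ^+ 2).
      have gg : 0 <= b * g ^+ 2 by rewrite mulr_ge0 ?sqr_ge0 // ltW.
      rewrite exprMn; have : 1 <= 4 * b ^+ 2 by nra.
      move=> /(ler_wpM2r gg); lra.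
    lra.
  have := ler_wpM2r (ltW c0) b4; rewrite mulrAC bc mul1r //.
have hx2 : 0 < x ^+ 2 by rewrite exprn_gt0.
have xg : (1 + 2 * x) / 2 * x * (25 * g) <= 24 * x ^+ 2 * c.
  have : x * g <= 3 / 2 * x ^+ 2 * c.
    by have := ler_wpM2l (ltW x0') gx; rewrite [leRHS](_ : _ = 3 / 2 * x ^+ 2 * c) //; ring.
  have : 0 <= x * g by rewrite mulr_ge0 // ltW.
  move: (x * g) => y; nra.
have : (1 + 2 * x) / 2 * x * B <= x ^+ 2 / 2 + 3 * x ^+ 3.
  rewrite /B; have : 0 < x ^+ 3 by rewrite exprn_gt0.
  have : x ^+ 4 <= x ^+ 3 / 8 by rewrite exprSr ler_wpM2l ?exprn_ge0 ?(ltW x0') //.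
  lra.
have : 0 < x ^+ 3 by rewrite exprn_gt0.
lra.
Qed.

(** * The probability of connectedness, given that all balls are placed *)

Section TreeEstimate.
Variable R : realType.
Variables (p x : R) (M : nat).
Hypothesis p01 : 0 < p < 1.
Hypothesis xE : x = M.+2%:R * p.
Hypothesis x8 : x <= 8^-1.
Hypothesis M64 : (64 <= M.+2)%N.
Let N := M.+1.

Let p0 : 0 < p. Proof. by case/andP: p01. Qed.
Let hp : 0 <= p <= 1. Proof. by case/andP: p01 => *; rewrite !ltW. Qed.
Let Q0 : 0 < 1 - p. Proof. by rewrite subr_gt0; case/andP: p01. Qed.
Let Q1 : 1 - p < 1. Proof. by rewrite ltrBlDr ltrDl; case/andP: p01. Qed.
Let x0 : 0 < x. Proof. by rewrite xE mulr_gt0 // ltr0n. Qed.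

Let q (l : nat) := 1 - (1 - p) ^+ l.
Let q_gt0 l : (0 < l)%N -> 0 < q l.
Proof. by move=> l0; rewrite subr_gt0 exprn_ilt1 ?(ltW Q0) -?lt0n //. Qed.

Let W i := box_mass p N N * ((M.+1%:R - i%:R) / box_mass p N i.+1 - (M.+2%:R - i%:R) / box_mass p N i).

Let WE i l : (i + l = M)%N ->
  W i = p * (1 - p) ^+ l * (l.+2%:R * p - q l.+2) / (q l.+2 * q l.+1).
Proof.
move=> ilM; rewrite /W !box_massE /N ?subSnn; [|by move: ilM; clear; lia..].
have -> : (M.+2 - i.+1 = l.+1)%N by move: ilM; clear; lia.
have -> : (M.+2 - i = l.+2)%N by move: ilM; clear; lia.
have -> : M.+1%:R - i%:R = l.+1%:R :> R.
  by rewrite -natrB; [congr _%:R|]; move: ilM; clear; lia.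
have -> : M.+2%:R - i%:R = l.+2%:R :> R.
  by rewrite -natrB; [congr _%:R|]; move: ilM; clear; lia.
have -> : M.+1 = (i + l.+1)%N by move: ilM; clear; lia.
have a0 := gt_eqF (q_gt0 (ltn0Sn l)); have b0 := gt_eqF (q_gt0 (ltn0Sn l.+1)).
have -> : q l.+2 = q l.+1 + p * (1 - p) ^+ l.+1 by rewrite /q [in LHS]exprS; ring.
move: b0; rewrite -/(q l.+1) -/(q l.+2).
have -> : q l.+2 = q l.+1 + p * (1 - p) ^+ l.+1 by rewrite /q [in LHS]exprS; ring.
have eQ : (1 - p) ^+ l.+1 = 1 - q l.+1 by rewrite /q; ring.
have z0 : (1 - p) ^+ i != 0 by rewrite expf_neq0 // gt_eqF.
have z1 : 1 - p != 0 by rewrite gt_eqF.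
rewrite exprD expr1 !exprS; set X := (1 - p) ^+ i in z0 *.
have -> : (1 - p) * (1 - p) ^+ l = 1 - q l.+1 by rewrite -exprS.
have -> : (1 - p) ^+ l = (1 - q l.+1) / (1 - p) by rewrite -eQ exprS mulrC mulKf.
move: a0; set a := q l.+1 => a0 b0.
rewrite [l.+2%:R]mulrSr; set L := l.+1%:R.
by field; rewrite z0 z1 a0 b0.
Qed.

Let q_ub l : q l <= l%:R * p.
Proof. by have := bernoulli1 hp l; rewrite /q; lra. Qed.

Let W_bounds i : (i <= M)%N ->
  p / 2 * (1 - 2 * x) <= W i <= p / 2 * (1 + 2 * x).
Proof.
move=> iM; have ilM : (i + (M - i) = M)%N by rewrite subnKC.
rewrite (WE ilM); set l := (M - i)%N.
have lx : l.+2%:R * p <= x.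
  by rewrite xE ler_wpM2r ?(ltW p0) // ler_nat !ltnS leq_subr.
have h1 := bernoulli2 hp l.+2; have h2 := bernoulli3 hp l.+2; have h3 := bernoulli2 hp l.+1.
have u1 := q_ub l.+1; have u2 := q_ub l.+2.
have hQ : 1 - x <= (1 - p) ^+ l.
  apply: le_trans (bernoulli1 hp l); rewrite lerB //.
  by apply: le_trans lx; rewrite ler_wpM2r ?(ltW p0) // ler_nat leqW.
have hQ1 : (1 - p) ^+ l <= 1 by rewrite exprn_ile1 // ltW.
have a0 := q_gt0 (ltn0Sn l); have b0 := q_gt0 (ltn0Sn l.+1).
have l0 : 0 <= l%:R :> R by [].
move: lx h1 h2 h3 u1 u2.
rewrite -/(q l.+1) (_ : (1 - p) ^+ l.+2 = 1 - q l.+2); last by rewrite /q; ring.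
rewrite (_ : (1 - p) ^+ l.+1 = 1 - q l.+1); last by rewrite /q; ring.
rewrite [l.+2%:R]mulrSr [l.+1%:R]mulrSr.
move: hQ hQ1 a0 b0 l0; set a := q l.+1; set b := q l.+2; set Y := (1 - p) ^+ l; set L : R := l%:R.
clearbody a b Y L => hQ hQ1 a0 b0 l0 lx h1 h2 h3 u1 u2.
exact: weight_core (p0) (x0) x8 hQ hQ1 a0 b0 l0 lx h1 h2 h3 u1 u2.
Qed.

Lemma tree_prob_ge0 : 0 <= tree_prob p M.+1.
Proof.
by rewrite divr_ge0 ?busy_ge0 // exprn_ge0 // ltW // (hit_prob_gt0 _ p01).
Qed.

Let tree_probE : tree_prob p M.+1 = box_mass p N N / hit_prob p N + \sum_(i < N) cond_survival p N i * W i.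
Proof. exact: busy_diag_sum. Qed.

(** The bounds [cond_survival_le] are summed up to time [k / 2] and continued by monotonicity. Their
    terms [6 / sqrt i] add up to order [sqrt k] against a total of about [k x], a relative error of
    order [(k x ^ 2) ^ (-1/2)], which [b] controls. *)
Lemma tree_prob_ub b : 2^-1 <= b -> b ^+ 3 <= M.+2%:R * x ^+ 2 ->
  tree_prob p M.+1 <= x ^+ 2 / 2 + 32 * x ^+ 2 * (x + b^-1).
Proof.
move=> b2 hb; have x8' := x8; have x0' := x0; have p0' := p0.
have [k kE] : exists k : R, k = M.+2%:R by exists M.+2%:R.
have k64 : 64 <= k by rewrite kE ler_nat.
have [g gE] : exists g : R, g = (Num.sqrt k)^-1 by exists (Num.sqrt k)^-1.
have sk0 : 0 < Num.sqrt k by rewrite sqrtr_gt0; lra.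
have sk2 : Num.sqrt k ^+ 2 = k by rewrite sqr_sqrtr //; lra.
have g0 : 0 < g by rewrite gE invr_gt0.
have gk : g ^+ 2 * k = 1 by rewrite gE exprVn sk2 mulVf // gt_eqF //; lra.
have gsk : Num.sqrt k = g * k by rewrite gE -{3}sk2 expr2 mulKf // gt_eqF.
pose h := M.+2./2.
have hk4 : k / 4 <= h%:R.
  rewrite ler_pdivrMr // kE -natrM ler_nat /h; move: M64; clear; lia.
have h_gt0 : (0 < h)%N by rewrite /h; move: M64; clear; lia.
have hM : (h <= N)%N by rewrite /h /N; move: M64; clear; lia.
have h2k : (h.*2 <= M.+2)%N by rewrite /h; clear; lia.
have sh : Num.sqrt k / 2 <= Num.sqrt h%:R.
  have e4 : (2 : R) ^+ 2 = 4 by ring.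
  have sk2' : 0 <= Num.sqrt k / 2 by rewrite divr_ge0 // ltW.
  rewrite -(@ler_pXn2r _ 2) ?nnegrE ?sqrtr_ge0 //.
  by rewrite expr_div_n sk2 e4 sqr_sqrtr.
have sh0 : 0 < Num.sqrt h%:R :> R by rewrite sqrtr_gt0 ltr0n.
have shi : 6 / Num.sqrt h%:R <= 12 * g.
  rewrite ler_pdivrMr // gE; move: sh; rewrite -ler_pdivlMr ?invr_gt0 // => sh.
  have : 1 <= 2 * ((Num.sqrt k)^-1 * Num.sqrt h%:R).
    rewrite -ler_pdivrMl // mulr1 ler_pdivlMl // mulrC.
    by move: sh; rewrite invrK; lra.
  lra.
set B := x + 2 * x ^+ 2.
have fsb (i : 'I_M) : cond_survival p N i.+1 <= B + 12 * g + 6 * (Num.sqrt i.+1%:R)^-1.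
  have v0 : 0 <= 6 * (Num.sqrt i.+1%:R)^-1 :> R by rewrite mulr_ge0 // invr_ge0 sqrtr_ge0.
  have [ih|hi] := leqP i.+1 h.
    have : (i.+1.*2 <= M.+2)%N by apply: leq_trans h2k; rewrite leq_double.
    move=> /(cond_survival_le p01 xE x8 (leq_trans (isT : (32 <= 64)%N) M64) (ltn0Sn i)).
    rewrite -/B; lra.
  apply: (@le_trans _ _ (cond_survival p N h)).
    by apply: cond_survival_antitone => //; rewrite (ltnW hi) /N ltnW // ltnS.
  have := cond_survival_le p01 xE x8 (leq_trans (isT : (32 <= 64)%N) M64) h_gt0 h2k.
  rewrite -/B; lra.
(* In the 25, the constant excess [12 g] accounts for 12, the sum of [6 / sqrt i] for 12 more, and
   time 0 for the rest, as [g k = sqrt k >= 8]. *)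
have S_ub : \sum_(i < N) cond_survival p N i <= k * B + 25 * (g * k).
  rewrite big_ord_recl /=.
  have f0 : cond_survival p N 0 <= 1 by apply: cond_survival_le1.
  have : \sum_(i < M) cond_survival p N (lift ord0 i) <= \sum_(i < M) (B + 12 * g + 6 * (Num.sqrt i.+1%:R)^-1).
    by apply: ler_sum => i _; exact: fsb.
  rewrite big_split /= sumr_const card_ord -mulr_sumr -[_ *+ M]mulr_natr.
  have := sum_inv_sqrt_le R M.
  have sM : Num.sqrt M%:R <= g * k :> R by rewrite -gsk kE; apply: ler_wsqrtr; rewrite ler_nat; clear; lia.
  have B0 : 0 <= B + 12 * g by rewrite /B; have := sqr_ge0 x; lra.
  have Mk : M%:R <= k - 1 by rewrite kE [M.+2%:R]mulrSr [M.+1%:R]mulrSr; lra.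
  have := ler_wpM2l B0 Mk.
  have g8 : 8 <= g * k by rewrite -gsk -(@ler_pXn2r _ 2) ?nnegrE ?(ltW sk0) // sk2; lra.
  have B0' : 0 <= B by rewrite /B; have := sqr_ge0 x; lra.
  move: (Num.sqrt M%:R) sM => sM sMk; set S1 := \sum_(i < M) _; set S2 := \sum_(i < M) _.
  lra.
have Dq : box_mass p N N / hit_prob p N <= 2 * g ^+ 2.
  have q0 := @hit_prob_gt0 _ p N p01.
  rewrite ler_pdivrMr //.
  have : box_mass p N N <= p.
    rewrite box_massE /N // subSnn expr1 (_ : 1 - (1 - p) = p); last by ring.
    by rewrite ler_piMl ?(ltW p0) // exprn_ile1 // ltW.
  have : x / 2 <= hit_prob p N.
    have := bernoulli2 hp M.+2; rewrite /hit_prob -/N -kE -/N => hh.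
    have : k * (k - 1) / 2 * p ^+ 2 <= x ^+ 2 / 2.
      by rewrite xE -kE; have := sqr_ge0 p; nra.
    rewrite xE -kE in x8' x0' *; nra.
  have g20 : 0 <= 2 * g ^+ 2 by rewrite mulr_ge0 // sqr_ge0.
  move=> /(ler_wpM2l g20).
  have -> : 2 * g ^+ 2 * (x / 2) = p.
    by rewrite xE -kE; transitivity (g ^+ 2 * k * p); [field|rewrite gk mul1r].
  lra.
have T_ub : \sum_(i < N) cond_survival p N i * W i <= p / 2 * (1 + 2 * x) * (k * B + 25 * (g * k)).
  apply: (@le_trans _ _ (\sum_(i < N) cond_survival p N i * (p / 2 * (1 + 2 * x)))).
    apply: ler_sum => i _; have iM : (i <= M)%N by rewrite -ltnS.
    rewrite ler_wpM2l //; first by apply: cond_survival_ge0 => //; rewrite ltnW.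
    by case/andP: (W_bounds iM).
  by rewrite -mulr_suml mulrC ler_wpM2l // mulr_ge0; lra.
rewrite tree_probE; apply: (le_trans (lerD Dq T_ub)).
have -> : p / 2 * (1 + 2 * x) * (k * B + 25 * (g * k)) = (1 + 2 * x) / 2 * x * (B + 25 * g).
  by rewrite xE -kE; field.
rewrite -kE in hb; exact: tree_prob_ub_core b2 g0 gk hb.
Qed.

(** * Lower bound by three stages: up to [K1 = k c], then to [K2 = k / 2], then to [m2 = k (1 - c)],
    up to rounding *)

Section Cut.
Variables (c : R) (K1 : nat).
Hypothesis c0 : 0 < c.
Hypothesis c400 : c <= (20 ^+ 2)^-1.
Hypothesis hc : 1 <= M.+2%:R * c ^+ 3 * x ^+ 2.
Hypothesis K1a : K1%:R <= M.+2%:R * c.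
Hypothesis K1b : M.+2%:R * c <= 2 * K1%:R.
Hypothesis K1c : M.+2%:R * c <= K1%:R + 1.
Let K2 := M.+2./2.
Let m2 := (N - K1)%N.

Let k64 : 64 <= M.+2%:R :> R. Proof. by rewrite ler_nat. Qed.
Let k0 : 0 < M.+2%:R :> R. Proof. by rewrite ltr0n. Qed.
Let x20 : 0 < x ^+ 2. Proof. by rewrite exprn_gt0. Qed.
Let K1R : 0 < K1%:R :> R.
Proof.
have h : 0 < M.+2%:R * c by rewrite mulr_gt0.
have := K1b; move: h; set y := M.+2%:R * c; lra.
Qed.
Let K2a : M.+2%:R / 3 <= K2%:R :> R.
Proof. by rewrite ler_pdivrMr // -natrM ler_nat /K2; move: M64; clear; lia. Qed.
Let K2b : K2%:R <= M.+2%:R / 2 :> R.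
Proof. by rewrite ler_pdivlMr // -natrM ler_nat /K2; clear; lia. Qed.
Let K1K2 : (K1 < K2)%N.
Proof.
rewrite -(ltr_nat R).
have h1 := K1a; have h2 := K2a; have h3 := k0.
have : M.+2%:R * c <= M.+2%:R * (20 ^+ 2)^-1 by rewrite ler_wpM2l.
move: h1 h2 h3; set y := M.+2%:R; set z := K1%:R; set w := K2%:R; lra.
Qed.
Let K2M : (K2.*2 <= M.+2)%N. Proof. by rewrite /K2; clear; lia. Qed.
Let K2N : (K2 <= N)%N. Proof. by rewrite /K2 /N; clear; lia. Qed.
Let K1N : (K1 <= N)%N. Proof. by apply: leq_trans K2N; exact: ltnW. Qed.
Let m2E : m2%:R = M.+2%:R - 1 - K1%:R :> R.
Proof. by rewrite natrB // /N [M.+2%:R]mulrSr; ring. Qed.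
Let K2m2 : (K2 <= m2)%N.
Proof. by rewrite /m2; move: K1K2 K2M; rewrite /N; clear; lia. Qed.

Let fs1 : x * (1 - c) ^+ 2 * (1 - 4 * x) <= cond_survival p N K1.
Proof.
apply: le_trans (cond_survival_ge_init p01 xE x8 K1N).
have x8' := x8; have x0' := x0.
rewrite ler_wpM2r //; first by lra.
rewrite ler_wpM2l ?(ltW x0') //.
have : K1%:R / M.+2%:R <= c by rewrite ler_pdivrMr // mulrC.
have := c0; have := c400; move: (K1%:R / M.+2%:R) => y; nra.
Qed.

(** The stage error [32 / (K1 d ^ 2 x ^ 2)], with [d >= 1 / 2] and [K1 >= k c / 2], is at most
    [2 ^ 8 / (k c x ^ 2) <= 2 ^ 8 c ^ 2]. *)
Let fs2 : cond_survival p N K1 * (1 - 2 ^+ 8 * c) <= cond_survival p N K2.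
Proof.
have K12 : (K1 <= K2 <= N)%N by rewrite (ltnW K1K2).
have K1_gt0 : (0 < K1)%N by rewrite -(ltr0n R).
have K1M : (K1.*2 <= M.+2)%N by move: K1K2 K2M; clear; lia.
apply: le_trans (cond_survival_ge_stage p01 xE x8 K1_gt0 K12 K1M).
rewrite ler_wpM2l ?cond_survival_ge0 // lerB //.
have d2 : 2^-1 <= 1 - K2%:R / M.+2%:R :> R.
  have : K2%:R / M.+2%:R <= 2^-1 :> R by rewrite ler_pdivrMr // mulrC.
  move: (K2%:R / _) => y; lra.
move: d2; set d := 1 - _ => d2.
have d4 : 4^-1 <= d ^+ 2 by nra.
have Dd : 0 < K1%:R * d ^+ 2 * x ^+ 2 by rewrite mulr_gt0 // mulr_gt0 //; lra.
rewrite ler_pdivrMr //.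
have h1 := K1b; have h2 := hc; have h3 := x20; have h4 := c0; have h5 := K1R; have h6 := c400.
clearbody d.
have h7 : M.+2%:R * c * x ^+ 2 <= 8 * (K1%:R * d ^+ 2 * x ^+ 2).
  apply: (@le_trans _ _ (2 * K1%:R * x ^+ 2)); first by rewrite ler_wpM2r // ltW.
  have : K1%:R * x ^+ 2 * 4^-1 <= K1%:R * x ^+ 2 * d ^+ 2.
    by rewrite ler_wpM2l // mulr_ge0 // ltW.
  lra.
have h8 : 1 <= 8 * (K1%:R * d ^+ 2 * x ^+ 2) * c.
  have c2 : 0 <= c ^+ 2 by apply: sqr_ge0.
  have := ler_wpM2r c2 h7; rewrite (_ : M.+2%:R * c * x ^+ 2 * c ^+ 2 = M.+2%:R * c ^+ 3 * x ^+ 2); last by ring.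
  move=> h9; have h10 := le_trans h2 h9.
  apply: (le_trans h10); rewrite ler_wpM2l //; first by rewrite mulr_ge0 // ltW.
  by rewrite expr2 ler_piMr ?(ltW h4) //; lra.
move: h8; set y := K1%:R * d ^+ 2 * x ^+ 2; lra.
Qed.

(** Now [d >= c] and [K2 >= k / 3], so the error is at most [96 / (k c ^ 2 x ^ 2) <= 96 c]; this
    fixes the exponent 3 in [hc]. Going from [K1] to [m2] at once would only give an error of order
    [1 / (k c ^ 3 x ^ 2)], which need not be small: hence the stop at [K2]. *)
Let fs3 : cond_survival p N K2 * (1 - 10 ^+ 2 * c) <= cond_survival p N m2.
Proof.
have K22 : (K2 <= m2 <= N)%N by rewrite K2m2 leq_subr.
have K2_gt0 : (0 < K2)%N by rewrite /K2; move: M64; clear; lia.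
apply: le_trans (cond_survival_ge_stage p01 xE x8 K2_gt0 K22 K2M).
rewrite ler_wpM2l ?cond_survival_ge0 // lerB //.
have dc : c <= 1 - m2%:R / M.+2%:R.
  have : m2%:R / M.+2%:R <= 1 - c.
    rewrite ler_pdivrMr // m2E mulrBl mul1r mulrC.
    have := K1c; set y := M.+2%:R * c; lra.
  move: (m2%:R / _) => y; lra.
move: dc; set d := 1 - _ => dc.
have h2 := hc; have h3 := x20; have h4 := c0; have h5 := K2a; have h6 := k0.
have d4 : c ^+ 2 <= d ^+ 2 by rewrite lerXn2r ?nnegrE //; lra.
have c20 : 0 < c ^+ 2 by rewrite exprn_gt0.
have K2R : 0 < K2%:R :> R by rewrite ltr0n.
have Dd : 0 < K2%:R * d ^+ 2 * x ^+ 2 by rewrite mulr_gt0 // mulr_gt0 //; lra.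
rewrite ler_pdivrMr //.
have h1 : M.+2%:R / 3 * c ^+ 2 * x ^+ 2 <= K2%:R * d ^+ 2 * x ^+ 2.
  by rewrite ler_wpM2r ?(ltW h3) // ler_pM ?sqr_ge0 // ?divr_ge0.
have := ler_wpM2l (ltW h4) h1.
rewrite (_ : c * (M.+2%:R / 3 * c ^+ 2 * x ^+ 2) = M.+2%:R * c ^+ 3 * x ^+ 2 / 3); last by field.
move: h2; set y := M.+2%:R * c ^+ 3 * x ^+ 2; set z := K2%:R * d ^+ 2 * x ^+ 2; lra.
Qed.

Lemma cond_survival_ge_cut : x * (1 - 4 * x - 20 ^+ 2 * c) <= cond_survival p N (N - K1).
Proof.
have x8' := x8; have x0' := x0.
have [neg|pos] := leP (1 - 4 * x - 20 ^+ 2 * c) 0.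
  by apply: le_trans (cond_survival_ge0 p01 (leq_subr _ _)); rewrite mulr_ge0_le0 // ltW.
have h4 := c0; have h6 := c400.
have c96 : 0 <= 1 - 10 ^+ 2 * c by lra.
have c256 : 0 <= 1 - 2 ^+ 8 * c by lra.
apply: le_trans fs3.
apply: (@le_trans _ _ (cond_survival p N K1 * (1 - 2 ^+ 8 * c) * (1 - 10 ^+ 2 * c))); last first.
  by rewrite ler_wpM2r // fs2.
apply: (@le_trans _ _ (x * (1 - c) ^+ 2 * (1 - 4 * x) * (1 - 2 ^+ 8 * c) * (1 - 10 ^+ 2 * c))); last first.
  by rewrite !ler_wpM2r // fs1.
rewrite (_ : x * (1 - c) ^+ 2 * (1 - 4 * x) * (1 - 2 ^+ 8 * c) * (1 - 10 ^+ 2 * c) =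
  x * ((1 - c) ^+ 2 * ((1 - 4 * x) * ((1 - 2 ^+ 8 * c) * (1 - 10 ^+ 2 * c))))); last by ring.
rewrite ler_wpM2l ?(ltW x0') //.
have e1 : 1 - 2 * c <= (1 - c) ^+ 2 by have := sqr_ge0 c; lra.
have e2 : 1 - 19 ^+ 2 * c <= (1 - 2 ^+ 8 * c) * (1 - 10 ^+ 2 * c) by have := sqr_ge0 c; lra.
have xc : 0 <= x * c by rewrite mulr_ge0 // ltW.
have e3 : 1 - 4 * x - 19 ^+ 2 * c <= (1 - 4 * x) * ((1 - 2 ^+ 8 * c) * (1 - 10 ^+ 2 * c)).
  apply: (@le_trans _ _ ((1 - 4 * x) * (1 - 19 ^+ 2 * c))); last by rewrite ler_wpM2l //; lra.
  lra.
apply: (@le_trans _ _ ((1 - 2 * c) * (1 - 4 * x - 19 ^+ 2 * c))).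
  have := sqr_ge0 c; lra.
apply: ler_pM; [lra | lra | exact: e1 | exact: e3].
Qed.

Let hp2 : 0 <= p / 2 * (1 - 2 * x).
Proof. by rewrite mulr_ge0 ?divr_ge0 ?(ltW p0) //; have := x8; move: (x) => y; lra. Qed.

(** Only the first [m2] times are kept, each with the survival probability at [m2]; they number at
    least [k (1 - 2 c)]. *)
Lemma tree_prob_lb_cut : x ^+ 2 / 2 * (1 - 6 * x - 21 ^+ 2 * c) <= tree_prob p M.+1.
Proof.
have x8' := x8; have x0' := x0; have h4 := c0; have h6 := c400.
have [neg|pos] := leP (1 - 4 * x - 20 ^+ 2 * c) 0.
  have neg' : 1 - 6 * x - 21 ^+ 2 * c <= 0 by lra.
  have x2 : 0 <= x ^+ 2 / 2 by rewrite divr_ge0 // sqr_ge0.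
  exact: le_trans (mulr_ge0_le0 x2 neg') tree_prob_ge0.
rewrite tree_probE.
have D0 : 0 <= box_mass p N N / hit_prob p N.
  by rewrite divr_ge0 // ltW // ?hit_prob_gt0 // box_mass_gt0.
apply: (@le_trans _ _ (\sum_(i < N) cond_survival p N i * W i)); last by rewrite lerDr.
have W0 i : (i <= M)%N -> 0 <= W i.
  by move=> /W_bounds /andP[h _]; apply: le_trans h.
have m2N : (m2 <= N)%N by rewrite leq_subr.
apply: (@le_trans _ _ (\sum_(i < m2) cond_survival p N m2 * (p / 2 * (1 - 2 * x)))); last first.
  rewrite (big_ord_widen N (fun i => cond_survival p N m2 * (p / 2 * (1 - 2 * x)))) //.
  rewrite big_mkcond /=; apply: ler_sum => i _.
  have iM : (i <= M)%N by rewrite -ltnS.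
  case: ifP => im; last by rewrite mulr_ge0 ?W0 // cond_survival_ge0 // ltnW.
  rewrite ler_pM ?cond_survival_ge0 //.
  - by apply: cond_survival_antitone; rewrite // (ltnW im).
  - by case/andP: (W_bounds iM).
rewrite sumr_const card_ord -[_ *+ m2]mulr_natr.
have m2b : M.+2%:R * (1 - 2 * c) <= m2%:R.
  rewrite m2E mulrBr mulr1.
  have h1 := K1a; have h2 := K1b; have h3 := K1R.
  have h5 : 1 <= K1%:R :> R by rewrite ler1n -(ltr0n R).
  move: h1 h2; rewrite (mulrCA _ 2); set y := M.+2%:R * c; set z := K1%:R in h3 h5 *; lra.
apply: (@le_trans _ _ (x * (1 - 4 * x - 20 ^+ 2 * c) * (p / 2 * (1 - 2 * x)) * (M.+2%:R * (1 - 2 * c)))); last first.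
  have g1 : 0 <= x * (1 - 4 * x - 20 ^+ 2 * c) by apply: mulr_ge0; exact: ltW.
  have g2 : 0 <= 1 - 2 * c by lra.
  apply: ler_pM; [exact: mulr_ge0 | exact: mulr_ge0 | | exact: m2b].
  by apply: ler_wpM2r; [exact: hp2 | exact: cond_survival_ge_cut].
have -> : x * (1 - 4 * x - 20 ^+ 2 * c) * (p / 2 * (1 - 2 * x)) * (M.+2%:R * (1 - 2 * c)) =
  x ^+ 2 / 2 * ((1 - 4 * x - 20 ^+ 2 * c) * (1 - 2 * x) * (1 - 2 * c)).
  transitivity (x * (1 - 4 * x - 20 ^+ 2 * c) * (1 - 2 * x) * (1 - 2 * c) / 2 * (M.+2%:R * p)).
    by move: (M.+2%:R : R) => K; field.
  by rewrite -xE; field.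
apply: ler_wpM2l; first by rewrite divr_ge0 // sqr_ge0.
have xc : 0 <= x * c by rewrite mulr_ge0 // ltW.
apply: (@le_trans _ _ ((1 - 6 * x - 20 ^+ 2 * c) * (1 - 2 * c))).
  have := sqr_ge0 c; lra.
rewrite ler_wpM2r //; first by lra.
have := sqr_ge0 x; lra.
Qed.

End Cut.

Lemma tree_prob_lb b : 0 < b -> b ^+ 3 <= M.+2%:R * x ^+ 2 ->
  x ^+ 2 / 2 - 20 ^+ 2 * x ^+ 2 * (x + b^-1) <= tree_prob p M.+1.
Proof.
move=> b_gt0 hb; have x8' := x8; have x0' := x0.
have [c cE] : exists c, c = b^-1 by exists b^-1.
have c0 : 0 < c by rewrite cE invr_gt0.
have bc : b * c = 1 by rewrite cE divff // gt_eqF.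
have hx2 : 0 < x ^+ 2 by rewrite exprn_gt0.
have hx3 : 0 < x ^+ 2 * x by rewrite mulr_gt0.
have hxc : 0 < x ^+ 2 * c by rewrite mulr_gt0.
rewrite -cE.
(* For such [c] the claimed lower bound is negative. *)
have [c400|c400] := leP (20 ^+ 2)^-1 c.
  apply: le_trans tree_prob_ge0.
  have : x ^+ 2 * (20 ^+ 2)^-1 <= x ^+ 2 * c by rewrite ler_wpM2l ?(ltW hx2).
  lra.
have hc : 1 <= M.+2%:R * c ^+ 3 * x ^+ 2.
  have c3 : 0 <= c ^+ 3 by rewrite exprn_ge0 // ltW.
  have := ler_wpM2r c3 hb; rewrite -exprMn bc expr1n; congr (_ <= _); ring.
have k0 : 0 <= M.+2%:R :> R by [].
have kc1 : 1 <= M.+2%:R * c.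
  apply: (le_trans hc); rewrite -mulrA ler_wpM2l // exprS -mulrA ler_piMr ?(ltW c0) //.
  have : c ^+ 2 <= 1 by rewrite exprn_ile1 ?(ltW c0) //; lra.
  have : x ^+ 2 <= 1 by rewrite exprn_ile1 ?(ltW x0') //; lra.
  have : 0 <= c ^+ 2 by apply: sqr_ge0.
  move: (c ^+ 2) (x ^+ 2) => y z; nra.
have kc0 : 0 <= M.+2%:R * c by lra.
have /andP[K1a K1b] := truncn_itv kc0.
set K1 := Num.truncn _ in K1a K1b; rewrite [K1.+1%:R]mulrSr in K1b.
have K1_gt0 : 1 <= K1%:R :> R.
  rewrite ler1n lt0n; apply/negP => /eqP e; move: K1b; rewrite e; set y := M.+2%:R * c in kc1 *; lra.
have K1c : M.+2%:R * c <= 2 * K1%:R by lra.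
apply: le_trans (tree_prob_lb_cut c0 (ltW c400) hc K1a K1c (ltW K1b)).
lra.
Qed.

End TreeEstimate.

(** * Mean number of components of a given size *)

Section LnBounds.
Variable R : realType.
Implicit Types x : R.

Lemma ln_cubic_le x : -1 < x -> ln (1 + x) <= x - x ^+ 2 / 2 + x ^+ 3 / 3.
Proof.
move=> x1; rewrite -[leRHS]expRK ler_ln ?posrE ?expR_gt0 //; last by lra.
by apply: expR_cubic_ge; exact: ltW.
Qed.

Lemma ln_cubic_ge x : - 2^-1 <= x -> x - x ^+ 2 / 2 - `|x| ^+ 3 <= ln (1 + x).
Proof.
move=> x1; rewrite -[leLHS]expRK ler_ln ?posrE ?expR_gt0 //; last by lra.
exact: expR_cubic_le.
Qed.

End LnBounds.

(** * Wallis integrals and the central binomial coefficient *)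

Section Wallis.
Variable R : realType.

(* [wallis_prim n] is the primitive of [sin ^ n] vanishing at 0. *)
Fixpoint wallis_pair (n : nat) : (R -> R) * (R -> R) :=
  if n is m.+1 then
    let: (f, g) := wallis_pair m in
    (g, fun x => (m.+1%:R * f x - sin x ^+ m.+1 * cos x) / m.+2%:R)
  else (id, fun x => 1 - cos x).
Definition wallis_prim n : R -> R := (wallis_pair n).1.

Let prim0 : wallis_prim 0 = id. Proof. by []. Qed.
Let prim1 : wallis_prim 1 = fun x => 1 - cos x. Proof. by []. Qed.
Let primSS n : wallis_prim n.+2 =
  fun x => (n.+1%:R * wallis_prim n x - sin x ^+ n.+1 * cos x) / n.+2%:R.
Proof. by rewrite /wallis_prim /=; case: (wallis_pair n). Qed.

Lemma is_derive_wallis n (x : R) : is_derive x 1 (wallis_prim n) (sin x ^+ n).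
Proof.
suff : is_derive x 1 (wallis_prim n) (sin x ^+ n) /\
       is_derive x 1 (wallis_prim n.+1) (sin x ^+ n.+1) by case.
elim: n => [|n [IH0 IH1]]; split=> //.
- by rewrite prim0 expr0; exact: is_derive_id.
- by rewrite prim1; apply: is_derive_eq; rewrite /GRing.scale /=; ring.
rewrite primSS.
have c2 : cos x ^+ 2 = 1 - sin x ^+ 2 by have := cos2Dsin2 x; lra.
have n2 : n.+2%:R != 0 :> R by rewrite pnatr_eq0.
have -> : (fun y => (n.+1%:R * wallis_prim n y - sin y ^+ n.+1 * cos y) / n.+2%:R) =
  (n.+2%:R^-1 : R) *: ((n.+1%:R : R) *: wallis_prim n - (sin : R -> R) ^+ n.+1 * cos).
  by apply/funext => y; rewrite !fctE /GRing.scale /=; field.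
have h1 := is_deriveX n.+1 (is_derive_sin x).
have h2 := is_deriveM h1 (is_derive_cos x).
have h3 := is_deriveB (is_deriveZ n.+1%:R IH0) h2.
apply: is_derive_eq (is_deriveZ n.+2%:R^-1 h3) _.
rewrite !fctE /GRing.scale /= !exprS; move: c2 n2; rewrite expr2 [n.+2%:R]mulrSr.
set s := sin x; set c := cos x; set S := s ^+ n; set m : R := n.+1%:R => c2 n2.
transitivity ((m + s * s - m * (c * c)) * S / (m + 1)); first by field.
by rewrite c2; field.
Qed.

Lemma wallis_prim_at0 n : wallis_prim n 0 = 0.
Proof.
suff : wallis_prim n 0 = 0 /\ wallis_prim n.+1 0 = 0 by case.
elim: n => [|n [IH0 IH1]]; split=> //.
- by rewrite prim1 cos0 subrr.
- by rewrite primSS IH0 sin0 exprS mul0r mulr0 mul0r subrr mul0r.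
Qed.

Let W n := wallis_prim n (pi / 2).

Let W0 : W 0 = pi / 2. Proof. by []. Qed.
Let W1 : W 1 = 1. Proof. by rewrite /W prim1 cos_pihalf subr0. Qed.
Let WSS n : W n.+2 = n.+1%:R / n.+2%:R * W n.
Proof. by rewrite /W primSS cos_pihalf mulr0 subr0 mulrAC. Qed.

Let W_nincr n : W n.+1 <= W n.
Proof.
have pi0 : 0 <= (pi : R) / 2 by rewrite divr_ge0 // pi_ge0.
rewrite -subr_ge0.
have -> : (0 : R) = wallis_prim n 0 - wallis_prim n.+1 0.
  by rewrite !wallis_prim_at0 subrr.
apply: (@is_derive_nondecreasing _ (wallis_prim n \- wallis_prim n.+1)
   (fun x => sin x ^+ n - sin x ^+ n.+1) 0 (pi / 2) pi0) => x /andP[x0 x1].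
  by apply: is_deriveB; exact: is_derive_wallis.
have s0 : 0 <= sin x by apply: sin_ge0_pi; rewrite x0 /=; have := pi_ge0 R; lra.
by rewrite subr_ge0 exprS ler_piMl ?exprn_ge0 // sin_le1.
Qed.

Definition central_ratio n : R := (n.*2)`!%:R / (4 ^+ n * n`!%:R ^+ 2).
Let cb := central_ratio.

Let cbS n : cb n.+1 = (n.*2).+1%:R / (n.*2).+2%:R * cb n.
Proof.
rewrite /cb /central_ratio doubleS !factS !natrM exprS.
have n0 : n.+1%:R != 0 :> R by rewrite pnatr_eq0.
have f0 : n`!%:R != 0 :> R by rewrite pnatr_eq0 -lt0n fact_gt0.
have p0 : 4 ^+ n != 0 :> R by rewrite expf_neq0 // pnatr_eq0.
have -> : (n.*2).+2%:R = 2 * n.+1%:R :> R by rewrite -natrM mul2n doubleS.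
move: n0 f0 p0; move: (n.+1%:R : R) (n`!%:R : R) (4 ^+ n : R) ((n.*2).+1%:R : R) => a b c d n0 f0 p0.
by field; rewrite n0 f0 p0.
Qed.

Let cb_gt0 n : 0 < cb n.
Proof.
by rewrite divr_gt0 ?ltr0n ?fact_gt0 // mulr_gt0 ?exprn_gt0 ?ltr0n ?fact_gt0.
Qed.

Let cb0 : cb 0 = 1.
Proof. by rewrite /cb /central_ratio fact0 expr0 expr1n mul1r divr1. Qed.

Let W_even n : W n.*2 = pi / 2 * cb n.
Proof.
elim: n => [|n IH]; first by rewrite W0 cb0 mulr1.
by rewrite doubleS WSS IH cbS mulrCA.
Qed.

Let W_odd n : W (n.*2).+1 = ((n.*2).+1%:R * cb n)^-1.
Proof.
elim: n => [|n IH]; first by rewrite W1 cb0 mulr1 invr1.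
rewrite doubleS WSS IH cbS.
have c0 : cb n != 0 by rewrite gt_eqF.
have n1 : (n.*2).+1%:R != 0 :> R by rewrite pnatr_eq0.
have n2 : (n.*2).+2%:R != 0 :> R by rewrite pnatr_eq0.
have n3 : (n.*2).+3%:R != 0 :> R by rewrite pnatr_eq0.
move: n1 n2 n3 c0; move: ((n.*2).+1%:R : R) ((n.*2).+2%:R : R) ((n.*2).+3%:R : R) (cb n).
by move=> a b c d n1 n2 n3 c0; field; rewrite n1 n2 n3 c0.
Qed.

(** Compares the Wallis integrals of index [2 n] and [2 n + 1]; the upper bound compares those of
    index [2 n - 1] and [2 n]. *)
Lemma central_ratio_ge n : 2 / (pi * (n.*2).+1%:R) <= central_ratio n ^+ 2.
Proof.
have := W_nincr n.*2; rewrite W_even W_odd -/(cb n).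
have c0 := cb_gt0 n; have n1 : 0 < (n.*2).+1%:R :> R by rewrite ltr0n.
have pi0 := pi_gt0 R.
move: n1; set a : R := (n.*2).+1%:R; set c := cb n in c0 * => n1 h.
have ac : 0 < a * c by rewrite mulr_gt0.
rewrite ler_pdivrMr ?mulr_gt0 //.
have : (a * c)^-1 * (a * c) <= pi / 2 * c * (a * c) by rewrite ler_wpM2r // ltW.
by rewrite mulVf ?gt_eqF //; lra.
Qed.

Lemma central_ratio_le n : (0 < n)%N -> central_ratio n ^+ 2 <= (pi * n%:R)^-1.
Proof.
case: n => [//|n] _.
have := W_nincr (n.*2).+1; rewrite W_odd -doubleS W_even cbS -/(cb n.+1) cbS.
have c0 := cb_gt0 n; have n1 : 0 < (n.*2).+1%:R :> R by rewrite ltr0n.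
have n2 : 0 < n.+1%:R :> R by rewrite ltr0n.
have pi0 := pi_gt0 R.
rewrite (_ : (n.*2).+2%:R = 2 * n.+1%:R :> R); last by rewrite -natrM mul2n doubleS.
move: n1 n2; move: ((n.*2).+1%:R : R) (n.+1%:R : R) => a b n1 n2; set c := cb n in c0 *.
rewrite -[leRHS]mul1r => h.
have cc : 0 < a * c by rewrite mulr_gt0.
rewrite -[leRHS]mul1r ler_pdivlMr ?mulr_gt0 //.
move: h; rewrite ler_pdivlMr // => h.
have -> : (a / (2 * b) * c) ^+ 2 * (pi * b) = pi / 2 * (a / (2 * b) * c) * (a * c).
  by field; rewrite gt_eqF.
exact: h.
Qed.

End Wallis.

(** * Stirling's formula with an explicit error *)

Section Stirling.
Variable R : realType.

Definition stirling_log n : R := ln n`!%:R + n%:R - (n%:R + 2^-1) * ln n%:R.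
Let L := stirling_log.

Let L_step n : (0 < n)%N -> `|L n - L n.+1| <= 4 * (n%:R^-1 - n.+1%:R^-1).
Proof.
move=> n0; have n0' : 0 < n%:R :> R by rewrite ltr0n.
have n1' : 1 <= n%:R :> R by rewrite ler1n.
have f0 : 0 < n`!%:R :> R by rewrite ltr0n fact_gt0.
have [y yE] : exists y : R, y = n%:R^-1 by exists n%:R^-1.
have y0 : 0 < y by rewrite yE invr_gt0.
have y1 : y <= 1 by rewrite yE invf_le1.
have ny : n%:R * y = 1 by rewrite yE divff // gt_eqF.
have eS : n.+1%:R = n%:R * (1 + y) :> R by rewrite mulrDr mulr1 ny [LHS]mulrSr.
have e : L n - L n.+1 = (n%:R + 2^-1) * ln (1 + y) - 1.
  rewrite /L /stirling_log factS natrM lnM ?posrE ?ltr0n //; last exact: fact_gt0.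
  rewrite eS lnM ?posrE //; last by lra.
  by rewrite mulrDr ny; ring.
have u := @ln_cubic_le R y; have l := @ln_cubic_ge R y.
have {}u : ln (1 + y) <= y - y ^+ 2 / 2 + y ^+ 3 / 3 by apply: u; lra.
have {}l : y - y ^+ 2 / 2 - y ^+ 3 <= ln (1 + y) by move: l; rewrite ger0_norm ?(ltW y0) //; apply; lra.
have d : y ^+ 2 / 2 <= y - n.+1%:R^-1.
  have y1' : 0 < 1 + y by lra.
  rewrite eS invfM -yE.
  have -> : y - y / (1 + y) = y ^+ 2 / (1 + y) by field; rewrite gt_eqF.
  by rewrite ler_wpM2l ?sqr_ge0 // lef_pV2 ?posrE //; lra.
rewrite -yE e.
have k0 : 0 <= n%:R + 2^-1 :> R by lra.
have u1 := ler_wpM2l k0 u; have l1 := ler_wpM2l k0 l.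
have e1 : (n%:R + 2^-1) * (y - y ^+ 2 / 2 + y ^+ 3 / 3) = 1 + y ^+ 2 / 12 + y ^+ 3 / 6.
  transitivity (n%:R * y * (1 - y / 2 + y ^+ 2 / 3) + 2^-1 * (y - y ^+ 2 / 2 + y ^+ 3 / 3)); first by field.
  by rewrite ny; field.
have e2 : (n%:R + 2^-1) * (y - y ^+ 2 / 2 - y ^+ 3) = 1 - 5 / 4 * y ^+ 2 - y ^+ 3 / 2.
  transitivity (n%:R * y * (1 - y / 2 - y ^+ 2) + 2^-1 * (y - y ^+ 2 / 2 - y ^+ 3)); first by field.
  by rewrite ny; field.
rewrite e1 in u1; rewrite e2 in l1.
have y3 : y ^+ 3 <= y ^+ 2 by rewrite exprS ler_piMl // sqr_ge0.
have y30 : 0 <= y ^+ 3 by rewrite exprn_ge0 // ltW.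
have y20 : 0 <= y ^+ 2 by apply: sqr_ge0.
move: u1 l1 d; move: (n%:R + 2^-1 : R) (ln (1 + y)) (n.+1%:R^-1 : R) => k z w u1 l1 d.
by rewrite ler_norml; apply/andP; split; lra.
Qed.

Let L_double n : (0 < n)%N -> `|L n - L n.*2| <= 2 / n%:R.
Proof.
move=> n0; have n0' : 0 < n%:R :> R by rewrite ltr0n.
have h m : `|L n - L (n + m)%N| <= 4 * (n%:R^-1 - (n + m)%:R^-1).
  elim: m => [|m IH]; first by rewrite addn0 !subrr normr0 mulr0.
  rewrite addnS (_ : L n - L (n + m).+1 = (L n - L (n + m)%N) + (L (n + m)%N - L (n + m).+1)); last by ring.
  apply: (le_trans (ler_normD _ _)).
  apply: (le_trans (lerD IH (L_step (ltn_addr m n0)))).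
  by rewrite -mulrDr addrA subrK.
have := h n; rewrite addnn -{2}muln2 natrM invfM.
by move: (L n) (L n.*2) (n%:R^-1 : R) => a b c; congr (_ <= _); field.
Qed.

(* [2 L(n) - L(2 n)] only involves the central binomial coefficient. *)
Let L_central n : (0 < n)%N ->
  2 * L n - L n.*2 = ln 2 / 2 - ln n%:R / 2 - ln (central_ratio R n).
Proof.
move=> n0; have n0' : 0 < n%:R :> R by rewrite ltr0n.
have f0 : 0 < n`!%:R :> R by rewrite ltr0n fact_gt0.
have f2 : 0 < (n.*2)`!%:R :> R by rewrite ltr0n fact_gt0.
have p4 : 0 < 4 ^+ n :> R by rewrite exprn_gt0.
rewrite /L /stirling_log /central_ratio ln_div ?posrE // ?mulr_gt0 ?exprn_gt0 //.
have l4 : ln (4 : R) = 2 * ln 2.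
  by rewrite (_ : 4 = 2 ^+ 2 :> R) ?lnXn // ?mulr_natl //; ring.
have e1 : ln (4 ^+ n) = n%:R * (2 * ln 2) :> R by rewrite lnXn // mulr_natl l4.
have e2 : ln (n`!%:R ^+ 2) = 2 * ln n`!%:R :> R by rewrite lnXn // mulr_natl.
rewrite lnM ?posrE ?exprn_gt0 // e1 e2.
rewrite (_ : n.*2%:R = 2 * n%:R :> R); last by rewrite -natrM mul2n.
rewrite lnM ?posrE //.
move: (ln (n`!%:R : R)) (ln ((n.*2)`!%:R : R)) (ln (n%:R : R)) (ln (2 : R)) (n%:R : R) => a b c d e.
by field.
Qed.

(** No limit is taken: [L n] equals [2 L n - L (2 n)], which the central binomial coefficient
    determines, minus [L n - L (2 n)], which the telescoping bound [L_step] makes at most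
    [2 / n]. *)
Lemma stirling_log_bound n : (0 < n)%N ->
  `|stirling_log n - ln (2 * pi) / 2| <= 3 / n%:R.
Proof.
move=> n0; have n0' : 0 < n%:R :> R by rewrite ltr0n.
have n1' : 1 <= n%:R :> R by rewrite ler1n.
have pi0 := pi_gt0 R.
have := L_double n0; have := L_central n0.
have c0 : 0 < central_ratio R n.
  by rewrite divr_gt0 ?ltr0n ?fact_gt0 // mulr_gt0 ?exprn_gt0 ?ltr0n ?fact_gt0.
have c2 : ln (central_ratio R n ^+ 2) = 2 * ln (central_ratio R n).
  by rewrite lnXn // mulr_natl.
have hi : ln (central_ratio R n ^+ 2) <= - ln pi - ln n%:R.
  have -> : - ln pi - ln n%:R = ln (pi * n%:R)^-1 :> R.
    by rewrite lnV ?posrE ?mulr_gt0 // lnM ?posrE // opprD.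
  rewrite ler_ln ?posrE ?exprn_gt0 ?invr_gt0 ?mulr_gt0 //.
  exact: central_ratio_le.
have lo : - ln pi - ln n%:R - (2 * n%:R)^-1 <= ln (central_ratio R n ^+ 2).
  apply: (@le_trans _ _ (ln (2 / (pi * (n.*2).+1%:R)))).
    have -> : 2 / (pi * (n.*2).+1%:R) = (pi * (n%:R * (1 + (2 * n%:R)^-1)))^-1 :> R.
      rewrite (_ : (n.*2).+1%:R = 2 * n%:R + 1 :> R); last by rewrite [LHS]mulrSr -mul2n natrM.
      by field; rewrite !gt_eqF //; lra.
    have i0 : 0 < (2 * n%:R)^-1 :> R by rewrite invr_gt0 mulr_gt0.
    have i1 : 0 < 1 + (2 * n%:R)^-1 :> R by lra.
    rewrite lnV ?posrE ?mulr_gt0 // lnM ?posrE ?mulr_gt0 // lnM ?posrE //.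
    have : ln (1 + (2 * n%:R)^-1) <= (2 * n%:R)^-1 :> R by apply: le_ln1Dx; lra.
    lra.
  have h1 : 0 < 2 / (pi * (n.*2).+1%:R) :> R by rewrite divr_gt0 // mulr_gt0 // ltr0n.
  have h2 : 0 < central_ratio R n ^+ 2 by rewrite exprn_gt0.
  by rewrite ler_ln // central_ratio_ge.
rewrite lnM ?posrE // -/(L n).
have i2 : (2 * n%:R)^-1 = 2^-1 * n%:R^-1 :> R by rewrite invfM.
rewrite i2 in lo; rewrite c2 in hi lo.
have j0 : 0 < n%:R^-1 :> R by rewrite invr_gt0.
move: hi lo j0; move: (L n) (L n.*2) (ln (central_ratio R n)) (ln (pi : R)) (ln (n%:R : R)) (ln (2 : R)) (n%:R^-1 : R).
move=> a b c d e f g hi lo g0 h1 /ler_normlP[h2 h3].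
by rewrite ler_norml; apply/andP; split; lra.
Qed.

End Stirling.

(** * The binomial factors and the exponent *)

Section Exponent.
Variable R : realType.

(** Adds up [ln (1 - j / n)] to second order. The sums of [j] and [j ^ 2] are replaced by
    [k ^ 2 / 2] and [k ^ 3 / 3], at a cost covered by [2 / n] per factor. *)
Lemma ln_ffact_bound (n k : nat) : (0 < n)%N -> (k.*2 <= n)%N ->
  let x : R := k%:R / n%:R in
  `|ln ((n ^_ k)%:R : R) - k%:R * ln n%:R + k%:R * (x / 2 + x ^+ 2 / 6)|
    <= k%:R * x ^+ 3 + 2 * x.
Proof.
move=> n0 hk /=; set x : R := k%:R / n%:R; have n0' : 0 < n%:R :> R by rewrite ltr0n.
have [v vE] : exists v : R, v = n%:R^-1 by exists n%:R^-1.
have v0 : 0 < v by rewrite vE invr_gt0.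
have nv : n%:R * v = 1 by rewrite vE divff // gt_eqF.
have v1 : v <= 1 by rewrite vE invf_le1 // ler1n.
have x0 : 0 <= x by rewrite /x divr_ge0.
suff h j : (j <= k)%N -> `|ln ((n ^_ j)%:R : R) - j%:R * ln n%:R +
    (j%:R ^+ 2 * v / 2 + j%:R ^+ 3 * v ^+ 2 / 6)| <= j%:R * (x ^+ 3 + 2 * v).
  have := h k (leqnn k); rewrite /x -vE.
  have -> : k%:R * (k%:R * v / 2 + (k%:R * v) ^+ 2 / 6) = k%:R ^+ 2 * v / 2 + k%:R ^+ 3 * v ^+ 2 / 6 :> R by field.
  by move=> /le_trans; apply; rewrite le_eqVlt; apply/orP; left; apply/eqP; ring.
elim: j => [_|j IH jk].
  by rewrite ffactn0 ln1 !(mul0r, expr0n, subr0, addr0) normr0.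
have {}IH := IH (ltnW jk).
have jn : (j < n)%N by apply: leq_trans jk _; apply: leq_trans hk; rewrite -addnn leq_addr.
have jv : j%:R * v <= 2^-1.
  rewrite vE ler_pdivrMr // mulrC ler_pdivlMr // -natrM ler_nat muln2.
  by apply: leq_trans hk; rewrite leq_double ltnW.
have jv0 : 0 <= j%:R * v by rewrite mulr_ge0 // ltW.
have jx : j%:R * v <= x by rewrite /x -vE ler_wpM2r ?(ltW v0) // ler_nat ltnW.
have ff0 : 0 < (n ^_ j)%:R :> R by rewrite ltr0n ffact_gt0 ltnW.
have e : ln ((n ^_ j.+1)%:R : R) = ln (n ^_ j)%:R + (ln n%:R + ln (1 - j%:R * v)).
  rewrite ffactnSr natrM lnM ?posrE ?ltr0n ?subn_gt0 //; last by rewrite -(ltr0n R).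
  rewrite natrB ?(ltnW jn) // (_ : n%:R - j%:R = n%:R * (1 - j%:R * v)); last first.
    by rewrite mulrBr mulr1 mulrCA nv mulr1.
  by rewrite lnM ?posrE //; lra.
have l1 : ln (1 - j%:R * v) <= - (j%:R * v) - (j%:R * v) ^+ 2 / 2 + (- (j%:R * v)) ^+ 3 / 3.
  have := @ln_cubic_le R (- (j%:R * v)); rewrite sqrrN; apply; lra.
have l2 : - (j%:R * v) - (j%:R * v) ^+ 2 / 2 - (j%:R * v) ^+ 3 <= ln (1 - j%:R * v).
  have := @ln_cubic_ge R (- (j%:R * v)); rewrite sqrrN normrN (ger0_norm jv0); apply; lra.
have c3 : (j%:R * v) ^+ 3 <= x ^+ 3 by rewrite lerXn2r ?nnegrE.
have c30 : 0 <= (j%:R * v) ^+ 3 by rewrite exprn_ge0.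
rewrite e [j.+1%:R]mulrSr.
have hv2 : j%:R * v ^+ 2 <= v / 2.
  by rewrite expr2 mulrA (le_trans (ler_wpM2r (ltW v0) jv)) //; lra.
have hv3 : 0 <= j%:R * v ^+ 2 by rewrite mulr_ge0 // sqr_ge0.
have v2 : v ^+ 2 <= v by rewrite expr2 ler_piMl // ltW.
have v20 : 0 <= v ^+ 2 by apply: sqr_ge0.
move: IH; move: l1 l2 c3 c30 jv jv0; rewrite exprNn.
have -> : (j%:R * v) ^+ 2 = j%:R ^+ 2 * v ^+ 2 :> R by rewrite exprMn.
move: (ln ((n ^_ j)%:R : R)) (ln (n%:R : R)) (ln (1 - j%:R * v)) ((j%:R * v) ^+ 3) (x ^+ 3) => a b c d f.
move: hv2 hv3; move: (j%:R : R) => J hv2 hv3 l1 l2 c3 c30 jv jv0 /ler_normlP[h1 h2].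
rewrite ler_norml; apply/andP; split; lra.
Qed.

Lemma ln1B_cubic (w : R) : 0 <= w <= 2^-1 ->
  - w - w ^+ 2 / 2 - w ^+ 3 <= ln (1 - w) <= - w - w ^+ 2 / 2.
Proof.
move=> /andP[w0 w12]; apply/andP; split.
  have := @ln_cubic_ge R (- w); rewrite sqrrN normrN (ger0_norm w0); apply; lra.
have : 0 <= w ^+ 3 by rewrite exprn_ge0.
have : ln (1 - w) <= - w - w ^+ 2 / 2 + (- w) ^+ 3 / 3.
  by have := @ln_cubic_le R (- w); rewrite sqrrN; apply; lra.
rewrite exprNn; lra.
Qed.

Lemma ln1B_bound (p : R) : 0 <= p <= 2^-1 -> `|ln (1 - p) + p| <= p ^+ 2.
Proof.
move=> hp; have /andP[l2 l1] := ln1B_cubic hp; have /andP[p0 p1] := hp.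
have : p ^+ 3 <= p ^+ 2 / 2 by rewrite exprSr ler_wpM2l ?sqr_ge0.
have := sqr_ge0 p.
by rewrite ler_norml => *; apply/andP; split; lra.
Qed.

(** The expansion is that of [ln ((1 - exp (- y)) / y)]; the term in [p] pays for replacing
    [(1 - p) ^ k] by [exp (- y)]. *)
Lemma ln_hit_bound (p : R) (k : nat) : 0 < p <= 2^-1 -> (0 < k)%N -> k%:R * p <= 8^-1 ->
  let y := k%:R * p in
  `|ln ((1 - (1 - p) ^+ k) / y) + y / 2 - y ^+ 2 / 24| <= 2 * p + 2 * y ^+ 3.
Proof.
move=> /andP[p0 p2] k0 y8 /=; set y := k%:R * p in y8 *; have hp : 0 <= p <= 1 by apply/andP; split; lra.
have k1 : 1 <= k%:R :> R by rewrite ler1n.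
have y0 : 0 < y by rewrite mulr_gt0 // (lt_le_trans ltr01).
have py : p <= y by rewrite ler_peMl // ltW.
have b3 := bernoulli3 hp k; have b4 := bernoulli4 hp k.
pose w := 1 - (1 - (1 - p) ^+ k) / y.
have wE : (1 - (1 - p) ^+ k) / y = 1 - w by rewrite /w; ring.
have wy : w * y = y - (1 - (1 - p) ^+ k) by rewrite /w mulrBl mul1r divfK // gt_eqF.
pose z := (y - p) / 2 - (y - p) * (y - 2 * p) / 6.
have w_lb : z <= w.
  rewrite -(ler_pM2r y0) wy /z /y; move: b4 b3.
  have -> : ((k%:R * p - p) / 2 - (k%:R * p - p) * (k%:R * p - 2 * p) / 6) * (k%:R * p) =
    k%:R * (k%:R - 1) / 2 * p ^+ 2 - k%:R * (k%:R - 1) * (k%:R - 2) / 6 * p ^+ 3 by field.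
  lra.
have w_ub : w <= z + y ^+ 3 / 24.
  rewrite -(ler_pM2r y0) wy.
  have -> : (z + y ^+ 3 / 24) * y =
    k%:R * (k%:R - 1) / 2 * p ^+ 2 - k%:R * (k%:R - 1) * (k%:R - 2) / 6 * p ^+ 3 + y ^+ 4 / 24.
    by rewrite /z /y; field.
  have : k%:R * (k%:R - 1) * (k%:R - 2) * (k%:R - 3) / 24 * p ^+ 4 <= y ^+ 4 / 24.
    rewrite /y exprMn mulrAC ler_wpM2r // ler_wpM2r ?exprn_ge0 ?(ltW p0) //.
    case: k k0 {b3 b4 w wE wy z w_lb y8 y y0 py k1} => [//|[|[|[|k]]]] _; rewrite ?subrr ?(mul0r, mulr0) ?exprn_ge0 //.
    have -> : k.+4%:R = k%:R + 4 :> R by rewrite -natrD addnC.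
    have : 0 <= k%:R :> R by [].
    move: (k%:R : R) => K K0.
    have -> : (K + 4) ^+ 4 = (K + 4) * (K + 4) * (K + 4) * (K + 4) by ring.
    rewrite !ler_pM ?mulr_ge0 //; lra.
  move: b4; rewrite /y; lra.
rewrite wE; clear - p0 py y0 y8 w_lb w_ub; clearbody w y.
have yp : y * p <= p / 8 by rewrite mulrC ler_wpM2l // ltW.
have p22 : p ^+ 2 <= p * y by rewrite expr2 ler_wpM2l // ltW.
have pp0 : 0 <= p ^+ 2 by apply: sqr_ge0.
have z1 : z - (y / 2 - y ^+ 2 / 6) <= p by rewrite /z; lra.
have py0 : 0 <= y * p by rewrite mulr_ge0 // ltW.
have p2y : p ^+ 2 <= y * p by rewrite mulrC.
have z2 : - p <= z - (y / 2 - y ^+ 2 / 6) by rewrite /z; lra.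
have yy3 : 0 < y ^+ 3 by rewrite exprn_gt0.
have y2 : y ^+ 2 <= y / 8 by rewrite expr2 mulrC ler_wpM2l // ltW.
have y3 : y ^+ 3 <= y ^+ 2 / 8 by rewrite exprSr ler_wpM2l // sqr_ge0.
have y20 : 0 < y ^+ 2 by rewrite exprn_gt0.
have z0 : 0 <= z.
  have : 0 <= (y - p) * (3 - (y - 2 * p)) by rewrite mulr_ge0 //; lra.
  rewrite /z; lra.
have w0 : 0 <= w by lra.
have wy1 : w <= 5 / 8 * y.
  have : z <= (y - p) / 2 + p * y by rewrite /z; have := sqr_ge0 (y - p); have := sqr_ge0 p; lra.
  lra.
have w12 : w <= 2^-1 by lra.
have w01 : 0 <= w <= 2^-1 by rewrite w0.
have /andP[l2 l1] := ln1B_cubic w01.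
have w3 : w ^+ 3 <= y ^+ 3 by rewrite lerXn2r ?nnegrE ?(ltW y0) //; lra.
have d1 : w - y / 2 <= p by lra.
have d2 : - (p + y ^+ 2 / 6) <= w - y / 2 by lra.
have s0 : 0 <= w + y / 2 by lra.
have s1 : w + y / 2 <= 9 / 8 * y by lra.
have m1 : w ^+ 2 - y ^+ 2 / 4 <= p * (9 / 8 * y).
  have -> : w ^+ 2 - y ^+ 2 / 4 = (w - y / 2) * (w + y / 2) by field.
  apply: (le_trans (ler_wpM2r s0 d1)); by rewrite ler_wpM2l // ltW.
have m2 : - ((p + y ^+ 2 / 6) * (9 / 8 * y)) <= w ^+ 2 - y ^+ 2 / 4.
  have -> : w ^+ 2 - y ^+ 2 / 4 = (w - y / 2) * (w + y / 2) by field.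
  apply: le_trans (ler_wpM2r s0 d2); rewrite mulNr lerN2 ler_wpM2l //; lra.
have m3 : (p + y ^+ 2 / 6) * (9 / 8 * y) = 9 / 8 * (y * p) + 3 / 16 * y ^+ 3 by field.
rewrite m3 in m2.
rewrite ler_norml; apply/andP; split; lra.
Qed.

Lemma ln1D_bound (th : R) : `|th| <= 8^-1 -> `|ln (1 + th) - th + th ^+ 2 / 2| <= `|th| ^+ 3.
Proof.
move=> /ler_normlP[th1 th2].
have l1 := @ln_cubic_le R th; have l2 := @ln_cubic_ge R th.
have {}l1 : ln (1 + th) <= th - th ^+ 2 / 2 + th ^+ 3 / 3 by apply: l1; lra.
have {}l2 : th - th ^+ 2 / 2 - `|th| ^+ 3 <= ln (1 + th) by apply: l2; lra.
have t3 : 0 <= `|th| ^+ 3 by rewrite exprn_ge0.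
have : th ^+ 3 <= `|th| ^+ 3 by rewrite -normrX ler_norm.
by rewrite ler_norml => *; apply/andP; split; lra.
Qed.

(** The terms of order [k], [k x] and [k th] cancel between the falling factorial, [k!], the hitting
    probability and [(1 - p) ^ (k (n - k))]. The quadratic ones add up to
    [- k (th - x / 2) ^ 2 / 2], with [x ^ 2] coefficient [- 1 / 6 + 1 / 24 = - 1 / 8]. *)
Lemma ln_mean_comps_bound (n k : nat) (p th : R) :
  let x := k%:R / n%:R in
  (0 < k)%N -> (0 < n)%N -> x <= 16^-1 -> `|th| <= 8^-1 -> p = (1 + th) / n%:R -> p <= 2^-1 ->
  `| ln ('C(n, k)%:R * (1 - (1 - p) ^+ k) ^+ k * (1 - p) ^+ (k * (n - k))) +
     (ln (2 * pi) + ln k%:R) / 2 + k%:R * (th ^+ 2 / 2 - x * th / 2 + x ^+ 2 / 8)|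
  <= 10 * (k%:R * x ^+ 3 + k%:R * `|th| ^+ 3 + k%:R * x ^+ 2 * `|th| + x + k%:R^-1).
Proof.
move=> x k0 n0 x16 th8 pE p2.
have k0' : 0 < k%:R :> R by rewrite ltr0n.
have n0' : 0 < n%:R :> R by rewrite ltr0n.
have xE : k%:R = x * n%:R by rewrite /x divfK // gt_eqF.
have x0 : 0 < x by rewrite divr_gt0.
have /ler_normlP[th1 th2] := th8.
have th98 : 1 + th <= 9 / 8 by lra.
have th0 : 0 < 1 + th by lra.
have th24 : 0 <= (2 + th) / 24 <= 1 by apply/andP; split; lra.
have x98 : 0 <= 9 / 8 * x by lra.
have c98 : (9 / 8) ^+ 3 <= 3 / 2 :> R by lra.
have k2n : (k.*2 <= n)%N.
  rewrite -(ler_nat R) -mul2n natrM xE mulrA ler_piMl //; lra.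
have kn : (k <= n)%N by apply: leq_trans k2n; rewrite -addnn leq_addr.
have p0 : 0 < p by rewrite pE divr_gt0 //; lra.
pose y := k%:R * p.
have yE : y = x * (1 + th) by rewrite /y pE xE; field; rewrite gt_eqF.
have y0 : 0 < y by rewrite mulr_gt0.
have Q0 : 0 < 1 - p by lra.
have Q1 : 1 - p < 1 by lra.
have yx : y <= 9 / 8 * x by rewrite yE mulrC ler_wpM2r ?(ltW x0) //; lra.
have y8 : k%:R * p <= 8^-1 by rewrite -/y; lra.
have h1 := ln_ffact_bound n0 k2n; have h2 := stirling_log_bound R k0.
have p02 : 0 < p <= 2^-1 by rewrite p0.
have h3 := ln_hit_bound p02 k0 y8.
have p02' : 0 <= p <= 2^-1 by rewrite ltW.
have h4 := ln1B_bound p02'.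
rewrite -/y in h3; rewrite -/x in h1.
have h5 := ln1D_bound th8.
have q0 : 0 < 1 - (1 - p) ^+ k.
  by rewrite subr_gt0 exprn_ilt1 ?(ltW Q0) -?lt0n.
have f0 : 0 < k`!%:R :> R by rewrite ltr0n fact_gt0.
have ff0 : 0 < (n ^_ k)%:R :> R by rewrite ltr0n ffact_gt0.
have C0 : 0 < 'C(n, k)%:R :> R by rewrite ltr0n bin_gt0.
have lC : ln ('C(n, k)%:R : R) = ln (n ^_ k)%:R - ln k`!%:R.
  rewrite -ln_div ?posrE //; congr ln.
  by rewrite -bin_ffact natrM mulfK // gt_eqF.
have lq : ln (1 - (1 - p) ^+ k) = ln ((1 - (1 - p) ^+ k) / y) + (ln k%:R - ln n%:R + ln (1 + th)).
  rewrite ln_div ?posrE // /y pE lnM ?posrE ?divr_gt0 //.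
  by rewrite ln_div ?posrE //; ring.
have e1 : ln ((1 - (1 - p) ^+ k) ^+ k) = k%:R * ln (1 - (1 - p) ^+ k).
  by rewrite lnXn // mulr_natl.
have e2 : ln ((1 - p) ^+ (k * (n - k))) = k%:R * (n%:R - k%:R) * ln (1 - p).
  by rewrite lnXn // -[LHS]mulr_natl natrM natrB.
have -> : ln ('C(n, k)%:R * (1 - (1 - p) ^+ k) ^+ k * (1 - p) ^+ (k * (n - k))) =
   ln 'C(n, k)%:R + ln ((1 - (1 - p) ^+ k) ^+ k) + ln ((1 - p) ^+ (k * (n - k))).
  by rewrite !lnM ?posrE ?mulr_gt0 ?exprn_gt0.
rewrite e1 e2 lq lC.
rewrite /stirling_log in h2.
have kk := ltW k0'.
have scale (a b c : R) : 0 <= c -> `|a| <= b -> `|c * a| <= c * b.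
  by move=> c0 ab; rewrite normrM (ger0_norm c0) ler_wpM2l.
have g3 := scale _ _ _ kk h3; have g5 := scale _ _ _ kk h5.
have nk0 : 0 <= k%:R * (n%:R - k%:R) :> R by rewrite mulr_ge0 // subr_ge0 ler_nat.
have g4 := scale _ _ _ nk0 h4.
have np : n%:R * p = 1 + th by rewrite pE mulrC divfK // gt_eqF.
have np2 : n%:R * p <= 9 / 8 by rewrite np.
have b4 : k%:R * (n%:R - k%:R) * p ^+ 2 <= 9 / 8 * y.
  apply: (@le_trans _ _ (k%:R * n%:R * p ^+ 2)).
    by rewrite ler_wpM2r ?sqr_ge0 // ler_wpM2l // gerBl.
  have -> : k%:R * n%:R * p ^+ 2 = n%:R * p * y by rewrite /y; ring.
  by rewrite ler_wpM2r // ltW.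
have b3 : k%:R * (2 * p + 2 * y ^+ 3) = 2 * y + 2 * (k%:R * y ^+ 3) by rewrite {2}/y; ring.
have y3 : k%:R * y ^+ 3 <= 3 / 2 * (k%:R * x ^+ 3).
  rewrite [leRHS]mulrCA; apply: ler_wpM2l => //.
  apply: (@le_trans _ _ ((9 / 8 * x) ^+ 3)).
    by rewrite lerXn2r ?nnegrE ?(ltW y0).
  by rewrite exprMn ler_wpM2r ?exprn_ge0 ?(ltW x0).
have id6 : k%:R * (n%:R - k%:R) * p = k%:R * ((1 - x) * (1 + th)).
  by rewrite -np xE; field; rewrite ?gt_eqF.
have id7 : k%:R * (y / 2 - y ^+ 2 / 24) = k%:R * (x / 2 + x * th / 2 - x ^+ 2 / 24)
   - k%:R * x ^+ 2 * (2 * th + th ^+ 2) / 24 by rewrite yE; field.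
have b7 : `|k%:R * x ^+ 2 * (2 * th + th ^+ 2) / 24| <= k%:R * x ^+ 2 * `|th|.
  have kx : 0 <= k%:R * x ^+ 2 by rewrite mulr_ge0 // sqr_ge0.
  rewrite -mulrA normrM (ger0_norm kx) ler_wpM2l //.
  have -> : (2 * th + th ^+ 2) / 24 = th * ((2 + th) / 24) by field.
  by case/andP: th24 => u0 u1; rewrite normrM ler_piMr // ger0_norm.
rewrite b3 in g3.
have kx3 : 0 <= k%:R * x ^+ 3 by rewrite mulr_ge0 // exprn_ge0 // ltW.
have kt3 : 0 <= k%:R * `|th| ^+ 3 by rewrite mulr_ge0 // exprn_ge0.
have kxt : 0 <= k%:R * x ^+ 2 * `|th| by rewrite !mulr_ge0 // sqr_ge0.
have ki : 0 < k%:R^-1 :> R by rewrite invr_gt0.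
rewrite mulrDr id6 in g4.
rewrite mulrDr mulrBr in g5.
move: g3; rewrite (_ : k%:R * (ln ((1 - (1 - p) ^+ k) / y) + y / 2 - y ^+ 2 / 24) =
  k%:R * ln ((1 - (1 - p) ^+ k) / y) + k%:R * (y / 2 - y ^+ 2 / 24)); last by ring.
rewrite id7.
move: g4 g5 h1 h2 b4 b7 y3.
move: (ln ((n ^_ k)%:R : R)) (ln (k`!%:R : R)) (ln ((1 - (1 - p) ^+ k) / y)) (ln (k%:R : R)) (ln (n%:R : R)).
move: (ln (1 + th)) (ln (2 * pi : R)) (k%:R * x ^+ 2 * (2 * th + th ^+ 2) / 24).
move: (k%:R * (n%:R - k%:R) * ln (1 - p)) (k%:R * (n%:R - k%:R) * p ^+ 2).
move: (k%:R * `|th| ^+ 3) (k%:R * x ^+ 2 * `|th|) (k%:R^-1) (k%:R * y ^+ 3) kt3 kxt ki.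
move: kx3 yx x0; clear; move: (k%:R : R) => K kx3 yx x0 a2 a3 a4 a5 kt3 kxt ki c1 c2 d1 d2 d3 f1 f2 f3 f4 f5.
move=> /ler_normlP[g4 g4'] /ler_normlP[g5 g5'] /ler_normlP[i1 i1'] /ler_normlP[i2 i2'] b4 /ler_normlP[b7 b7'] y3 /ler_normlP[g3 g3'].
rewrite ler_norml; apply/andP; split.
  lra.
lra.
Qed.

End Exponent.

Section RealHelpers.
Variable R : realType.

Lemma expR_half_ln (z : R) : 0 < z -> expR (- (ln z / 2)) = (Num.sqrt z)^-1.
Proof.
move=> z0; rewrite expRN; congr (_^-1).
have e0 := expR_gt0 (ln z / 2).
rewrite -[LHS](ger0_norm (ltW e0)) -sqrtr_sqr; congr Num.sqrt.
by rewrite -expRM_natl mulrC divfK ?pnatr_eq0 // lnK.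
Qed.

Lemma dist_expR_1 (d B : R) : `|d| <= B -> `|expR d - 1| <= `|d| * expR B.
Proof.
move=> hB; have B0 : 0 <= B by apply: le_trans hB.
have eB : 1 <= expR B by rewrite -expR0 ler_expR.
have h1 := expR_ge1Dx d; have h2 := expR_ge1Dx (- d).
have [d0|d0] := leP 0 d.
  rewrite (ger0_norm d0) in hB *; rewrite ger0_norm; last by lra.
  have e : expR d * expR (- d) = 1 by rewrite -expRD subrr expR0.
  have : expR d * (1 - d) <= 1 by rewrite -[leRHS]e ler_wpM2l ?expR_ge0 //; lra.
  have : d * expR d <= d * expR B by rewrite ler_wpM2l // ler_expR.
  lra.
have e1 : expR d <= 1 by rewrite expR_le1 ltW.
rewrite (ltr0_norm d0) ler0_norm; last by lra.
have : - d <= - d * expR B by rewrite ler_peMr //; lra.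
lra.
Qed.

End RealHelpers.

(** * Asymptotics of [mean_comps] *)

Section MeanEstimate.
Variable R : realType.

Lemma hit_prob_bounds (p y : R) (k : nat) : 0 < p < 1 -> (0 < k)%N -> y = k%:R * p ->
  y * (1 - y / 2) <= 1 - (1 - p) ^+ k <= y.
Proof.
move=> /andP[p0 p1] k0 ->; have hp : 0 <= p <= 1 by rewrite !ltW.
have b1 := bernoulli1 hp k; have b2 := bernoulli2 hp k.
have : 0 <= k%:R * p ^+ 2 by rewrite mulr_ge0 // sqr_ge0.
move=> h; apply/andP; split; lra.
Qed.

(** [busy] carries the hitting probability to the power [k - 1]; one more factor is supplied and
    divided out, to match the power [k] in [ln_mean_comps_bound]. *)
Let mean_factor (p : R) (n k : nat) : 0 < p < 1 -> (0 < k)%N ->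
  mean_comps p n k = 'C(n, k)%:R * (1 - (1 - p) ^+ k) ^+ k * (1 - p) ^+ (k * (n - k)) *
    (tree_prob p k.-1 / (1 - (1 - p) ^+ k)).
Proof.
move=> hp; case: k => [//|M] _.
have q0 := @hit_prob_gt0 _ p M hp.
rewrite /mean_comps /tree_prob /= -/(hit_prob p M) exprS.
have h1 : hit_prob p M != 0 by rewrite gt_eqF.
have h2 : hit_prob p M ^+ M != 0 by rewrite expf_neq0.
by field; rewrite h1 h2.
Qed.

(* The ratio [(t / q) / (x / 2)], with [t = tree_prob], [q] the hitting probability. *)
Let ratio_bound (F : realFieldType) (t q x y th E c : F) :
  0 < x -> `|th| <= 8^-1 -> y = x * (1 + th) -> y <= 8^-1 ->
  y * (1 - y / 2) <= q <= y -> `|t - y ^+ 2 / 2| <= 20 ^+ 2 * y ^+ 2 * (y + c) ->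
  0 <= c -> x <= E -> `|th| <= E -> c <= 2 * E -> E <= 5 ->
  `|t / q / (x / 2) - 1| <= 10 ^+ 6 * E.
Proof.
move=> x0 th8 yE y8 /andP[q1 q2] ht c0 xE thE cE E5.
have /ler_normlP[th1 th2] := th8.
have y0 : 0 < y by rewrite yE mulr_gt0 //; lra.
have q0 : 0 < q by apply: lt_le_trans q1; rewrite mulr_gt0 //; lra.
pose e1 := t / (y ^+ 2 / 2) - 1; pose e2 := y / q - 1.
have y2 : 0 < y ^+ 2 by rewrite exprn_gt0.
have -> : t / q / (x / 2) = (1 + e1) * ((1 + e2) * (1 + th)).
  rewrite /e1 /e2 !(addrC 1) !subrK.
  have -> : th + 1 = y / x by rewrite yE mulrC mulKf ?gt_eqF // addrC.
  by field; rewrite !gt_eqF.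
have yx : y <= 2 * x by rewrite yE mulrC ler_wpM2r ?(ltW x0) //; lra.
have E0 : 0 < E by lra.
have h1 : `|e1| <= 8 * 20 ^+ 2 * E.
  have -> : e1 = (t - y ^+ 2 / 2) / (y ^+ 2 / 2) by rewrite /e1; field; rewrite gt_eqF.
  rewrite normrM [X in _ * X]ger0_norm; last by rewrite invr_ge0; lra.
  rewrite ler_pdivrMr; last by lra.
  apply: (le_trans ht).
  have : y + c <= 4 * E by lra.
  move=> /(ler_wpM2l (ltW y2)); lra.
have h2 : 0 <= e2 by rewrite /e2 subr_ge0 ler_pdivlMr // mul1r.
have h3 : e2 <= y.
  rewrite /e2 lerBlDr ler_pdivrMr //.
  apply: (@le_trans _ _ ((y + 1) * (y * (1 - y / 2)))).
    have : 0 <= y ^+ 2 * (1 - y) by rewrite mulr_ge0 ?(ltW y2) //; lra.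
    lra.
  by rewrite ler_wpM2l //; lra.
pose z := (1 + e2) * (1 + th).
have zb : `|z - 1| <= 6 * E.
  move: th1 th2 thE => _ _ /ler_normlP[t1 t2].
  have h4 : e2 <= 2 * E by lra.
  have h5 : e2 <= 8^-1 by lra.
  have m1 : e2 * th <= e2 * 1 by rewrite ler_wpM2l //; move/ler_normlP: th8 => [? ?]; lra.
  have m2 : - (e2 * 1) <= e2 * th by rewrite -mulrN ler_wpM2l //; move/ler_normlP: th8 => [? ?]; lra.
  rewrite /z ler_norml; apply/andP; split; lra.
have -> : (1 + e1) * z - 1 = e1 * z + (z - 1) by ring.
apply: (le_trans (ler_normD _ _)).
rewrite normrM.
have z21 : `|z| <= 31.
  have -> : z = (z - 1) + 1 by ring.
  apply: (le_trans (ler_normD _ _)); rewrite normr1; lra.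
have : `|e1| * `|z| <= 8 * 20 ^+ 2 * E * 31 by rewrite ler_pM.
lra.
Qed.

Let near_half (F : realFieldType) (t u v : F) : t <= u / 2 + 32 * u * v -> u / 2 - 20 ^+ 2 * u * v <= t ->
  0 <= u * v -> `|t - u / 2| <= 20 ^+ 2 * u * v.
Proof. by move=> h1 h2 h3; rewrite ler_norml; apply/andP; split; lra. Qed.

Let product_bound (F : realFieldType) (u v e E : F) : 1 <= e -> 0 <= E <= 5 -> `|u - 1| <= 10 * E * e ->
  `|v - 1| <= 10 ^+ 6 * E -> `|u * v - 1| <= 10 ^+ 9 * e * E.
Proof.
move=> e1 /andP[E0 E5] hu hv.
have -> : u * v - 1 = (u - 1) * v + (v - 1) by ring.
apply: (le_trans (ler_normD _ _)); rewrite normrM.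
have vb : `|v| <= 10 ^+ 7.
  have -> : v = (v - 1) + 1 by ring.
  by apply: (le_trans (ler_normD _ _)); rewrite normr1; lra.
have : `|u - 1| * `|v| <= 10 * E * e * 10 ^+ 7 by rewrite ler_pM.
have : E <= E * e by rewrite ler_peMr.
lra.
Qed.

Definition main_a (n k : nat) (lam a : R) : R :=
  Num.sqrt (k%:R : R) / (Num.sqrt (8%:R * pi) * n%:R) * expR (- Glam lam a).

Lemma main_a_ge0 n k lam a : 0 <= main_a n k lam a.
Proof. by rewrite mulr_ge0 ?expR_ge0 // divr_ge0 ?sqrtr_ge0 // mulr_ge0 ?sqrtr_ge0. Qed.

(** [E1] in terms of [r = n^(1/60)], with a real [k] so that growth in the size can be studied. *)
Definition errE (k lam r : R) : R :=
  k ^+ 4 / r ^+ 180 + `|lam| / r ^+ 5 + `|lam| ^+ 3 * k / r ^+ 60 + r ^+ 40 / k + 1 / r ^+ 6.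

Section Scaled.
Variables (n k : nat) (r lam : R).
Hypothesis r2 : 2 <= r.
Hypothesis nr : n%:R = r ^+ 60.
Hypothesis k1 : r ^+ 40 <= k%:R.
Hypothesis k2 : k%:R <= r ^+ 45.
Hypothesis lam5 : `|lam| <= r ^+ 5.
Let p := (1 + lam / r ^+ 20) / r ^+ 60.
Let a := k%:R / r ^+ 40.
Let E := errE k%:R lam r.
Let th := lam / r ^+ 20.
Let x : R := k%:R / n%:R.

Let r1 : 1 <= r. Proof. by apply: le_trans r2; rewrite ler1n. Qed.
Let rp i : 0 < r ^+ i. Proof. by rewrite exprn_gt0 // (lt_le_trans ltr01). Qed.
Let rp1 i : 1 <= r ^+ i. Proof. by rewrite exprn_ege1. Qed.
Let rn i : r ^+ i != 0. Proof. by rewrite gt_eqF. Qed.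
Let k_gt0 : 0 < k%:R :> R. Proof. exact: lt_le_trans k1. Qed.
Let rn1 : r != 0. Proof. by rewrite gt_eqF // (lt_le_trans ltr01). Qed.
Let kn : k%:R != 0 :> R. Proof. by rewrite gt_eqF. Qed.
Let k0 : (0 < k)%N. Proof. by rewrite -(ltr0n R). Qed.
Let n0 : (0 < n)%N. Proof. by rewrite -(ltr0n R) nr. Qed.
Let rpow i j : (i <= j)%N -> (r ^+ j)^-1 <= (r ^+ i)^-1.
Proof. by move=> ij; rewrite lef_pV2 ?posrE // ler_weXn2l. Qed.
Let r15 : (r ^+ 15)^-1 <= 64^-1.
Proof.
rewrite lef_pV2 ?posrE //; apply: (@le_trans _ _ (r ^+ 6)); last by rewrite ler_weXn2l.
have -> : 64 = 2 ^+ 6 :> R by ring.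
by rewrite lerXn2r ?nnegrE // (le_trans ler01).
Qed.
Let xr : x <= (r ^+ 15)^-1.
Proof.
rewrite /x nr ler_pdivrMr // (_ : r ^+ 60 = r ^+ 15 * r ^+ 45); last by rewrite -exprD.
by rewrite mulrA mulVf // mul1r.
Qed.
Let x_gt0 : 0 < x. Proof. by rewrite /x nr divr_gt0. Qed.
Let thE : th = lam / r ^+ 20. Proof. by []. Qed.
Let thr : `|th| = `|lam| / r ^+ 20.
Proof. by rewrite /th normrM [X in _ * X]ger0_norm // invr_ge0 ltW. Qed.
Let th15 : `|th| <= (r ^+ 15)^-1.
Proof.
rewrite thr ler_pdivrMr // (_ : r ^+ 20 = r ^+ 15 * r ^+ 5); last by rewrite -exprD.
by rewrite mulrA mulVf // mul1r.
Qed.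
Let l0 : 0 <= `|lam| := normr_ge0 lam.

Let frac01 (u : R) i : 0 <= u -> u <= r ^+ i -> 0 <= u / r ^+ i <= 1.
Proof. by move=> u0 ui; rewrite divr_ge0 ?(ltW (rp i)) // ler_pdivrMr // mul1r. Qed.
Let t1 : 0 <= k%:R ^+ 4 / r ^+ 180 <= 1.
Proof.
apply: frac01; first by rewrite exprn_ge0.
by rewrite (_ : r ^+ 180 = (r ^+ 45) ^+ 4) ?lerXn2r ?nnegrE ?(ltW (rp _)) // -exprM.
Qed.
Let t2 : 0 <= `|lam| / r ^+ 5 <= 1.
Proof. exact: frac01. Qed.
Let t3 : 0 <= `|lam| ^+ 3 * k%:R / r ^+ 60 <= 1.
Proof.
apply: frac01; first by rewrite mulr_ge0 ?exprn_ge0.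
rewrite (_ : r ^+ 60 = (r ^+ 5) ^+ 3 * r ^+ 45); last by rewrite -exprM -exprD.
by rewrite ler_pM ?exprn_ge0 // lerXn2r ?nnegrE ?(ltW (rp _)).
Qed.
Let t4 : 0 <= r ^+ 40 / k%:R <= 1.
Proof. by rewrite divr_ge0 ?(ltW (rp _)) // ler_pdivrMr // mul1r. Qed.
Let t5 : 0 <= 1 / r ^+ 6 <= 1.
Proof. exact: frac01. Qed.

Lemma errE_le5 : E <= 5.
Proof.
have [/andP[_ a1] /andP[_ a2] /andP[_ a3]] := And3 t1 t2 t3.
have [/andP[_ a4] /andP[_ a5]] := conj t4 t5.
by rewrite /E /errE; lra.
Qed.

Let xE6 : x <= 1 / r ^+ 6. Proof. by rewrite div1r (le_trans xr) // rpow. Qed.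
Let xE : x <= E.
Proof.
have [/andP[a1 _] /andP[a2 _] /andP[a3 _]] := And3 t1 t2 t3.
have [/andP[a4 _] _] := conj t4 t5.
by have := xE6; rewrite /E /errE; move: x => y; lra.
Qed.
Let thE2 : `|th| <= `|lam| / r ^+ 5.
Proof. by rewrite thr ler_wpM2l // rpow. Qed.
Let thE1 : `|th| <= E.
Proof.
have [/andP[a1 _] /andP[a2 _] /andP[a3 _]] := And3 t1 t2 t3.
have [/andP[a4 _] /andP[a5 _]] := conj t4 t5.
by have := thE2; rewrite /E /errE; move: `|th| => y; lra.
Qed.
Let cE : (a / 2)^-1 <= 2 * E.
Proof.
have [/andP[a1 _] /andP[a2 _] /andP[a3 _]] := And3 t1 t2 t3.
have [/andP[a4 _] /andP[a5 _]] := conj t4 t5.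
have -> : (a / 2)^-1 = 2 * (r ^+ 40 / k%:R) by rewrite /a; field; rewrite ?rn ?rn1 ?kn.
by rewrite /E /errE; lra.
Qed.

Let expo_err : k%:R * x ^+ 3 + k%:R * `|th| ^+ 3 + k%:R * x ^+ 2 * `|th| + x + k%:R^-1 <= E.
Proof.
have e1 : k%:R * x ^+ 3 = k%:R ^+ 4 / r ^+ 180.
  rewrite /x nr (_ : r ^+ 180 = (r ^+ 60) ^+ 3); last by rewrite -exprM.
  by field; rewrite ?rn ?rn1 ?kn.
have e2 : k%:R * `|th| ^+ 3 = `|lam| ^+ 3 * k%:R / r ^+ 60.
  rewrite thr (_ : r ^+ 60 = (r ^+ 20) ^+ 3); last by rewrite -exprM.
  by field; rewrite ?rn ?rn1 ?kn.
have e3 : k%:R * x ^+ 2 * `|th| <= `|lam| / r ^+ 5.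
  have -> : k%:R * x ^+ 2 * `|th| = (k%:R ^+ 3 / (r ^+ 45) ^+ 3) * (`|lam| / r ^+ 5).
    rewrite thr /x nr.
    have -> : (r ^+ 45) ^+ 3 = r ^+ 60 * r ^+ 60 * r ^+ 15 by rewrite -exprM -!exprD.
    have -> : r ^+ 20 = r ^+ 15 * r ^+ 5 by rewrite -exprD.
    by field; rewrite ?rn ?rn1.
  rewrite ler_piMl ?divr_ge0 ?(ltW (rp _)) //.
  rewrite ler_pdivrMr; last by rewrite exprn_gt0 ?rp.
  rewrite mul1r.
  by rewrite lerXn2r ?nnegrE ?(ltW (rp _)).
have e5 : k%:R^-1 <= r ^+ 40 / k%:R by rewrite ler_peMl // invr_ge0.
have h6 := xE6; rewrite /E /errE e1 e2.
move: e3 e5 h6; move: x (k%:R * x ^+ 2 * `|th|) => y z; lra.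
Qed.

Let GlamE : Glam lam a = k%:R * (th ^+ 2 / 2 - x * th / 2 + x ^+ 2 / 8).
Proof.
rewrite /Glam /a /th /x nr.
have -> : r ^+ 60 = r ^+ 20 * r ^+ 40 by rewrite -exprD.
have -> : r ^+ 40 = r ^+ 20 * r ^+ 20 by rewrite -exprD.
by field; rewrite ?rn ?rn1.
Qed.

Lemma mean_comps_est : `|mean_comps p n k - main_a n k lam a| <=
   10 ^+ 9 * expR 50 * main_a n k lam a * E.
Proof.
have x64 : x <= 64^-1 by apply: le_trans xr r15.
have th64 : `|th| <= 64^-1 by apply: le_trans th15 r15.
have th8 : `|th| <= 8^-1 by lra.
have x16 : x <= 16^-1 by lra.
have n_gt0 : 0 < n%:R :> R by rewrite ltr0n.
have pE : p = (1 + th) / n%:R by rewrite nr.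
have /ler_normlP[th1 th2] := th8.
have k64 : 64 <= k%:R :> R.
  apply: le_trans k1; apply: (@le_trans _ _ (2 ^+ 40)).
    have -> : 64 = 2 ^+ 6 :> R by ring.
    by rewrite ler_eXn2l // ltr1n.
  by rewrite lerXn2r ?nnegrE // (le_trans ler01).
have yE : k%:R * p = x * (1 + th) by rewrite pE /x mulrA mulrAC.
have p0 : 0 < p by rewrite pE divr_gt0 //; lra.
have y8 : k%:R * p <= 8^-1.
  rewrite yE; have : x * (1 + th) <= 64^-1 * (9 / 8).
    by rewrite ler_pM ?(ltW x_gt0) //; lra.
  lra.
have p2 : p <= 2^-1.
  have : 64 * p <= k%:R * p by rewrite ler_wpM2r // ltW.
  lra.
have p01 : 0 < p < 1 by rewrite p0; lra.
have Q0 : 0 < 1 - p by lra.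
have Q1 : 1 - p < 1 by lra.
have x1 : x <= 1 by lra.
have hb := hit_prob_bounds p01 k0 erefl.
have hl := ln_mean_comps_bound k0 n0 x16 th8 pE p2.
rewrite -/x -GlamE in hl.
have hE := errE_le5.
(* Each of the five terms of [E] is at most 1 in this range; this is the origin of [expR 50] in the
   constant. *)
have hE50 : 10 * E <= 50 by lra.
have M62 : k = k.-2.+2 by move: k64; rewrite ler_nat; case: (k) => [|[|m]].
have Ek : 0 < E by apply: lt_le_trans xE.
have a1 : 1 <= a by rewrite ler_pdivlMr // mul1r.
(* Since [k x ^ 2 = a ^ 3] and [(1 + th) ^ 2 >= 1 / 8], [b = a / 2] is admissible in the bounds for
   [tree_prob], whose error [1 / b] becomes [2 / a]. *)
have b3 : (a / 2) ^+ 3 <= k%:R * (k%:R * p) ^+ 2.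
  rewrite yE /a /x nr.
  have -> : (k%:R / r ^+ 40 / 2) ^+ 3 = k%:R * (k%:R / r ^+ 60) ^+ 2 / 8.
    have -> : r ^+ 60 = r ^+ 20 * r ^+ 40 by rewrite -exprD.
    have -> : r ^+ 40 = r ^+ 20 * r ^+ 20 by rewrite -exprD.
    by field.
  have -> : k%:R * (k%:R / r ^+ 60 * (1 + th)) ^+ 2 = k%:R * (k%:R / r ^+ 60) ^+ 2 * (1 + th) ^+ 2.
    by rewrite exprMn mulrA.
  rewrite ler_wpM2l //; last by have := sqr_ge0 th; lra.
  by rewrite mulr_ge0 // sqr_ge0.
have ht : `|tree_prob p k.-1 - (k%:R * p) ^+ 2 / 2| <= 20 ^+ 2 * (k%:R * p) ^+ 2 * (k%:R * p + (a / 2)^-1).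
  have k64' : (64 <= k)%N by rewrite -(ler_nat R).
  have yk : k%:R * p = (k.-2).+2%:R * p by rewrite -M62.
  have kM : (64 <= k.-2.+2)%N by rewrite -M62.
  have a2 : 2^-1 <= a / 2 by rewrite ler_peMl // invr_ge0.
  have a0 : 0 < a / 2 by rewrite divr_gt0 // (lt_le_trans ltr01).
  have b3' : (a / 2) ^+ 3 <= (k.-2).+2%:R * (k%:R * p) ^+ 2 by rewrite -M62.
  have hu := tree_prob_ub p01 yk y8 kM a2 b3'.
  have hlo := tree_prob_lb p01 yk y8 kM a0 b3'.
  have -> : k.-1 = (k.-2).+1 by rewrite {1}M62.
  have s0 : 0 <= (k%:R * p) ^+ 2 * (k%:R * p + (a / 2)^-1).
    have kp0 : 0 <= k%:R * p by rewrite mulr_ge0 // ltW.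
    have a0' : 0 <= (a / 2)^-1 by rewrite invr_ge0 ltW.
    by rewrite mulr_ge0 ?sqr_ge0 // addr_ge0.
  exact: near_half hu hlo s0.
have a0 : 0 <= (a / 2)^-1 by rewrite invr_ge0 divr_ge0 // (le_trans ler01).
have hr := ratio_bound x_gt0 th8 yE y8 hb ht a0 xE thE1 cE hE.
rewrite mean_factor //.
have pi0 := pi_gt0 R.
have main_E : main_a n k lam a = x / 2 * expR (- ((ln (2 * pi) + ln k%:R) / 2) - Glam lam a).
  rewrite expRB -lnM ?posrE ?mulr_gt0 // expR_half_ln ?mulr_gt0 //.
  rewrite /main_a expRN mulrA; congr (_ / _).
  have -> : 8 * pi = 2 ^+ 2 * (2 * pi) :> R by ring.
  rewrite (sqrtrM _ (sqr_ge0 _)) sqrtr_sqr ger0_norm // (@sqrtrM _ (2 * pi)) ?mulr_ge0 ?(ltW pi0) //.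
  rewrite !(@sqrtrM _ 2) //.
  rewrite /x -{2}(sqr_sqrtr (ltW k_gt0)).
  have s1 : Num.sqrt (k%:R : R) != 0 by rewrite gt_eqF // sqrtr_gt0.
  have s2 : Num.sqrt (2 : R) != 0 by rewrite gt_eqF // sqrtr_gt0.
  have s3 : Num.sqrt (pi : R) != 0 by rewrite gt_eqF // sqrtr_gt0.
  by field; rewrite s1 s2 s3 gt_eqF.
set P := 'C(n, k)%:R * _ * _ in hl *.
have q0 : 0 < 1 - (1 - p) ^+ k.
  by rewrite subr_gt0 exprn_ilt1 ?(ltW Q0) -?lt0n.
have P0 : 0 < P.
  have k2n : (k <= n)%N.
    rewrite -(ler_nat R); have : x * n%:R <= n%:R by rewrite ler_piMl.
    by rewrite /x divfK // gt_eqF.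
  by rewrite /P !mulr_gt0 ?exprn_gt0 ?ltr0n ?bin_gt0.
pose d := ln P + (ln (2 * pi) + ln k%:R) / 2 + Glam lam a.
have hd : `|d| <= 10 * E by apply: (le_trans hl); rewrite ler_wpM2l.
have hd50 : `|d| <= 50 := le_trans hd hE50.
have Pd : P = expR d * expR (- ((ln (2 * pi) + ln k%:R) / 2) - Glam lam a).
  by rewrite -expRD /d -[LHS]lnK ?posrE //; congr expR; ring.
pose rho := tree_prob p k.-1 / (1 - (1 - p) ^+ k) / (x / 2).
have x2 : x / 2 != 0 by rewrite gt_eqF // divr_gt0.
have -> : P * (tree_prob p k.-1 / (1 - (1 - p) ^+ k)) = main_a n k lam a * (expR d * rho).
  rewrite main_E Pd /rho; set T := tree_prob _ _ / _; set X := x / 2 in x2 *.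
  by field.
have m0 := main_a_ge0 n k lam a.
rewrite -{2}[main_a _ _ _ _]mulr1 -mulrBr normrM ger0_norm //.
have he := dist_expR_1 hd50.
have e50 : 1 <= expR 50 :> R by rewrite -expR0 ler_expR.
have key : `|expR d * rho - 1| <= 10 ^+ 9 * expR 50 * E.
  apply: product_bound => //; first by rewrite (ltW Ek).
  by apply: (le_trans he); rewrite ler_wpM2r ?expR_ge0.
rewrite [_ * main_a _ _ _ _]mulrC -[leRHS]mulrA.
exact: ler_wpM2l m0 _ _ key.
Qed.

End Scaled.

End MeanEstimate.

(** * Summation over sizes *)

Section Laplace.
Variable R : realType.
Implicit Types lam x h : R.

Definition laplace_density lam x := Num.sqrt x * expR (- Glam lam x).
Definition laplace_tail lam x := laplace_density lam x / Glam' lam x.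

Lemma laplace_density_ge0 lam x : 0 <= laplace_density lam x.
Proof. by rewrite mulr_ge0 ?sqrtr_ge0 ?expR_ge0. Qed.

(** For [lam <= x / 3] the least value of [G'] is [7 x ^ 2 / 72], at [lam = x / 3], and this exceeds
    [x ^ 2 / 11]. The expression [3 / 4 * x - lam] is the second derivative of [G]. *)
Lemma Glam'_bounds lam x : 0 <= x -> 3 * lam <= x ->
  11^-1 * x ^+ 2 <= Glam' lam x /\
  (3 / 4 * x - lam) ^+ 2 / 2 <= Glam' lam x <= (3 / 4 * x - lam) ^+ 2.
Proof.
move=> x0 lx; rewrite /Glam'.
have h1 : 0 <= x * (x - 3 * lam) by rewrite mulr_ge0 // subr_ge0.
have h2 : 0 <= (x - 3 * lam) * (x - 3 * lam) by rewrite mulr_ge0 // subr_ge0.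
have h3 : 0 <= x * x by rewrite mulr_ge0.
have h4 : 0 <= lam * lam by rewrite -expr2 sqr_ge0.
have h5 : 0 <= (x / 2 - lam) * (x / 2 - lam) by rewrite -expr2 sqr_ge0.
by split; [lra|apply/andP; split; lra].
Qed.

Lemma Glam_increment lam x h :
  Glam lam (x + h) - Glam lam x = h * Glam' lam x + h ^+ 2 * (3 / 4 * x - lam) / 2 + h ^+ 3 / 8.
Proof. by rewrite /Glam /Glam'; field. Qed.

Lemma Glam'_increment lam x h :
  Glam' lam (x + h) = Glam' lam x + h * (3 / 4 * x - lam + 3 / 8 * h).
Proof. by rewrite /Glam'; field. Qed.

Lemma Glam_convex lam x h : 0 <= x -> 3 * lam <= x -> 0 <= h ->
  Glam lam x + Glam' lam x * h <= Glam lam (x + h).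
Proof.
move=> x0 lx h0; have := Glam_increment lam x h.
have : 0 <= h ^+ 2 * (3 / 4 * x - lam) by rewrite mulr_ge0 ?sqr_ge0 //; lra.
have : 0 <= h ^+ 3 by rewrite exprn_ge0.
lra.
Qed.

(** [g] and [g'] are the values of [G'] at [x] and [x + h], [D] is the increment of [G], and [s] the
    ratio of the square roots. The loss [w = 1 - s exp (- D)] is squeezed between
    [(h g - h u) / (1 + h g)] and [h g']. *)
Let step_core (g g' h del D s u : R) :
  0 < g -> 0 < h -> 0 <= del -> g' = g + del -> h * g <= D <= h * g' ->
  1 <= s <= 1 + h * u -> 0 <= u ->
  - (h * (u / g + h * g + del / g)) <= g^-1 - s * expR (- D) / g' - h <= del / g ^+ 2.
Proof.
move=> g0 h0 d0 g'E /andP[D1 D2] /andP[s1 s2] u0.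
have g'0 : 0 < g' by rewrite g'E ltr_wpDr.
have gg : g <= g' by rewrite g'E lerDl.
have D0 : 0 <= D by apply: le_trans D1; rewrite mulr_ge0 ?ltW.
have hg0 : 0 <= h * g by rewrite mulr_ge0 ?ltW.
pose w := 1 - s * expR (- D).
have TE : g^-1 - s * expR (- D) / g' = del / (g * g') + w / g'.
  by rewrite /w; move: (s * _) => e; rewrite g'E; field; rewrite -g'E !gt_eqF.
apply/andP; split; last first.
  have w1 : w <= h * g'.
    have e1 := expR_ge1Dx (- D); have e0 := expR_ge0 (- D).
    have : expR (- D) <= s * expR (- D) by rewrite ler_peMl.
    by rewrite /w; lra.
  have : w / g' <= h by rewrite ler_pdivrMr.
  have : del / (g * g') <= del / g ^+ 2.
    by rewrite ler_wpM2l // lef_pV2 ?posrE ?exprn_gt0 ?mulr_gt0 // expr2 ler_wpM2l // ltW.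
  rewrite TE; lra.
have w1 : (h * g - h * u) / (1 + h * g) <= w.
  have e1 : expR (- D) <= (1 + h * g)^-1.
    apply: le_trans (expRN_le_inv _) => //.
    by rewrite ler_expR lerN2.
  have : s * expR (- D) <= (1 + h * u) / (1 + h * g).
    by rewrite ler_pM ?expR_ge0 //; lra.
  rewrite /w; set e := s * _ => he.
  have -> : (h * g - h * u) / (1 + h * g) = 1 - (1 + h * u) / (1 + h * g).
    by field; rewrite gt_eqF //; lra.
  lra.
have dg : 0 <= del / g by rewrite divr_ge0 // ltW.
have dgg : 0 <= del / (g * g') by rewrite divr_ge0 // mulr_ge0 // ltW.
have ug : 0 <= u / g by rewrite divr_ge0 // ltW.
have [ul|ul] := leP g u.
  have w2 : - (h * (u - g)) <= w.
    apply: le_trans w1; rewrite -mulrBr -[g - u]opprB mulrN mulNr lerN2.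
    by rewrite ler_piMr ?mulr_ge0 ?(ltW h0) ?subr_ge0 // invf_le1; lra.
  have : - (h * (u - g)) / g <= w / g'.
    apply: (@le_trans _ _ (- (h * (u - g)) / g')); last by rewrite ler_wpM2r // invr_ge0 ltW.
    rewrite !mulNr lerN2 ler_wpM2l ?mulr_ge0 ?(ltW h0) ?subr_ge0 // lef_pV2 //.
  have -> : - (h * (u - g)) / g = - (h * (u / g)) + h by field; rewrite gt_eqF.
  have : 0 <= h * (h * g) by rewrite mulr_ge0 // ltW.
  have : 0 <= h * (del / g) by rewrite mulr_ge0 // ltW.
  rewrite TE; lra.
have w3 : h * (1 - (u / g + h * g + del / g)) <= w / g'.
  apply: (@le_trans _ _ ((h * g - h * u) / (1 + h * g) / g')); last first.
    by rewrite ler_wpM2r // invr_ge0 ltW.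
  have -> : (h * g - h * u) / (1 + h * g) / g' = h * ((g - u) / ((1 + h * g) * g')).
    by field; rewrite !gt_eqF //; lra.
  rewrite ler_wpM2l ?(ltW h0) // ler_pdivlMr; last by rewrite mulr_gt0 //; lra.
  have [v vE] : exists v, v = u / g by exists (u / g).
  have [d dE] : exists d, d = del / g by exists (del / g).
  have g'2 : g' = g * (1 + d) by rewrite g'E dE; field; rewrite gt_eqF.
  have -> : g - u = g * (1 - v) by rewrite vE; field; rewrite gt_eqF.
  rewrite -vE -dE g'2.
  have -> : (1 - (v + h * g + d)) * ((1 + h * g) * (g * (1 + d))) =
    g * ((1 - (v + h * g + d)) * ((1 + h * g) * (1 + d))) by ring.
  rewrite ler_wpM2l ?(ltW g0) //.
  rewrite -vE in ug; rewrite -dE in dg; move: (h * g) hg0 => y y0.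
  have : 0 <= v * y by rewrite mulr_ge0.
  have : 0 <= v * d by rewrite mulr_ge0.
  have : 0 <= y * d by rewrite mulr_ge0.
  have : 0 <= y * y by rewrite mulr_ge0.
  have : 0 <= d * d by rewrite mulr_ge0.
  have : 0 <= v * y * d by rewrite !mulr_ge0.
  have : 0 <= y * y * d by rewrite !mulr_ge0.
  have : 0 <= y * d * d by rewrite !mulr_ge0.
  lra.
rewrite TE; lra.
Qed.

(* [laplace_tail] is the leading term of the integral of [laplace_density]: its
   increments differ from [h * laplace_density] by a relative error of order
   [x^-1 + h G']. *)
Lemma laplace_tail_step lam x h : 1 <= x -> 3 * lam <= x -> 0 < h <= 1 ->
  `|laplace_tail lam x - laplace_tail lam (x + h) - h * laplace_density lam x| <=
  h * laplace_density lam x * (2 ^+ 7 / x + h * Glam' lam x + 10 * h).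
Proof.
move=> x1 lx /andP[h0 h1].
have x0 : 0 < x by lra.
have [b1 /andP[b2 b3]] := Glam'_bounds (ltW x0) lx.
have [w wE] : exists w, w = 3 / 4 * x - lam by exists (3 / 4 * x - lam).
rewrite -wE in b2 b3.
have w5 : 5 / 12 * x <= w by lra.
have w0 : 0 < w by lra.
have g0 : 0 < Glam' lam x by apply: lt_le_trans b1; rewrite mulr_gt0 ?exprn_gt0.
have [g gE] : exists g, g = Glam' lam x by exists (Glam' lam x).
pose del := h * (w + 3 / 8 * h).
have d0 : 0 <= del by rewrite mulr_ge0 ?(ltW h0) //; lra.
have g'E := Glam'_increment lam x h; rewrite -wE -/del -gE in g'E.
have dE := Glam_increment lam x h; rewrite -wE -gE in dE.
set D := _ - _ in dE.
have D12 : h * g <= D <= h * Glam' lam (x + h).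
  rewrite g'E dE /del.
  have : 0 <= h ^+ 2 * w by rewrite mulr_ge0 ?sqr_ge0 // ltW.
  have : 0 <= h ^+ 3 by rewrite exprn_ge0 // ltW.
  by move=> *; apply/andP; split; lra.
pose u := (2 * x)^-1.
have u0 : 0 <= u by rewrite invr_ge0; lra.
pose s := Num.sqrt (1 + h / x).
have hx : 0 <= h / x by rewrite divr_ge0 ?ltW.
have s12 : 1 <= s <= 1 + h * u.
  have hu : h * u = h / x / 2 by rewrite /u; field; rewrite gt_eqF.
  rewrite /s hu; move: (h / x) hx => t t0; apply/andP; split.
    by rewrite -[leLHS]sqrtr1 ler_wsqrtr //; lra.
  have -> : 1 + t / 2 = Num.sqrt ((1 + t / 2) ^+ 2) by rewrite sqrtr_sqr ger0_norm //; lra.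
  by rewrite ler_wsqrtr //; have := sqr_ge0 t; lra.
rewrite -gE in g0 b1 b2 b3 *.
have := step_core g0 h0 d0 g'E D12 s12 u0.
have sq : Num.sqrt (x + h) = Num.sqrt x * s.
  by rewrite /s -sqrtrM ?(ltW x0) //; congr Num.sqrt; field; rewrite gt_eqF.
have eq : expR (- Glam lam (x + h)) = expR (- Glam lam x) * expR (- D).
  by rewrite -expRD; congr expR; rewrite /D; ring.
have f0 := laplace_density_ge0 lam x.
have -> : laplace_tail lam x - laplace_tail lam (x + h) - h * laplace_density lam x =
    laplace_density lam x * (g^-1 - s * expR (- D) / Glam' lam (x + h) - h).
  rewrite /laplace_tail /laplace_density sq eq -gE.
  move: (Num.sqrt x) (expR _) (expR _) (g^-1) (Glam' lam (x + h))^-1 => *; ring.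
rewrite normrM (ger0_norm f0) (mulrC h (laplace_density _ _)).
rewrite -(mulrA (laplace_density _ _) h).
move: (g^-1 - _ / _ - h) => T /andP[t1 t2]; clear sq eq D12 s12 g'E dE hx.
have gw : 5 / 24 * w <= g.
  have : 5 / 12 * w <= w * w by rewrite ler_wpM2r ?(ltW w0) //; lra.
  rewrite -expr2; lra.
have dw : del <= 2 * h * w.
  have : h * (w + 3 / 8 * h) <= h * (2 * w) by rewrite ler_wpM2l ?(ltW h0) //; lra.
  by rewrite /del; lra.
have dg : del / g <= 10 * h.
  rewrite ler_pdivrMr //.
  have : h * (5 / 24 * w) <= h * g by rewrite ler_wpM2l // ltW.
  lra.
have gx : 11^-1 * x <= g.
  by apply: le_trans b1; rewrite ler_wpM2l // expr2 ler_peMl // ltW.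
have ix : 0 < x^-1 by rewrite invr_gt0.
have ig : g^-1 <= 11 / x.
  rewrite -[leLHS]mul1r ler_pdivrMr //.
  have -> : 11 / x * g = (11 * g) / x by rewrite mulrAC.
  by rewrite ler_pdivlMr //; lra.
have ug : u / g <= 11 / x.
  apply: le_trans ig; rewrite ler_piMl ?invr_ge0 ?(ltW g0) // invf_le1; lra.
have hg0 : 0 <= h * g by rewrite mulr_ge0 // ltW.
have dg2 : del / g ^+ 2 <= h * (2 ^+ 7 / x).
  have -> : del / g ^+ 2 = del / g / g by field; rewrite gt_eqF.
  apply: (@le_trans _ _ (10 * h * (11 / x))).
    by rewrite ler_pM // ?invr_ge0 ?divr_ge0 ?(ltW g0).
  have : 0 <= h * x^-1 by rewrite mulr_ge0 // ltW.
  lra.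
rewrite ler_wpM2l // ler_norml.
set W := 2 ^+ 7 / x + h * g + 10 * h.
have WE : h * (2 ^+ 7 / x) <= h * W by rewrite ler_wpM2l ?(ltW h0) // /W; lra.
have WE2 : h * (u / g + h * g + del / g) <= h * W.
  rewrite ler_wpM2l ?(ltW h0) // /W; lra.
apply/andP; split; lra.
Qed.

Definition growth_const : R := 120 ^+ 5.

Lemma growth_const_ge1 : 1 <= growth_const.
Proof. by rewrite exprn_ege1 // ler1n. Qed.

(** Fifth power of [1 + t <= 120 (1 + t / 120) <= 120 exp (t / 120)]. The rate [1 / 24] is chosen
    below [1 / 22], half of the decay rate that [G' x >= 1 / 11] guarantees. *)
Lemma pow5_le_expR (t : R) : 0 <= t -> (1 + t) ^+ 5 <= growth_const * expR (t / 24).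
Proof.
rewrite /growth_const => t0; have -> : t / 24 = 5%:R * (t / 120) by field.
rewrite expRM_natl -exprMn lerXn2r ?nnegrE ?mulr_ge0 ?expR_ge0 //; first lra.
have := expR_ge1Dx (t / 120); lra.
Qed.

Lemma geometric_sum_le (z : R) N : 0 <= z < 1 -> \sum_(i < N) z ^+ i <= (1 - z)^-1.
Proof.
move=> /andP[z0 z1]; rewrite -[leRHS]mul1r ler_pdivlMr ?subr_gt0 //.
have := subrX1 z N; have : 0 <= z ^+ N by rewrite exprn_ge0.
move: (\sum_(i < N) _) => S; lra.
Qed.

(* The density decays at least like [expR (- G' t)], which beats the polynomial weight. *)
Lemma laplace_weighted_sum lam x h N : 1 <= x -> 3 * lam <= x -> 0 < h -> h * Glam' lam x <= 2 ->
  \sum_(i < N) h * laplace_density lam (x + h *+ i) * (1 + h *+ i / x) ^+ 4 <=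
  4 * growth_const * laplace_tail lam x.
Proof.
move=> x1 lx h0 hg.
have x0 : 0 < x by lra.
have [b1 _] := Glam'_bounds (ltW x0) lx.
have g0 : 0 < Glam' lam x by apply: lt_le_trans b1; rewrite mulr_gt0 ?exprn_gt0.
rewrite /laplace_tail; move gE : (Glam' lam x) => g; rewrite gE in hg b1 g0.
set f := laplace_density lam x; have f0 : 0 <= f := laplace_density_ge0 lam x.
have gx : 11^-1 <= g * x.
  have : 1 <= x ^+ 2 * x by rewrite -exprSr exprn_ege1.
  have : 11^-1 * x ^+ 2 * x <= g * x by rewrite ler_wpM2r // ltW.
  lra.
pose z := expR (- (h * g / 2)).
have z0 : 0 <= z by apply: expR_ge0.
have hg0 : 0 < h * g by rewrite mulr_gt0.
have z1 : z < 1 by rewrite expR_lt1; lra.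
have term i : h * laplace_density lam (x + h *+ i) * (1 + h *+ i / x) ^+ 4 <=
    h * (growth_const * f) * z ^+ i.
  have [t tE] : exists t, t = h *+ i by exists (h *+ i).
  have t0 : 0 <= t by rewrite tE mulrn_wge0 // ltW.
  have -> : z ^+ i = expR (- (g * t / 2)).
    by rewrite /z -expRM_natl tE -mulr_natl; congr expR; field.
  rewrite -tE -[leLHS]mulrA -[leRHS]mulrA ler_wpM2l ?(ltW h0) //.
  have [v vE] : exists v, v = t / x by exists (t / x).
  have tv : t = v * x by rewrite vE divfK // gt_eqF.
  have v0 : 0 <= v by rewrite vE divr_ge0 // ltW.
  have d1 : laplace_density lam (x + t) <= f * (1 + v) * expR (- (g * t)).
    rewrite /laplace_density /f /laplace_density.
    have -> : Num.sqrt x * expR (- Glam lam x) * (1 + v) * expR (- (g * t)) =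
       (Num.sqrt x * (1 + v)) * (expR (- Glam lam x) * expR (- (g * t))) by ring.
    rewrite ler_pM ?sqrtr_ge0 ?expR_ge0 //.
      have -> : x + t = x * (1 + v) by rewrite tv; ring.
      rewrite sqrtrM ?(ltW x0) // ler_wpM2l ?sqrtr_ge0 //.
      rewrite -[leRHS]ger0_norm; last by lra.
      by rewrite -sqrtr_sqr ler_wsqrtr // expr2 ler_peMr //; lra.
    rewrite -expRD ler_expR -opprD lerN2.
    by have := Glam_convex (ltW x0) lx t0; rewrite gE.
  rewrite -vE.
  apply: (@le_trans _ _ (f * (1 + v) * expR (- (g * t)) * (1 + v) ^+ 4)).
    by rewrite ler_wpM2r // exprn_ge0 //; lra.
  have -> : f * (1 + v) * expR (- (g * t)) * (1 + v) ^+ 4 = f * ((1 + v) ^+ 5 * expR (- (g * t))).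
    by ring.
  rewrite (mulrC _ f) -[leRHS]mulrA ler_wpM2l //.
  (* One half of the decay absorbs the polynomial, as [g t / 2 = g x v / 2 >= v / 22]; the other
     half is [z ^ i] and is summed geometrically. *)
  have -> : expR (- (g * t)) = expR (- (g * t / 2)) * expR (- (g * t / 2)).
    by rewrite -expRD; congr expR; field.
  rewrite mulrA ler_wpM2r ?expR_ge0 //.
  apply: (@le_trans _ _ (growth_const * expR (v / 24) * expR (- (g * t / 2)))).
    by rewrite ler_wpM2r ?expR_ge0 // pow5_le_expR.
  rewrite -mulrA -[leRHS]mulr1 ler_wpM2l ?(le_trans ler01 growth_const_ge1) // -expRD expR_le1.
  have -> : g * t = g * x * v by rewrite tv; ring.
  have : 11^-1 * v <= g * x * v by rewrite ler_wpM2r.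
  lra.
apply: (@le_trans _ _ (\sum_(i < N) h * (growth_const * f) * z ^+ i)).
  by apply: ler_sum => i _; apply: term.
rewrite -mulr_sumr.
have cf0 : 0 <= growth_const * f by rewrite mulr_ge0 // (le_trans ler01 growth_const_ge1).
have z01 : 0 <= z < 1 by rewrite z0.
apply: (@le_trans _ _ (h * (growth_const * f) * (1 - z)^-1)).
  by rewrite ler_wpM2l ?geometric_sum_le ?(mulr_ge0 (ltW h0) cf0).
have zh : z <= (1 + h * g / 2)^-1 by rewrite /z expRN_le_inv //; lra.
have zb : h * g / 4 <= 1 - z.
  have : (1 + h * g / 2)^-1 <= 1 - h * g / 4.
    rewrite -[leLHS]mul1r ler_pdivrMr; last by lra.
    have : 0 <= h * g * (2 - h * g) by rewrite mulr_ge0 //; lra.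
    lra.
  lra.
have -> : 4 * growth_const * (f / g) = h * (growth_const * f) * (h * g / 4)^-1.
  by field; rewrite !gt_eqF.
have z3 : 0 < 1 - z by lra.
apply: ler_wpM2l; first exact: mulr_ge0 (ltW h0) cf0.
by rewrite lef_pV2 // posrE divr_gt0.
Qed.

End Laplace.

(** * Sizes above [n^(3/4)] *)

Section Tail.
Variable R : realType.

Let expR_quad (s : R) : 0 <= s <= (2 ^+ 7)^-1 -> expR s <= 1 + s + 21 / 20 * s ^+ 2.
Proof.
move=> /andP[s0 s1].
have h1 : 1 - s <= expR (- s) by have := expR_ge1Dx (- s); lra.
have h2 : expR (- s) * expR s = 1 by rewrite -expRD addNr expR0.
have e0 := expR_ge0 s.
have h3 : (1 - s) * expR s <= 1 by rewrite -[leRHS]h2 ler_wpM2r.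
have h4 : 1 <= (1 - s) * (1 + s + 21 / 20 * s ^+ 2).
  have : 0 <= s ^+ 2 * (1 - 21 * s) by rewrite mulr_ge0 ?sqr_ge0 //; lra.
  lra.
have : (1 - s) * expR s <= (1 - s) * (1 + s + 21 / 20 * s ^+ 2) by lra.
by rewrite ler_pM2l //; lra.
Qed.

(** [b] is [n^(-1/4)]. Over [b^-3] boxes depletion lowers the mean by a factor about [1 - b / 2],
    against [1 + th <= 1 + b / 5]; this is where the factor [1 / 5] in the hypothesis on [lam] is
    needed. *)
Let drift_le (F : realFieldType) (b x th y pp : F) : 0 < b <= (2 ^+ 7)^-1 -> - b <= th <= b / 5 ->
  b - b ^+ 4 <= x <= b -> 0 <= pp <= b ^+ 2 -> y = x * (1 + th) ->
  0 <= (1 + th) * (1 - y / 2 + pp / 2 + y ^+ 2 / 6) <= 1 - 7 / 25 * b.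
Proof.
move=> /andP[b0 b1] /andP[t1 t2] /andP[x1 x2] /andP[p0 p1] yE.
have b2 : b ^+ 2 <= b * (2 ^+ 7)^-1 by rewrite expr2 ler_wpM2l // ltW.
have b20 : 0 <= b ^+ 2 := sqr_ge0 b.
have b4 : b ^+ 4 <= b * (2 ^+ 7)^-1 * (2 ^+ 7)^-1.
  have -> : b ^+ 4 = b * b * b ^+ 2 by ring.
  have h : b * b <= b * (2 ^+ 7)^-1 by rewrite ler_wpM2l // ltW.
  rewrite ler_pM // ?mulr_ge0 ?(ltW b0) //; lra.
have y1 : 49 / 50 * b <= y.
  have : b * (1 - (2 ^+ 7)^-1 * (2 ^+ 7)^-1) * (1 - (2 ^+ 7)^-1) <= y.
    by rewrite yE ler_pM ?mulr_ge0 ?(ltW b0) //; lra.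
  lra.
have y2 : y <= 51 / 50 * b.
  have : y <= b * (1 + (2 ^+ 7)^-1) by rewrite yE ler_pM //; lra.
  lra.
have y22 : y ^+ 2 <= (51 / 50 * b) ^+ 2 by rewrite lerXn2r ?nnegrE //; lra.
have y20 := sqr_ge0 y.
have v1 : 1 - y / 2 + pp / 2 + y ^+ 2 / 6 <= 1 - 12 / 25 * b by lra.
have v0 : 0 <= 1 - y / 2 + pp / 2 + y ^+ 2 / 6 by lra.
apply/andP; split; first by rewrite mulr_ge0 //; lra.
have : (1 + th) * (1 - y / 2 + pp / 2 + y ^+ 2 / 6) <= (1 + b / 5) * (1 - 12 / 25 * b).
  by rewrite ler_pM //; lra.
lra.
Qed.

(** At least [J] balls must fall where at most [J (1 - 7 b / 25)] are expected. The Chernoff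
    exponent is at least [J b ^ 2 / 60], about [1 / (60 b)]; the 80 leaves room for the rounding of
    [J]. *)
Lemma survival0_tail (M J : nat) (b th p : R) : (0 < J <= M)%N -> 0 < b <= (2 ^+ 7)^-1 ->
  - b <= th <= b / 5 -> M.+1%:R = (b ^+ 4)^-1 -> p = b ^+ 4 * (1 + th) ->
  (b ^+ 3)^-1 - 1 <= J%:R <= (b ^+ 3)^-1 ->
  survival p M J 0 <= expR (- (b^-1 / 80)).
Proof.
move=> /andP[J0 JM] b01 tb ME pE /andP[J1 J2].
have /andP[b0 b1] := b01; have /andP[t1 t2] := tb.
have J0' : 1 <= J%:R :> R by rewrite ler1n.
have b4 : 0 < b ^+ 4 by rewrite exprn_gt0.
have b3 : 0 < b ^+ 3 by rewrite exprn_gt0.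
have b41 : b ^+ 4 <= b ^+ 2 * (2 ^+ 7)^-1.
  have -> : b ^+ 4 = b ^+ 2 * b * b by ring.
  rewrite -mulrA ler_wpM2l ?sqr_ge0 //.
  have : b * b <= b * 1 by rewrite ler_wpM2l ?(ltW b0) //; lra.
  lra.
have b21 : b ^+ 2 <= 1 by rewrite exprn_ile1 ?(ltW b0) //; lra.
have p0 : 0 <= p by rewrite pE mulr_ge0 ?(ltW b4) //; lra.
have pb : p <= b ^+ 2.
  have : p <= b ^+ 2 * (2 ^+ 7)^-1 * 2 by rewrite pE ler_pM ?(ltW b4) //; lra.
  have := sqr_ge0 b; lra.
have p01 : 0 <= p <= 1 by rewrite p0; lra.
(* Close to the minimiser [2 b / 15] of [21 / 20 * s ^ 2 - 7 / 25 * b * s], the leading part of the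
   exponent per box. *)
pose s := b / 8.
have s01 : 0 <= s <= (2 ^+ 7)^-1 by rewrite /s; apply/andP; split; lra.
have z1 : 1 <= expR s by rewrite -expR0 ler_expR; case/andP: s01.
have hch := survival0_chernoff p01 z1 JM.
pose q := 1 - (1 - p) ^+ J; rewrite -/q in hch.
pose y := J%:R * p.
have y0 : 0 <= y by rewrite mulr_ge0.
have q0 : 0 <= q by rewrite subr_ge0 exprn_ile1 //; lra.
have qy : q <= y * (1 - y / 2 + p / 2 + y ^+ 2 / 6).
  have := bernoulli3 p01 J.
  have : 0 <= J%:R * (3 * J%:R - 2) * p ^+ 3 by rewrite !mulr_ge0 ?exprn_ge0 //; lra.
  rewrite /q /y; lra.
pose x := J%:R * b ^+ 4.
have yE : y = x * (1 + th) by rewrite /y /x pE mulrA.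
have xb : b - b ^+ 4 <= x <= b.
  have e : b = (b ^+ 3)^-1 * b ^+ 4 by rewrite [in RHS]exprS mulrCA mulVf ?mulr1 // gt_eqF.
  have := ler_wpM2r (ltW b4) J1; have := ler_wpM2r (ltW b4) J2.
  by rewrite mulrBl -e mul1r -/x => -> ->.
have /andP[D0 D1] := drift_le b01 tb xb (introT andP (conj p0 pb)) yE.
set D := (1 + th) * _ in D0 D1.
have nq : M%:R * q <= J%:R * D.
  apply: (@le_trans _ _ (M.+1%:R * q)); first by rewrite ler_wpM2r // ler_nat.
  have -> : J%:R * D = M.+1%:R * (y * (1 - y / 2 + p / 2 + y ^+ 2 / 6)).
    by rewrite ME {1}yE /x /D; field; rewrite gt_eqF.
  by rewrite ler_wpM2l.
have zs : 0 <= expR s - 1 <= s + 21 / 20 * s ^+ 2.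
  by rewrite subr_ge0 z1; have := expR_quad s01; lra.
have h1 : survival p M J 0 <= expR (M%:R * q * (expR s - 1) - J%:R * s).
  rewrite expRD expRN expRM_natl ler_pdivlMr ?exprn_gt0 ?expR_gt0 // mulrC.
  apply: (le_trans hch); rewrite -[M%:R * q * _]mulrA expRM_natl.
  rewrite lerXn2r ?nnegrE ?expR_ge0 ?expR_ge1Dx // addr_ge0 // mulr_ge0 //.
  by case/andP: zs.
apply: (le_trans h1); rewrite ler_expR.
have /andP[zs0 zs1] := zs.
have h2 : M%:R * q * (expR s - 1) <= J%:R * D * (s + 21 / 20 * s ^+ 2).
  by rewrite ler_pM // mulr_ge0.
have h3 : J%:R * D * (s + 21 / 20 * s ^+ 2) <= J%:R * ((1 - 7 / 25 * b) * (s + 21 / 20 * s ^+ 2)).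
  rewrite -mulrA ler_wpM2l // ler_wpM2r //; lra.
clear - b0 b1 b21 b3 J1 J0' h2 h3.
have h4 : (1 - 7 / 25 * b) * (s + 21 / 20 * s ^+ 2) - s <= - (b ^+ 2 / 60).
  rewrite /s; have := sqr_ge0 b; have : 0 <= b ^+ 3 by rewrite ltW.
  lra.
have h5 : b^-1 / 80 <= J%:R * (b ^+ 2 / 60).
  have : ((b ^+ 3)^-1 - 1) * (b ^+ 2 / 60) <= J%:R * (b ^+ 2 / 60).
    by rewrite ler_wpM2r //; have := sqr_ge0 b; lra.
  have -> : ((b ^+ 3)^-1 - 1) * (b ^+ 2 / 60) = b^-1 / 60 - b ^+ 2 / 60.
    by field; rewrite gt_eqF.
  have : 2 ^+ 7 <= b^-1 by rewrite -[leLHS]invrK lef_pV2 ?posrE.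
  lra.
have : J%:R * ((1 - 7 / 25 * b) * (s + 21 / 20 * s ^+ 2) - s) <= J%:R * (- (b ^+ 2 / 60)).
  by rewrite ler_wpM2l.
lra.
Qed.

End Tail.

Definition mean_const (R : realType) : R := 10 ^+ 9 * expR 50.

Lemma mean_const_ge1 (R : realType) : 1 <= mean_const R.
Proof.
have h1 : 1 <= 10 ^+ 9 :> R by rewrite exprn_ege1 // ler1n.
have h2 : 1 <= expR 50 :> R by rewrite -expR0 ler_expR.
by rewrite -[leLHS]mulr1 /mean_const ler_pM.
Qed.

(** 13 is 1 from the first moment plus 12 from the second: [mc <= 6 K M] and [S <= 2 E]. *)
Lemma two_sided_est (R : realDomainType) (K M E mc S P : R) : 1 <= K -> 0 <= M -> 0 <= E <= 5 ->
  0 <= mc -> `|mc - M| <= K * M * E -> S <= 2 * E -> mc * (1 - S) <= P -> P <= mc ->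
  `|P - M| <= 13 * K * M * E.
Proof.
move=> K1 M0 /andP[E0 E5] mc0 /ler_normlP[m1 m2] Sb hge hle.
have KM0 : 0 <= K * M by rewrite mulr_ge0 // (le_trans ler01).
have KM : K * M * E <= K * M * 5 by rewrite ler_wpM2l.
have MK : M <= K * M by rewrite ler_peMl.
have mcS : mc * S <= mc * (2 * E) by rewrite ler_wpM2l.
have mcE : mc * (2 * E) <= 6 * (K * M) * (2 * E) by rewrite ler_wpM2r ?mulr_ge0 //; lra.
have KME : 0 <= K * M * E by rewrite mulr_ge0.
rewrite mulrBr mulr1 in hge.
by rewrite ler_norml; apply/andP; split; lra.
Qed.

(** * Part (a): the probability that [L1] equals [k] *)

Section Window.
Variables (R : realType) (n : nat) (r lam : R).
Hypothesis r2 : 2 <= r.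
Hypothesis nr : n%:R = r ^+ 60.
Hypothesis laml : - r ^+ 5 <= lam.
Hypothesis lamu : lam <= r ^+ 5 / 5.
Let p := (1 + lam / r ^+ 20) / r ^+ 60.
Let th := lam / r ^+ 20.

Let r1 : 1 <= r. Proof. by apply: le_trans r2; rewrite ler1n. Qed.
Let r0 : 0 < r. Proof. exact: lt_le_trans r1. Qed.
Let rp i : 0 < r ^+ i. Proof. by rewrite exprn_gt0. Qed.
Let rn i : r ^+ i != 0. Proof. by rewrite gt_eqF. Qed.
Let rn1 : r != 0. Proof. by rewrite gt_eqF. Qed.
Let n_gt0 : (0 < n)%N. Proof. by rewrite -(ltr0n R) nr. Qed.
Let lam5 : `|lam| <= r ^+ 5.
Proof. by rewrite ler_norml laml /=; have := rp 5; have := lamu; lra. Qed.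

Let r7 : 2 ^+ 7 <= r ^+ 7.
Proof.
by rewrite lerXn2r // ?nnegrE // ltW.
Qed.
Let r15 : (r ^+ 15)^-1 <= (2 ^+ 7)^-1.
Proof.
have r7' := r7; rewrite lef_pV2 ?posrE //.
by apply: (le_trans r7); rewrite ler_weXn2l.
Qed.

Let th_bounds : - (r ^+ 15)^-1 <= th <= (r ^+ 15)^-1 / 5.
Proof.
have e : (r ^+ 15)^-1 = r ^+ 5 / r ^+ 20.
  by rewrite (exprD r 15 5 : r ^+ 20 = _); field; rewrite rn1.
rewrite /th e -mulNr [r ^+ 5 / r ^+ 20 / 5]mulrAC.
by rewrite !ler_pM2r ?invr_gt0 // laml lamu.
Qed.

Let p01 : 0 <= p <= 1.
Proof.
have /andP[t1 t2] := th_bounds; have r15' := r15.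
have h : 1 + th <= r ^+ 60.
  apply: (@le_trans _ _ (r ^+ 7)); last by rewrite ler_weXn2l.
  have := r7; lra.
rewrite /p -/th; apply/andP; split; last by rewrite ler_pdivrMr // mul1r.
rewrite divr_ge0 ?(ltW (rp _)) //; lra.
Qed.

Lemma edge_prob_bounds : 0 <= p <= 1.
Proof. exact: p01. Qed.

Lemma L1_tail_le (J : nat) : r ^+ 45 - 1 <= J%:R <= r ^+ 45 ->
  \sum_(J.+1 <= j < n.+1) mean_comps p n j <= 2 * r ^+ 15 * expR (- (r ^+ 15 / 80)).
Proof.
move=> /andP[J1 J2].
pose b : R := (r ^+ 15)^-1.
have e3 : (b ^+ 3)^-1 = r ^+ 45 by rewrite /b exprVn invrK -exprM.
have e4 : (b ^+ 4)^-1 = r ^+ 60 by rewrite /b exprVn invrK -exprM.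
have r45 : r ^+ 7 <= r ^+ 45 by rewrite ler_weXn2l.
have J127 : 127 <= J%:R :> R by have := r7; lra.
have J0 : (0 < J)%N by rewrite -(ltr0n R); lra.
have Jn : (J < n)%N.
  rewrite -(ltr_nat R) nr; apply: (le_lt_trans J2); rewrite ltr_eXn2l //.
  by apply: lt_le_trans r2; rewrite ltr1n.
case: (n) nr Jn => [//|M] nrM Jn.
rewrite big_add1 /=.
apply: le_trans (mean_comps_tail p01 J0 Jn) _.
have hH : survival p M J 0 <= expR (- (b^-1 / 80)).
  apply: (@survival0_tail _ M J b th p) => //.
  - by rewrite J0.
  - by rewrite invr_gt0 rp r15.
  - by rewrite e4.
  - by rewrite /p /b exprVn -exprM mulrC.
  - by rewrite e3 J1.
rewrite /b invrK in hH.
rewrite ler_pM ?divr_ge0 //; first by rewrite survival_ge0 // exprn_ge0 // subr_ge0; case/andP: p01.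
rewrite ler_pdivrMr ?ltr0n // nrM (exprD r 15 45 : r ^+ 60 = _).
have -> : 2 * r ^+ 15 * J%:R = r ^+ 15 * (2 * J%:R) by ring.
by rewrite ler_wpM2l ?(ltW (rp _)) //; have := r7; lra.
Qed.

Lemma Gnp_L1_eq_est k : r ^+ 40 <= k%:R -> 3 * lam * r ^+ 40 <= k%:R -> k%:R <= r ^+ 45 ->
  `|@Gnp_prob R n p (fun E => L1 E == k) - main_a n k lam (k%:R / r ^+ 40)| <=
  13 * mean_const R * main_a n k lam (k%:R / r ^+ 40) * errE k%:R lam r.
Proof.
move=> k1 k3 k2.
have k_gt0 : 0 < k%:R :> R := lt_le_trans (rp _) k1.
have k0 : (0 < k)%N by rewrite -(ltr0n R).
have hm := @mean_comps_est _ n k r lam r2 nr k1 k2 lam5; rewrite -/p -/(mean_const R) in hm.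
have hE := @errE_le5 _ k r lam r2 k1 k2 lam5.
have K1 := mean_const_ge1 R.
set M := main_a _ _ _ _ in hm *; set E := errE _ _ _ in hm hE *.
set K := mean_const R in hm K1 *.
have M0 : 0 <= M := main_a_ge0 _ _ _ _.
have E0 : r ^+ 40 / k%:R <= E.
  have d (u v : R) : 0 <= u -> 0 < v -> 0 <= u / v by move=> ? ?; rewrite divr_ge0 // ltW.
  have a1 : 0 <= k%:R ^+ 4 / r ^+ 180 by rewrite d // exprn_ge0.
  have a2 : 0 <= `|lam| / r ^+ 5 by rewrite d.
  have a3 : 0 <= `|lam| ^+ 3 * k%:R / r ^+ 60 by rewrite d // mulr_ge0 // exprn_ge0.
  have a5 : 0 <= 1 / r ^+ 6 by rewrite d.
  by rewrite /E /errE; lra.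
pose c : R := r ^+ 40 / k%:R.
have c0 : 0 < c by rewrite divr_gt0.
have c1 : c <= 1 by rewrite /c ler_pdivrMr // mul1r.
have /andP[p0 p1] := p01.
pose x : R := k%:R / n%:R.
have n0 : 0 < n%:R :> R by rewrite ltr0n.
have x0 : 0 < x by rewrite divr_gt0.
have /andP[t1 t2] := th_bounds; have r15' := r15.
have x8 : x <= (2 ^+ 7)^-1.
  apply: le_trans r15; rewrite /x nr ler_pdivrMr // (exprD r 15 45 : r ^+ 60 = _).
  by rewrite mulrA mulVf // mul1r.
have tx : 3 * th <= x.
  rewrite /x nr /th mulrA ler_pdivrMr // mulrAC ler_pdivlMr //.
  rewrite (exprD r 20 40 : r ^+ 60 = _).
  have -> : 3 * lam * (r ^+ 20 * r ^+ 40) = 3 * lam * r ^+ 40 * r ^+ 20 by ring.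
  by rewrite ler_wpM2r // ltW.
have kn : (k <= n)%N.
  rewrite -(ler_nat R) -[leRHS]mul1r -ler_pdivrMr // -/x; lra.
have [m mE] : exists m, (n - k)%N = m.+2.
  have : 2 <= (n - k)%N%:R :> R.
    rewrite natrB //; have -> : k%:R = x * n%:R by rewrite /x divfK // gt_eqF.
    have : 2 ^+ 7 <= n%:R :> R by rewrite nr; apply: (le_trans r7); rewrite ler_weXn2l.
    have : x * n%:R <= (2 ^+ 7)^-1 * n%:R by rewrite ler_wpM2r // ltW.
    lra.
  by rewrite ler_nat; case: (n - k)%N => [|[|m]] // _; exists m.
have mp : m.+2%:R * p = (1 - x) * (1 + th).
  rewrite -mE natrB // /p -/th /x -nr; move: (n%:R : R) (gt_eqF n0) => N N0.
  by field; rewrite N0.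
(* The hypothesis [3 lam <= a] enters as [3 th <= x]: the graph on the remaining [n - k = m + 2]
   vertices is subcritical by a margin [x / 2]. *)
have mp1 : x / 2 <= 1 - m.+2%:R * p.
  rewrite mp; have [q|q] := leP 0 th.
    have : 0 <= x * th by rewrite mulr_ge0 // ltW.
    lra.
  have : 0 <= (1 - x) * (- th) by rewrite mulr_ge0 //; lra.
  lra.
have mp2 : m.+2%:R * p < 1 by lra.
have hS := sum_mean_comps_le p01 k0 mp2.
have hge := @Gnp_L1_eq_ge _ n _ p01 k k0.
have hle := @Gnp_L1_eq_le _ n _ p01 k k0.
rewrite mE in hge; set S := \sum_(_ < _ | _) _ in hS hge.
set P := Gnp_prob _ _ in hge hle *; set mc := mean_comps p n k in hm hge hle.
have mc0 : 0 <= mc by apply: mean_comps_ge0.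
have Sb : S <= 2 * E.
  apply: (le_trans hS).
  apply: (@le_trans _ _ (n%:R / k%:R ^+ 2 / (x / 2))).
    rewrite ler_pM // ?divr_ge0 ?invr_ge0 ?exprn_ge0 //; first by lra.
      by rewrite ler_wpM2r ?invr_ge0 ?exprn_ge0 // ler_nat -mE leq_subr.
    rewrite lef_pV2 ?posrE //; lra.
  have -> : n%:R / k%:R ^+ 2 / (x / 2) = 2 * c ^+ 3.
    rewrite /x nr /c (exprD r 20 40 : r ^+ 60 = _).
    rewrite (exprD r 20 20 : r ^+ 40 = _).
    by field; rewrite rn1 gt_eqF.
  have : c ^+ 3 <= c by rewrite -[leRHS]expr1 ler_wiXn2l // ltW.
  rewrite -/c in E0; lra.
have E1 : 0 <= E <= 5 by rewrite hE (le_trans _ E0) // ltW.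
exact: two_sided_est K1 M0 E1 mc0 hm Sb hge hle.
Qed.

End Window.

Section LaplaceSum.
Variable R : realType.
Implicit Types lam x h : R.

Lemma laplace_tail_ge0 lam x : 0 <= x -> 3 * lam <= x -> 0 <= laplace_tail lam x.
Proof.
move=> x0 lx; have [b _] := Glam'_bounds x0 lx.
rewrite divr_ge0 ?laplace_density_ge0 //; apply: le_trans b.
by rewrite mulr_ge0 ?sqr_ge0.
Qed.

(** From [x - 2 lam >= 3 x / 5] one gets [G >= 9 x ^ 3 / 200 >= s ^ 3 / 80]. With [s = n^(1/12)]
    this puts the boundary term of the telescoped sum within [E2]. *)
Lemma laplace_tail_le lam s x : 1 <= s -> lam <= s / 5 -> s <= x ->
  laplace_tail lam x <= 11 * expR (- (s ^+ 3 / 80)).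
Proof.
move=> s1 ls sx; have x0 : 0 <= x by lra.
have lx : 3 * lam <= x by lra.
have [b _] := Glam'_bounds x0 lx.
have x2 : 0 < x ^+ 2 by rewrite exprn_gt0 //; lra.
have g0 : 0 < Glam' lam x by apply: lt_le_trans b; lra.
have G : s ^+ 3 / 80 <= Glam lam x.
  have sx3 : s ^+ 3 <= x ^+ 3 by rewrite lerXn2r ?nnegrE //; lra.
  have -> : Glam lam x = x * (x - 2 * lam) ^+ 2 / 8 by rewrite /Glam; field.
  have : (3 / 5 * x) ^+ 2 <= (x - 2 * lam) ^+ 2 by rewrite lerXn2r ?nnegrE //; lra.
  move=> /(ler_wpM2l x0); have : 0 <= s ^+ 3 by rewrite exprn_ge0 //; lra.
  lra.
have sq : Num.sqrt x <= x ^+ 2.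
  apply: (@le_trans _ _ x); last by rewrite expr2 ler_peMl //; lra.
  rewrite -[leRHS](ger0_norm x0) -sqrtr_sqr ler_wsqrtr // expr2 ler_peMl //; lra.
rewrite /laplace_tail /laplace_density mulrAC ler_pM ?expR_ge0 ?divr_ge0 ?sqrtr_ge0 ?(ltW g0) //.
  rewrite ler_pdivrMr //; lra.
by rewrite ler_expR lerN2.
Qed.

Lemma laplace_sum lam x h N (e : nat -> R) :
  (forall i, (i < N)%N ->
     `|laplace_tail lam (x + h *+ i) - laplace_tail lam (x + h *+ i + h) -
       h * laplace_density lam (x + h *+ i)| <= e i) ->
  `|\sum_(i < N) h * laplace_density lam (x + h *+ i) -
    (laplace_tail lam x - laplace_tail lam (x + h *+ N))| <= \sum_(i < N) e i.
Proof.
elim: N => [|N IH] he; first by rewrite !big_ord0 mulr0n addr0 subrr subr0 normr0.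
rewrite !big_ord_recr /=.
have := IH (fun i iN => he i (ltnW iN)); have := he N (ltnSn N).
have -> : x + h *+ N.+1 = x + h *+ N + h by rewrite mulrSr addrA.
move: (\sum_(i < N) h * _) => S; move: (\sum_(i < N) e i) => T.
move: (laplace_tail lam x) (laplace_tail lam (x + h *+ N)) (laplace_tail lam (x + h *+ N + h)).
move: (h * laplace_density lam (x + h *+ N)) => z w u v h1 h2.
have -> : S + z - (w - v) = (S - (w - u)) - (u - v - z) by ring.
by apply: (le_trans (ler_normB _ _)); rewrite lerD.
Qed.

End LaplaceSum.

(** * Part (b): summation over the sizes from [k] on *)

Section WindowUp.
Variables (R : realType) (n k : nat) (r lam : R).
Hypothesis r2 : 2 <= r.
Hypothesis nr : n%:R = r ^+ 60.
Hypothesis laml : - r ^+ 5 <= lam.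
Hypothesis lamu : lam <= r ^+ 5 / 5.
Hypothesis k1 : r ^+ 40 <= k%:R.
Hypothesis k3 : 3 * lam * r ^+ 40 <= k%:R.
Hypothesis k2 : k%:R <= r ^+ 45.
Let p := (1 + lam / r ^+ 20) / r ^+ 60.
Let a := k%:R / r ^+ 40.
Let h := (r ^+ 40)^-1.
Let E (j : nat) := errE j%:R lam r.
Let c0 : R := (Num.sqrt (8%:R * pi))^-1.

Let r1 : 1 <= r. Proof. by apply: le_trans r2; rewrite ler1n. Qed.
Let r0 : 0 < r. Proof. exact: lt_le_trans r1. Qed.
Let rp i : 0 < r ^+ i. Proof. by rewrite exprn_gt0. Qed.
Let rn i : r ^+ i != 0. Proof. by rewrite gt_eqF. Qed.
Let rn1 : r != 0. Proof. by rewrite gt_eqF. Qed.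
Let k_gt0 : 0 < k%:R :> R. Proof. exact: lt_le_trans k1. Qed.
Let h0 : 0 < h. Proof. by rewrite invr_gt0. Qed.
Let h1 : h <= 1. Proof. by rewrite invf_le1 // exprn_ege1. Qed.
Let p01 : 0 <= p <= 1.
Proof. exact: edge_prob_bounds. Qed.
Let a1 : 1 <= a. Proof. by rewrite ler_pdivlMr // mul1r. Qed.
Let la : 3 * lam <= a. Proof. by rewrite ler_pdivlMr. Qed.

Let errE_lower (j : nat) : 0 <= E j /\ r ^+ 40 / j%:R + (r ^+ 6)^-1 <= E j.
Proof.
have d (u v : R) : 0 <= u -> 0 <= v -> 0 <= u / v by move=> ? ?; rewrite divr_ge0.
have a1' : 0 <= j%:R ^+ 4 / r ^+ 180 by rewrite d ?(ltW (rp _)) // exprn_ge0.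
have a2 : 0 <= `|lam| / r ^+ 5 by rewrite d ?(ltW (rp _)).
have a3 : 0 <= `|lam| ^+ 3 * j%:R / r ^+ 60.
  by rewrite d ?(ltW (rp _)) // mulr_ge0 // exprn_ge0.
have a4 : 0 <= r ^+ 40 / j%:R by rewrite d ?(ltW (rp _)).
have a5 : 0 <= 1 / r ^+ 6 by rewrite d ?(ltW (rp _)).
have e : (r ^+ 6)^-1 = 1 / r ^+ 6 by rewrite div1r.
by rewrite e /E /errE; split; lra.
Qed.

(** The highest power of [k] in [errE] is the fourth; it dictates the weight in
    [laplace_weighted_sum]. *)
Let errE_growth i : E (i + k) <= (1 + h *+ i / a) ^+ 4 * E k.
Proof.
have [v vE] : exists v : R, v = 1 + h *+ i / a by exists (1 + h *+ i / a).
have v1 : 1 <= v by rewrite vE lerDl divr_ge0 ?mulrn_wge0 ?(ltW h0) // (le_trans ler01).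
have v0 : 0 <= v by apply: le_trans v1.
have kv : (i + k)%N%:R = v * k%:R :> R.
  by rewrite vE natrD -[h *+ i]mulr_natl /h /a; field; rewrite ?rn ?rn1 gt_eqF.
rewrite -vE /E /errE kv; have v4 : 1 <= v ^+ 4 by rewrite exprn_ege1.
have vv : v <= v ^+ 4 by rewrite -[leLHS]expr1 ler_weXn2l.
have i5 u j : 0 <= u -> 0 <= u / r ^+ j by move=> ?; rewrite divr_ge0 ?(ltW (rp _)).
rewrite !mulrDr !lerD //.
- by rewrite exprMn -[leLHS]mulrA.
- by rewrite ler_peMl ?i5.
- have -> : `|lam| ^+ 3 * (v * k%:R) / r ^+ 60 = v * (`|lam| ^+ 3 * k%:R / r ^+ 60) by ring.
  by rewrite ler_wpM2r // i5 // mulr_ge0 // exprn_ge0.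
- have -> : r ^+ 40 / (v * k%:R) = v^-1 * (r ^+ 40 / k%:R) by rewrite invfM; ring.
  rewrite ler_wpM2r ?divr_ge0 ?(ltW (rp _)) //; apply: le_trans v4.
  by rewrite invf_le1 // (lt_le_trans ltr01).
- by rewrite ler_peMl ?i5.
Qed.

Let main_aE (i : nat) : main_a n (i + k) lam ((i + k)%N%:R / r ^+ 40) =
  c0 * (h * laplace_density lam (a + h *+ i)).
Proof.
have e : (i + k)%N%:R / r ^+ 40 = a + h *+ i.
  by rewrite natrD addrC mulrDl -[h *+ i]mulr_natl.
rewrite /main_a /laplace_density e.
have -> : (i + k)%N%:R = (r ^+ 20) ^+ 2 * (a + h *+ i) :> R.
  by rewrite -e -exprM mulrC divfK.
have s0 : Num.sqrt (8%:R * pi) != 0 :> R by rewrite gt_eqF // sqrtr_gt0 mulr_gt0 ?pi_gt0.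
rewrite sqrtrM ?sqr_ge0 // sqrtr_sqr ger0_norm ?(ltW (rp _)) // nr.
rewrite (exprD r 20 40 : r ^+ 60 = _) /c0 /h.
move: (Num.sqrt (a + _)) (expR _) (Num.sqrt _) s0 => u v w w0; field; rewrite ?rn ?rn1 w0 //.
Qed.

Definition main_b (lm x : R) : R :=
  Num.sqrt x / (Num.sqrt (8%:R * pi) * Glam' lm x) * expR (- Glam lm x).

Let main_bE : main_b lam a = c0 * laplace_tail lam a.
Proof. by rewrite /main_b /laplace_tail /laplace_density /c0 invfM; ring. Qed.

Let c01 : 0 < c0 <= 1.
Proof.
have p8 : 1 <= 8%:R * pi :> R by have := pi_ge2 R; lra.
have p0 : 0 < Num.sqrt (8%:R * pi) :> R by rewrite sqrtr_gt0 (lt_le_trans ltr01).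
by rewrite invr_gt0 p0 invf_le1 // -[leLHS]sqrtr1 ler_wsqrtr.
Qed.

Let hG x : 1 <= x -> 3 * lam <= x -> x <= r ^+ 5 -> h * Glam' lam x <= 4 / r ^+ 30.
Proof.
move=> x1 lx xr; have [_ /andP[_ b]] := Glam'_bounds (le_trans ler01 x1) lx.
have r5 := rp 5; have l1 := laml; have l2 := lamu.
have w : (3 / 4 * x - lam) ^+ 2 <= (2 * r ^+ 5) ^+ 2 by rewrite lerXn2r ?nnegrE //; lra.
have -> : 4 / r ^+ 30 = h * (2 * r ^+ 5) ^+ 2.
  by rewrite /h (exprD r 10 30 : r ^+ 40 = _); field; rewrite ?rn ?rn1.
by rewrite ler_wpM2l ?(ltW h0) // (le_trans b).
Qed.

Let weighted_sum N : \sum_(i < N) h * laplace_density lam (a + h *+ i) * E (i + k) <=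
  4 * growth_const R * laplace_tail lam a * E k.
Proof.
have ha : h * Glam' lam a <= 2.
  have : 4 / r ^+ 30 <= 2.
    rewrite ler_pdivrMr //; have : r ^+ 1 <= r ^+ 30 by rewrite ler_weXn2l.
    by rewrite expr1; have := r2; lra.
  by apply: le_trans; rewrite hG // ler_pdivrMr // -exprD.
have hw := laplace_weighted_sum N a1 la h0 ha.
have E0 : 0 <= E k.
  by have [] := errE_lower k.
apply: le_trans (ler_wpM2r E0 hw).
rewrite mulr_suml ler_sum // => i _; rewrite -[leRHS]mulrA ler_wpM2l ?errE_growth //.
by rewrite mulr_ge0 ?(ltW h0) ?laplace_density_ge0.
Qed.

(** Of the relative error in [laplace_tail_step], [2 ^ 7 / x] is [2 ^ 7] times the term
    [r ^ 40 / (i + k)] of [E], and the other two parts are at most [14 / r ^ 6]. *)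
Let step_err (J i : nat) : J%:R <= r ^+ 45 -> (i < J.+1 - k)%N ->
  `|laplace_tail lam (a + h *+ i) - laplace_tail lam (a + h *+ i + h) -
    h * laplace_density lam (a + h *+ i)| <=
  2 ^+ 7 * (h * laplace_density lam (a + h *+ i) * E (i + k)).
Proof.
move=> JR iJ; have ikJ : (i + k <= J)%N by move: iJ; clear; lia.
have [x xE] : exists x, x = a + h *+ i by exists (a + h *+ i).
have ax : a <= x by rewrite xE lerDl mulrn_wge0 // ltW.
have xk : x = (i + k)%N%:R / r ^+ 40.
  by rewrite xE natrD addrC mulrDl -[h *+ i]mulr_natl.
have xr : x <= r ^+ 5.
  rewrite xk ler_pdivrMr // -exprD; apply: le_trans JR; by rewrite ler_nat.
have x1 : 1 <= x := le_trans a1 ax.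
have lx : 3 * lam <= x := le_trans la ax.
have h01 : 0 < h <= 1 by rewrite h0 h1.
rewrite -xE; apply: (le_trans (laplace_tail_step x1 lx h01)).
rewrite [leRHS]mulrCA ler_wpM2l ?mulr_ge0 ?(ltW h0) ?laplace_density_ge0 //.
have [_ e] := errE_lower (i + k).
have hx := hG x1 lx xr.
have -> : 2 ^+ 7 / x = 2 ^+ 7 * (r ^+ 40 / (i + k)%N%:R) by rewrite xk invf_div.
have q1 : (r ^+ 30)^-1 <= (r ^+ 6)^-1 by rewrite lef_pV2 ?posrE // ler_weXn2l.
have q2 : h <= (r ^+ 6)^-1 by rewrite lef_pV2 ?posrE // ler_weXn2l.
lra.
Qed.

(** The sum is cut at [J], the integer part of [n^(3/4)]. In the additive error, 2 comes from the
    sizes above [J] and 11 from the boundary term of the telescoped sum. *)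
Lemma Gnp_L1_ge_est :
  `|@Gnp_prob R n p (fun F => (k <= L1 F)%N) - main_b lam a| <=
  (2 ^+ 7 + 13 * mean_const R) * (4 * growth_const R) * main_b lam a * E k +
  13 * (r ^+ 15 * expR (- (r ^+ 15 / 80))).
Proof.
pose J := Num.truncn (r ^+ 45).
have /andP[J2 J3] : J%:R <= r ^+ 45 < J.+1%:R by rewrite truncn_itv // ltW.
have J1 : r ^+ 45 - 1 <= J%:R by move: J3; rewrite mulrSr; lra.
have kJ : (k < J.+1)%N by rewrite -(ltr_nat R) (le_lt_trans k2).
have Jn : (J.+1 <= n.+1)%N.
  by rewrite ltnS -(ler_nat R) nr (le_trans J2) // ler_weXn2l.
rewrite Gnp_L1_ge (big_cat_nat (ltnW kJ) Jn) /=.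
have p01' := p01.
have hT := @L1_tail_le _ n r lam r2 nr laml lamu J (introT andP (conj J1 J2)).
set T1 := \sum_(J.+1 <= j < n.+1) Gnp_prob _ _.
have T01 : 0 <= T1 <= 2 * r ^+ 15 * expR (- (r ^+ 15 / 80)).
  apply/andP; split; first by apply: sumr_ge0 => j _; apply: Gnp_prob_ge0.
  apply: le_trans hT; apply: ler_sum_nat => j /andP[jJ _].
  by apply: Gnp_L1_eq_le => //; apply: leq_ltn_trans jJ.
rewrite -{1}[k]add0n big_addn big_mkord.
set N := (J.+1 - k)%N.
set S := \sum_(i < N) _.
have hS : `|S - c0 * \sum_(i < N) h * laplace_density lam (a + h *+ i)| <=
    13 * mean_const R * c0 * \sum_(i < N) h * laplace_density lam (a + h *+ i) * E (i + k).
  rewrite [c0 * _]mulr_sumr -sumrB [leRHS]mulr_sumr.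
  apply: (le_trans (ler_norm_sum _ _ _)); apply: ler_sum => i _.
  have iJ : (i + k <= J)%N by have := ltn_ord i; rewrite /N; clear; lia.
  have ki : k%:R <= (i + k)%N%:R :> R by rewrite ler_nat leq_addl.
  have hi : (i + k)%N%:R <= r ^+ 45 by apply: le_trans J2; rewrite ler_nat.
  have := Gnp_L1_eq_est r2 nr laml lamu (le_trans k1 ki) (le_trans k3 ki) hi.
  by rewrite main_aE; congr (_ <= _); rewrite /E; ring.
have hL := laplace_sum (fun i iN => step_err J2 iN); rewrite -/N in hL.
rewrite -[leRHS]mulr_sumr in hL.
have hw := weighted_sum N.
have xN : r ^+ 5 <= a + h *+ N.
  have -> : a + h *+ N = J.+1%:R / r ^+ 40.
    by rewrite -(mulr_natl h) /a /h -mulrDl -natrD subnKC // ltnW.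
  by rewrite ler_pdivlMr // -exprD ltW.
have r5 : 1 <= r ^+ 5 by rewrite exprn_ege1.
have hB := laplace_tail_le r5 lamu xN; rewrite -exprM in hB.
have hB0 : 0 <= laplace_tail lam (a + h *+ N).
  have l1 := lamu; apply: laplace_tail_ge0; lra.
have /andP[c0p c0l] := c01.
rewrite main_bE.
move: (mean_const_ge1 R) hS hL hw hB hB0; rewrite -/(E k).
set F := \sum_(i < N) h * _; set W := \sum_(i < N) h * _ * _.
move: (laplace_tail lam (a + _)) (laplace_tail lam a) (mean_const R) => BN B K K1 hS hL hw hB hB0.
have [e eE] : exists e, e = r ^+ 15 * expR (- (r ^+ 15 / 80)) by eexists.
have eB : expR (- (r ^+ 15 / 80)) <= e by rewrite eE ler_peMl ?expR_ge0 // exprn_ege1.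
have e0 : 0 <= e by apply: le_trans eB; apply: expR_ge0.
rewrite -[2 * _ * _]mulrA -eE in T01; rewrite -eE.
have -> : S + T1 - c0 * B = (S - c0 * F) + c0 * (F - (B - BN)) + (T1 - c0 * BN) by ring.
apply: (le_trans (ler_normD _ _)); apply: lerD.
  apply: (le_trans (ler_normD _ _)); rewrite normrM (gtr0_norm c0p).
  have s1 : c0 * `|F - (B - BN)| <= c0 * (2 ^+ 7 * W) by rewrite ler_wpM2l // ltW.
  have s2 : (2 ^+ 7 + 13 * K) * c0 * W <= (2 ^+ 7 + 13 * K) * c0 * (4 * growth_const R * B * E k).
    by rewrite ler_wpM2l // mulr_ge0 ?(ltW c0p) //; lra.
  apply: (le_trans (lerD hS s1)); apply: le_trans (le_trans s2 _).
    by rewrite le_eqVlt; apply/orP; left; apply/eqP; ring.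
  by rewrite le_eqVlt; apply/orP; left; apply/eqP; ring.
clear hS hL hw; have cB : c0 * BN <= BN by rewrite ler_piMl.
have cB0 : 0 <= c0 * BN by rewrite mulr_ge0 // ltW.
by have /andP[u1 u2] := T01; rewrite ler_norml; apply/andP; split; lra.
Qed.

End WindowUp.

Lemma powR_root (R : realType) (x : R) (y : R) (m d : nat) : 0 <= x -> (0 < d)%N ->
  y * d%:R = m%:R -> powR x y = powR x (1 / d%:R) ^+ m.
Proof.
move=> x0 d0 ye; rewrite -powR_mulrn ?powR_ge0 // -powRrM; congr powR.
by rewrite -ye mulrCA div1r mulVf ?mulr1 // pnatr_eq0 -lt0n.
Qed.

Theorem theorem2p1 (R : realType) :
  exists C : R, exists N : nat, forall n : nat, (0 < n)%N -> (N <= n)%N ->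
  forall (lam : R) (k : nat),
    - powR (n%:R : R) (1 / 12%:R) <= lam ->
    lam <= powR (n%:R : R) (1 / 12%:R) / 5%:R ->
    Num.max (3%:R * lam) 1 * powR (n%:R : R) (2%:R / 3%:R) <= k%:R ->
    (k%:R : R) <= powR (n%:R : R) (3%:R / 4%:R) ->
    let a : R := k%:R / powR (n%:R : R) (2%:R / 3%:R) in
    let p : R := p_nl n lam in
    let mainA : R := Num.sqrt (k%:R : R) / (Num.sqrt (8%:R * pi) * n%:R)
                      * expR (- Glam lam a) in
    let mainB : R := Num.sqrt a / (Num.sqrt (8%:R * pi) * Glam' lam a)
                      * expR (- Glam lam a) in
    `| @Gnp_prob R n p (fun E => L1 E == k) - mainA |
      <= C * `|mainA| * E1 k n lam + C * E2 R n
    /\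
    `| @Gnp_prob R n p (fun E => (k <= L1 E)%N) - mainB |
      <= C * `|mainB| * E1 k n lam + C * E2 R n.
Proof.
have K1 := mean_const_ge1 R.
have [C CE] : exists C : R, C = (2 ^+ 7 + 13 * mean_const R) * (4 * growth_const R) by eexists.
have c5 : 1 <= growth_const R := growth_const_ge1 R.
have C1 : 2 ^+ 7 + 13 * mean_const R <= C.
  by rewrite CE ler_peMr //; lra.
have C13 : 13 <= C by lra.
(* The threshold exceeds [2 ^ 60], which makes [r >= 2]; 60 is a common denominator of all the
   exponents of [n] in the statement. *)
exists C, (Num.truncn (2 ^+ 60 : R)).+1 => n n0 nN lam k.
have n_ge0 : 0 <= n%:R :> R := ler0n _ _.
pose r : R := powR n%:R (1 / 60%:R).
have rootE y m : y * 60 = m%:R -> powR (n%:R : R) y = r ^+ m by move=> ?; exact: powR_root.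
have -> : powR (n%:R : R) (1 / 12%:R) = r ^+ 5 by apply: rootE; lra.
have e23 : powR (n%:R : R) (2%:R / 3%:R) = r ^+ 40 by apply: rootE; lra.
have -> : powR (n%:R : R) (3%:R / 4%:R) = r ^+ 45 by apply: rootE; lra.
have e43 : powR (n%:R : R) (- (4%:R / 3%:R)) = (r ^+ 80)^-1.
  by rewrite powRN; congr (_^-1); apply: rootE; lra.
have nr : n%:R = r ^+ 60 by rewrite -(rootE 1) ?powRr1 ?mul1r.
have r_ge0 : 0 <= r := powR_ge0 _ _.
have r2 : 2 <= r.
  have : (2 : R) ^+ 60 < r ^+ 60.
    rewrite -nr; have /andP[_ h] := @truncn_itv R (2 ^+ 60) (exprn_ge0 _ (ler0n _ 2)).
    by apply: (lt_le_trans h); rewrite ler_nat.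
  by rewrite ltr_pXn2r ?nnegrE //; apply: ltW.
have r0 : 0 < r by apply: lt_le_trans r2.
move=> laml lamu hk k2 a p mainA mainB.
have r40 : 0 < r ^+ 40 by rewrite exprn_gt0.
rewrite e23 in hk.
have k1 : r ^+ 40 <= k%:R.
  by apply: le_trans hk; rewrite ler_peMl ?(ltW r40) // le_max lexx orbT.
have k3 : 3 * lam * r ^+ 40 <= k%:R.
  by apply: le_trans hk; rewrite ler_wpM2r ?(ltW r40) // le_max lexx.
have pE : p = (1 + lam / r ^+ 20) / r ^+ 60.
  rewrite /p /p_nl e43 nr (exprD r 20 60 : r ^+ 80 = _).
  by field; rewrite gt_eqF.
have aE : a = k%:R / r ^+ 40 by rewrite /a e23.
have E1E : E1 k n lam = errE k%:R lam r.
  rewrite /E1 /errE e23 nr -exprM.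
  have -> : powR (r ^+ 60 : R) (1 / 12%:R) = r ^+ 5 by rewrite -nr; apply: rootE; lra.
  by have -> : powR (r ^+ 60 : R) (1 / 10%:R) = r ^+ 6 by rewrite -nr; apply: rootE; lra.
have E2E : E2 R n = r ^+ 15 * expR (- (r ^+ 15 / 80)).
  by rewrite /E2; have -> : powR (n%:R : R) (1 / 4%:R) = r ^+ 15 by apply: rootE; lra.
have hA := @Gnp_L1_eq_est R n r lam r2 nr laml lamu k k1 k3 k2.
have hB := @Gnp_L1_ge_est R n k r lam r2 nr laml lamu k1 k3 k2.
have mA : mainA = main_a n k lam (k%:R / r ^+ 40) by rewrite /mainA aE.
have mB : mainB = main_b lam (k%:R / r ^+ 40) by rewrite /mainB aE.
have E20 : 0 <= E2 R n by rewrite E2E mulr_ge0 ?exprn_ge0 ?expR_ge0.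
have E10 : 0 <= E1 k n lam.
  by rewrite /E1 !addr_ge0 ?divr_ge0 ?mulr_ge0 ?exprn_ge0 ?powR_ge0 ?normr_ge0.
rewrite -pE -mA -E1E in hA; rewrite -pE -mB -E1E -E2E -CE in hB.
have C0 : 0 <= C by apply: le_trans C13.
have CA : 13 * mean_const R <= C by apply: le_trans C1; rewrite lerDr.
split.
  apply: (le_trans hA); apply: ler_wpDr; first by rewrite mulr_ge0.
  by rewrite ler_wpM2r // ler_pM ?mulr_ge0 ?ler_norm // ?(le_trans ler01 K1) // mA main_a_ge0.
by apply: (le_trans hB); rewrite lerD ?(ler_wpM2r E20) // ler_wpM2r // ler_wpM2l ?ler_norm.
Qed.
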